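(* Let $d\ge 1$, $T>0$ and $H\in(1/2,1)$. If $$H>\frac d4,$$ then: (a) $g_{tx}\in|\mathcal H|$ for every $(t,x)\in[0,T]\times\mathbb R^d$; (b) $\eta*\tilde G\in\mathcal H$ for every $\eta\in\mathcal D((0,T)\times\mathbb R^d)$. Moreover, $$\|g_{tx}\|_{\mathcal H}<\infty\ \text{ for all }(t,x)\in[0,T]\times\mathbb R^d\quad\text{if and only if}\quad H>\frac d4 .$$
   Context: $\mathcal D(U)$ is the space of infinitely differentiable functions with compact support contained in the open set $U$. For $\varphi\in L_2(0,T)$, $\mathcal F_{0,T}\varphi(\tau)=\int_0^T e^{-i\tau t}\varphi(t)\,dt$; for a function $\varphi(t,x)$ on $[0,T]\times\mathbb R^d$, $\mathcal F_{0,T}\varphi(\tau,x)=\int_0^T e^{-i\tau t}\varphi(t,x)\,dt$. Put $\alpha_H=H(2H-1)$ and $c_H=[2^{2(1-H)}\pi^{1/2}]^{-1}\Gamma(H-1/2)/\Gamma(1-H)$. $\mathcal H$ is the completion of $\mathcal D((0,T)\times\mathbb R^d)$ with respect to the inner product $$\langle\varphi,\psi\rangle_{\mathcal H}=\alpha_H\int_0^T\!\int_0^T\!\int_{\mathbb R^d}\varphi(u,x)|u-v|^{2H-2}\psi(v,x)\,dx\,dv\,du=\alpha_Hc_H\int_{\mathbb R}\int_{\mathbb R^d}\mathcal F_{0,T}\varphi(\tau,x)\overline{\mathcal F_{0,T}\psi(\tau,x)}\,|\tau|^{-(2H-1)}dx\,d\tau .$$ For a function $\varphi$ on $[0,T]\times\mathbb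 R^d$ with $\varphi(\cdot,x)\in L_2(0,T)$ for each $x$ and $\mathcal F_{0,T}\varphi$ measurable, put $\|\varphi\|_{\mathcal H}^2=\alpha_Hc_H\int_{\mathbb R}\int_{\mathbb R^d}|\mathcal F_{0,T}\varphi(\tau,x)|^2|\tau|^{-(2H-1)}dx\,d\tau\in[0,\infty]$; ''$\varphi\in\mathcal H$'' means that $\varphi$ is identified with an element of the completion, i.e. $\varphi$ is a limit in $\|\cdot\|_{\mathcal H}$ of elements of $\mathcal D((0,T)\times\mathbb R^d)$. $|\mathcal H|$ is the set of measurable $\varphi:[0,T]\times\mathbb R^d\to\mathbb R$ with $\int_0^T\int_0^T\int_{\mathbb R^d}|\varphi(u,x)||\varphi(v,x)||u-v|^{2H-2}dx\,dv\,du<\infty$. $G$ is the heat kernel: $G(t,x)=(4\pi t)^{-d/2}\exp(-|x|^2/(4t))$ for $t>0$ and $G(t,x)=0$ for $t\le0$. $g_{tx}(s,y)=G(t-s,x-y)$. $\tilde G(s,y)=G(-s,-y)$, and for $\eta\in\mathcal D((0,T)\times\mathbb R^d)$ (extended by $0$), $(\eta*\tilde G)(t,x)=\int_0^\infty\int_{\mathbb R^d}\eta(t+s,x+y)G(s,y)\,dy\,ds$, considered for $t\in[0,T]$. *)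

(* Defs.v *)
From HB Require Import structures.
From mathcomp Require Import all_boot all_order all_algebra.
From mathcomp Require Import all_classical all_reals all_analysis.
From mathcomp Require Import complex.

Set Implicit Arguments.
Unset Strict Implicit.
Unset Printing Implicit Defensive.

Import Order.TTheory GRing.Theory Num.Theory.
Import numFieldNormedType.Exports.

Local Open Scope classical_set_scope.
Local Open Scope ring_scope.

(* The library has no measurable structure on row vectors: 'rV[T]_n gets the
   sigma-algebra generated by the coordinates, as n.-tuple T does.  For T the
   Borel line it is the Borel sigma-algebra of 'rV[R]_n. *)
Definition measure_rV_display : measure_display -> measure_display.
Proof. exact. Qed.

Section measurable_rV.
Context {d : measure_display} {T : measurableType d}.
Variable n : nat.

Let coors : 'I_n -> 'rV[T]_n -> T := fun i x => x ord0 i.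

Let rV_set0 : g_sigma_preimage coors set0.
Proof. exact: sigma_algebra0. Qed.

Let rV_setC A : g_sigma_preimage coors A -> g_sigma_preimage coors (~` A).
Proof. exact: sigma_algebraC. Qed.

Let rV_bigcup (F : (set 'rV[T]_n)^nat) :
  (forall i, g_sigma_preimage coors (F i)) ->
  g_sigma_preimage coors (\bigcup_i (F i)).
Proof. exact: sigma_algebra_bigcup. Qed.

HB.instance Definition _ := @isMeasurable.Build (measure_rV_display d)
  'rV[T]_n (g_sigma_preimage coors) rV_set0 rV_setC rV_bigcup.

End measurable_rV.

Section measurable_rV_theory.
Context d0 (X : measurableType d0) d (T : measurableType d).

Lemma measurable_coord n (i : 'I_n) :
  measurable_fun [set: 'rV[T]_n] (fun x : 'rV[T]_n => x ord0 i).
Proof.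
move=> _ Y mY; rewrite setTI; apply: sub_sigma_algebra => /=.
rewrite -bigcup_seq/=; exists i => /=; first by rewrite mem_index_enum.
by exists Y => //; rewrite setTI.
Qed.

Lemma measurable_fun_rV n (f : X -> 'rV[T]_n) :
  (forall i, measurable_fun [set: X] (fun x => f x ord0 i)) ->
  measurable_fun [set: X] f.
Proof.
move=> mf.
have sub : g_sigma_preimage (fun i x => f x ord0 i) `<=` measurable.
  apply: smallest_sub; first exact: sigma_algebra_measurable.
  rewrite -bigcup_seq; apply: bigcup_sub => i _ A [B mB <-].
  exact: mf.
move=> _ A mA; apply: sub.
rewrite (g_sigma_preimage_comp (fun i (x : 'rV[T]_n) => x ord0 i)).
by exists A.
Qed.

End measurable_rV_theory.

(* The library proves this, but its canonical instance on m1 \x m2 is keyed to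
   subprobabilities only and is not found for general m1 and m2. *)
Lemma sigma_finite_product (R : realType) d1 d2 (T1 : measurableType d1)
    (T2 : measurableType d2) (m1 : {sigma_finite_measure set T1 -> \bar R})
    (m2 : {sigma_finite_measure set T2 -> \bar R}) :
  sigma_finite setT (m1 \x m2)%E.
Proof.
have /sigma_finiteP[F [TF ndF Foo]] := sigma_finiteT m1.
have /sigma_finiteP[G [TG ndG Goo]] := sigma_finiteT m2.
exists (fun n => F n `*` G n).
  rewrite -setXTT TF TG predeqE => -[x y]; split.
    move=> [/= [n _ Fnx] [k _ Gky]]; exists (maxn n k) => //; split.
    - by move: x Fnx; exact/subsetPset/ndF/leq_maxl.
    - by move: y Gky; exact/subsetPset/ndG/leq_maxr.
  by move=> [n _ []/= ? ?]; split; exists n.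
move=> k; have [? ?] := Foo k; have [? ?] := Goo k.
split; first exact: measurableX.
by rewrite product_measure1E// lte_mul_pinfty// ge0_fin_numE.
Qed.

Section lebesgue_rV.
Context {R : realType}.

Definition consrV n (p : R * 'rV[R]_n) : 'rV[R]_n.+1 :=
  \row_(i < n.+1) oapp (fun j => p.2 ord0 j) p.1 (unlift ord0 i).

Definition unconsrV n (x : 'rV[R]_n.+1) : R * 'rV[R]_n :=
  (x ord0 ord0, \row_(i < n) x ord0 (lift ord0 i)).

Lemma consrV0 n (p : R * 'rV[R]_n) : consrV p ord0 ord0 = p.1.
Proof. by rewrite mxE unlift_none. Qed.

Lemma consrVS n (p : R * 'rV[R]_n) i : consrV p ord0 (lift ord0 i) = p.2 ord0 i.
Proof. by rewrite mxE liftK. Qed.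

Lemma consrVK n : cancel (@consrV n) (@unconsrV n).
Proof.
move=> [a v]; rewrite /unconsrV consrV0; congr pair.
by apply/rowP => i; rewrite mxE consrVS.
Qed.

Lemma measurable_consrV n : measurable_fun [set: R * 'rV[R]_n] (@consrV n).
Proof.
apply: measurable_fun_rV => i.
have [->|] := eqVneq i ord0.
  rewrite (_ : (fun p => _) = fst) //.
  by apply/funext => p; rewrite consrV0.
rewrite eq_sym => /unlift_some[j -> _].
rewrite (_ : (fun p => _) = (fun v : 'rV[R]_n => v ord0 j) \o snd);
  last by apply/funext => p; rewrite consrVS.
exact: (measurableT_comp (measurable_coord j) measurable_snd).
Qed.

Lemma measurable_unconsrV n : measurable_fun [set: 'rV[R]_n.+1] (@unconsrV n).
Proof.
apply/measurable_fun_pairP; split; first exact: measurable_coord.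
apply: measurable_fun_rV => i.
rewrite (_ : (fun x => _) = fun x : 'rV[R]_n.+1 => x ord0 (lift ord0 i));
  last by apply/funext => x; rewrite mxE.
exact: measurable_coord.
Qed.

Section step.
Variables (n : nat) (m : {sigma_finite_measure set 'rV[R]_n -> \bar R}).

Definition lebesgue_rV_step : set 'rV[R]_n.+1 -> \bar R :=
  pushforward (@lebesgue_measure R \x m)%E (@consrV n).

Let step0 : lebesgue_rV_step set0 = 0%E.
Proof. by rewrite /lebesgue_rV_step /pushforward preimage_set0 measure0. Qed.

Let step_ge0 A : (0 <= lebesgue_rV_step A)%E.
Proof. by rewrite /lebesgue_rV_step /pushforward; exact: measure_ge0. Qed.

Let step_sigma_additive : semi_sigma_additive lebesgue_rV_step.
Proof.
exact: (@measure_semi_sigma_additive _ _ _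
  (measure_function_pushforward__canonical__measure_function_Measure
     (@lebesgue_measure R \x m)%E (@measurable_consrV n))).
Qed.

HB.instance Definition _ := isMeasure.Build _ _ _ lebesgue_rV_step
  step0 step_ge0 step_sigma_additive.

Let step_sigma_finite : sigma_finite setT lebesgue_rV_step.
Proof.
have [F FT mF] := sigma_finite_product (@lebesgue_measure R) m.
exists (fun k => @unconsrV n @^-1` F k).
  by rewrite -preimage_bigcup -FT preimage_setT.
move=> k; have [mFk Fk] := mF k; split.
  by rewrite -[X in measurable X]setTI; exact: measurable_unconsrV.
rewrite /lebesgue_rV_step /pushforward -comp_preimage.
by rewrite (_ : _ \o _ = id) //; apply/funext => p /=; rewrite consrVK.
Qed.

HB.instance Definition _ :=
  Measure_isSigmaFinite.Build _ _ _ lebesgue_rV_step step_sigma_finite.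

End step.

(* n-dimensional Lebesgue measure: the n-fold product of lebesgue_measure, carried
   to row vectors; on the one-point space 'rV[R]_0 it is the unit mass. *)
Fixpoint lebesgue_rV (n : nat) : {sigma_finite_measure set 'rV[R]_n -> \bar R} :=
  match n with
  | 0 => [the {sigma_finite_measure set 'rV[R]_0 -> \bar R} of \d_(0 : 'rV[R]_0)]
  | k.+1 => [the {sigma_finite_measure set 'rV[R]_k.+1 -> \bar R} of
              lebesgue_rV_step (lebesgue_rV k)]
  end.
End lebesgue_rV.

(* C^infinity, through iterated directional derivatives 'D_vn ... 'D_v1 f rather
   than partial derivatives, so that no basis of V is needed. *)
Definition smooth (R : realType) (V : normedModType R) (f : V -> R) : Prop :=
  forall (vs : seq V) (x : V),
    differentiable (foldr (fun v g => fun y => 'D_v g y) f vs) x.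

(* An element of D(U) is represented by its extension by 0 to the whole space. *)
Definition test_function (R : realType) (V : normedModType R) (U : set V)
    (f : V -> R) : Prop :=
  [/\ smooth f,
      compact (closure [set x | f x != 0]) &
      closure [set x | f x != 0] `<=` U].

Section spaces.
Context {R : realType}.
Variables (d : nat) (T H : R).

Local Notation lambda := (@lebesgue_measure R).
Local Notation mu := (@lebesgue_rV R d).

(* Functions on [0,T] x R^d are total functions on R x R^d of which only the
   values at times in [0,T] are ever used. *)
Implicit Types phi : R * 'rV[R]_d -> R.

(* Euler's integral, meaningful for 0 < s. *)
Definition Gamma (s : R) : R :=
  \int[lambda]_(t in `]0, +oo[) (t `^ (s - 1) * expR (- t)).

Definition alphaH : R := H * (2 * H - 1).

Definition cH : R :=
  (2 `^ (2 * (1 - H)) * pi `^ (2^-1))^-1 * (Gamma (H - 2^-1) / Gamma (1 - H)).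

(* exp(- i tau t) = cos (tau t) - i sin (tau t), integrated componentwise since
   the library integral is real-valued. *)
Definition fourier0T (f : R -> R) (tau : R) : complex R :=
  Complex (\int[lambda]_(t in `[0, T]) (cos (tau * t) * f t))
          (- \int[lambda]_(t in `[0, T]) (sin (tau * t) * f t)).

Definition fourier0Tx phi (tau : R) (x : 'rV[R]_d) : complex R :=
  fourier0T (fun t => phi (t, x)) tau.

Definition L2_0T (f : R -> R) : Prop :=
  measurable_fun (`[0, T] : set R) f /\
  (\int[lambda]_(t in `[0%R, T]) (`|f t| ^+ 2)%:E < +oo)%E.

(* The weight |tau|^-(2H-1) has value 0 at tau = 0, a null set. *)
Definition calH_norm2 phi : \bar R :=
  ((alphaH * cH)%:E *
   \int[lambda]_tau \int[mu]_x
     ((ComplexField.Normc.normc (fourier0Tx phi tau x)) ^+ 2 *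
      `|tau| `^ (- (2 * H - 1)))%:E)%E.

Definition calH_norm phi : \bar R := sqrte (calH_norm2 phi).

Definition calH_admissible phi : Prop :=
  [/\ forall x : 'rV[R]_d, L2_0T (fun t => phi (t, x)),
      measurable_fun [set: R * 'rV[R]_d]
        (fun p => complex.Re (fourier0Tx phi p.1 p.2)) &
      measurable_fun [set: R * 'rV[R]_d]
        (fun p => complex.Im (fourier0Tx phi p.1 p.2))].

Definition spacetime : set (R * 'rV[R]_d) := `]0, T[ `*` setT.

Definition in_calH phi : Prop :=
  calH_admissible phi /\
  exists phi_ : nat -> R * 'rV[R]_d -> R,
    (forall n, test_function spacetime (phi_ n)) /\
    (fun n => calH_norm (fun p => phi p - phi_ n p)) @ \oo --> 0%E.

Definition in_abs_calH phi : Prop :=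
  measurable_fun ((`[0, T] : set R) `*` [set: 'rV[R]_d]) phi /\
  (\int[lambda]_(u in `[0%R, T]) \int[lambda]_(v in `[0%R, T]) \int[mu]_x
     (`|phi (u, x)| * `|phi (v, x)| * `|u - v| `^ (2 * H - 2))%:E < +oo)%E.

End spaces.

Section heat.
Context {R : realType}.
Variable d : nat.

(* The library norm on 'rV[R]_d is the sup norm. *)
Definition sqnorm (x : 'rV[R]_d) : R := \sum_(i < d) x ord0 i ^+ 2.

Definition heat (t : R) (x : 'rV[R]_d) : R :=
  if 0 < t then (4 * pi * t) `^ (- (d%:R / 2)) * expR (- (sqnorm x / (4 * t)))
  else 0.

(* For t > 0, heat_tx t x (., y) fails to be in L2(0,T) at y = x, where
   fourier0Tx may be a junk value: a null set of y, invisible to calH_norm. *)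
Definition heat_tx (t : R) (x : 'rV[R]_d) (p : R * 'rV[R]_d) : R :=
  heat (t - p.1) (x - p.2).

(* eta * G~ with G~(s, y) = G(-s, -y), after the substitution (s,y) -> (-s,-y). *)
Definition conv_heat_rev (eta : R * 'rV[R]_d -> R) (p : R * 'rV[R]_d) : R :=
  \int[@lebesgue_measure R]_(s in `[0, +oo[) \int[@lebesgue_rV R d]_y
    (eta (p.1 + s, p.2 + y) * heat s y).

End heat.

(* Main.v *)
Require Import Defs.
From HB Require Import structures.
From mathcomp Require Import all_boot all_order all_algebra.
From mathcomp Require Import all_classical all_reals all_analysis.
From mathcomp Require Import measurable_realfun ring lra.

(** The squared norm of H is a constant times the spectral form, the integral of
    |F phi|^2 |tau|^(1-2H).  Everything rests on comparing it with the kernel form,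
    the integral of |phi(u, x)| |phi(v, x)| |u - v|^(2H-2), without the Fourier
    transform of |tau|^(1-2H), which makes sense only for distributions.  With h = 2H - 1,
    the weight |tau|^(-h) is a positive mixture over l > 0 of the Laplace kernels
    exp(- l |tau|), with density l^(h-1) (laplace_powR).  For f integrable on [0, T],
    the integral of |F f|^2 against a Laplace kernel converges absolutely, and
    Fubini's theorem turns it into a quadratic form of f with the Cauchy kernel
    2 l / (l^2 + (u - v)^2) (fourier_laplace).  The same mixture of these kernels is a multiple of
    |u - v|^(h-1) = |u - v|^(2H-2) (cauchy_powR).  The Cauchy kernels being positive,
    a nonnegative phi gives an identity, by Tonelli and hence even when both sides
    are infinite, and a phi of any sign gives an inequality: this is
    spectral_kernel.

    For the heat kernel, integrating over space with the semigroup property and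
    setting a = t - u, b = t - v turns the kernel form into the integral over
    [0, t]^2 of (4 pi (a + b))^(-d/2) |a - b|^(2H-2).  The integrand is homogeneous of
    degree 2H - 2 - d/2 in dimension 2, so that the integral is finite exactly when
    d/2 < 2H (overlap_lty, overlap_infty).  Since the heat kernel is nonnegative, this
    settles both its membership in |H| and the finiteness of its norm.

    For the convolution of eta with the time-reversed heat kernel, Schur's test bounds
    the kernel form by the squared L^2 norm (kernel_form_le_sqnorm2), so approximation
    in L^2 is approximation in H.  The convolution is bounded because eta is and the
    heat kernel has mass at most 1 at each time, over a time interval of length T; it
    is integrable over [0, T] x R^d because eta is (conv_bounded, conv_integrable).
    Hence it lies in L^2, where test functions are dense (approximableP): open boxes
    are approximated by products of the flat functions exp(- 1 / x), and Dynkin's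
    theorem extends this to measurable sets. *)

Set Implicit Arguments.
Unset Strict Implicit.
Unset Printing Implicit Defensive.

Import Order.TTheory GRing.Theory Num.Theory.
Import numFieldNormedType.Exports.

Local Open Scope classical_set_scope.
Local Open Scope ring_scope.

(** * Measurability and iterated integrals *)

Lemma measurable_EFin_on d (T : measurableType d) (R : realType) (D : set T)
  (f : T -> R) : measurable_fun [set: T] f ->
  measurable_fun D (fun x => (f x)%:E).
Proof. by move=> mf; apply/measurable_EFinP; exact: measurable_funTS. Qed.

Lemma measurable_patch d (T : measurableType d) (R : realType) (D : set T)
  (f : T -> \bar R) : measurable D -> measurable_fun [set: T] f ->
  measurable_fun [set: T] (f \_ D).
Proof.
by move=> mD mf; apply/(measurable_restrictT _ mD); exact: measurable_funTS.
Qed.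

(** The real power x `^ (-1) is not the inverse at negative x: the identity
    x^-1 = x * (x ^ 2)^-1 moves the inverse to nonnegative arguments. *)
Lemma measurable_invr (R : realType) : measurable_fun [set: R] (@GRing.inv R).
Proof.
rewrite (_ : @GRing.inv R = fun x => x * (x ^+ 2) `^ (-1)).
  apply: measurable_funM => //.
  apply: (@measurableT_comp _ _ _ _ _ _ (fun y : R => y `^ (-1)) _ (fun x : R => x ^+ 2)).
    exact: measurable_powR.
  exact: measurable_funX.
apply/funext => x; rewrite powR_inv1 ?sqr_ge0// expr2.
by have [->|x0] := eqVneq x 0; [rewrite invr0 mul0r|field].
Qed.

Section parametric_integrals.
Context d1 d2 (T1 : measurableType d1) (T2 : measurableType d2) (R : realType).
Variables (m1 : {sigma_finite_measure set T1 -> \bar R}).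
Variables (m2 : {sigma_finite_measure set T2 -> \bar R}).

(** Here and in the next three lemmas, integrals over the subsets A and B reduce to
    integrals over whole spaces by extending the integrand by 0. *)
Lemma measurable_int_param (B : set T2) (f : T1 * T2 -> \bar R) :
  measurable B -> measurable_fun setT f ->
  measurable_fun setT (fun x => \int[m2]_(y in B) f (x, y))%E.
Proof.
move=> mB mf; pose g := fun p : T1 * T2 => ((f \_ (setT `*` B)) p)%E.
have mg : measurable_fun setT g.
  by apply/(measurable_restrictT _ (measurableX measurableT mB)); exact: measurable_funTS.
rewrite (_ : (fun x => _) =
    (fun x => \int[m2]_y g^\+ (x, y) - \int[m2]_y g^\- (x, y))%E).
  apply: emeasurable_funB.
  - apply: (measurable_fun_fubini_tonelli_F (m2 := m2) g^\+%E) => //.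
    exact: measurable_funepos.
  - apply: (measurable_fun_fubini_tonelli_F (m2 := m2) g^\-%E) => //.
    exact: measurable_funeneg.
apply/funext => x; rewrite integral_mkcond integralE; congr (_ - _)%E;
  apply: eq_integral => y _; rewrite /g !(funeposE,funenegE) !patchE/=;
  congr (maxe _ _); rewrite ?in_setX ?in_setT//=.
Qed.

Lemma measurable_Rint_param (B : set T2) (f : T1 * T2 -> R) :
  measurable B -> measurable_fun setT f ->
  measurable_fun setT (fun x => \int[m2]_(y in B) f (x, y)).
Proof.
move=> mB mf; apply: measurableT_comp => //.
apply: (@measurable_int_param B (EFin \o f)) => //.
exact: measurableT_comp.
Qed.

Lemma tonelli_in (A : set T1) (B : set T2) (f : T1 * T2 -> \bar R) :
  measurable A -> measurable B -> measurable_fun setT f ->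
  (forall p, 0 <= f p)%E ->
  (\int[m1]_(x in A) \int[m2]_(y in B) f (x, y) =
   \int[m2]_(y in B) \int[m1]_(x in A) f (x, y))%E.
Proof.
move=> mA mB mf f0; pose g := fun p : T1 * T2 => ((f \_ (A `*` B)) p)%E.
have mg : measurable_fun setT g.
  by apply/(measurable_restrictT _ (measurableX mA mB)); exact: measurable_funTS.
have g0 p : (0 <= g p)%E by rewrite /g patchE; case: ifPn.
have := fubini_tonelli (m1 := m1) (m2 := m2) g mg g0.
rewrite [in LHS](_ : (fun x => _) =
    (fun x => (((fun x => \int[m2]_(y in B) f (x, y)) \_ A) x)%E)); last first.
  apply/funext => x; rewrite patchE; case: ifPn => xA.
    rewrite [RHS]integral_mkcond; apply: eq_integral => y _.
    by rewrite /g !patchE/= in_setX/= xA.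
  by apply: integral0_eq => y _; rewrite /g patchE/= in_setX/= (negbTE xA).
rewrite -integral_mkcond => ->.
rewrite [RHS]integral_mkcond; apply: eq_integral => y _; rewrite patchE.
case: ifPn => yB.
  rewrite [RHS]integral_mkcond; apply: eq_integral => x _.
  by rewrite /g !patchE/= in_setX/= yB andbT.
by apply: integral0_eq => x _; rewrite /g patchE/= in_setX/= (negbTE yB) andbF.
Qed.

Lemma fubini_in (A : set T1) (B : set T2) (f : T1 * T2 -> \bar R) :
  measurable A -> measurable B -> measurable_fun setT f ->
  (\int[m1]_(x in A) \int[m2]_(y in B) `|f (x, y)| < +oo)%E ->
  (\int[m1]_(x in A) \int[m2]_(y in B) f (x, y) =
   \int[m2]_(y in B) \int[m1]_(x in A) f (x, y))%E.
Proof.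
move=> mA mB mf foo; pose g := fun p : T1 * T2 => ((f \_ (A `*` B)) p)%E.
have mg : measurable_fun setT g.
  by apply/(measurable_restrictT _ (measurableX mA mB)); exact: measurable_funTS.
have key (h : T1 * T2 -> \bar R) :
   ((fun x => \int[m2]_y (h \_ (A `*` B)) (x, y)) =
    (fun x => (((fun x => \int[m2]_(y in B) h (x, y)) \_ A) x)))%E.
  apply/funext => x; rewrite patchE; case: ifPn => xA.
    rewrite [RHS]integral_mkcond; apply: eq_integral => y _.
    by rewrite !patchE/= in_setX/= xA.
  by apply: integral0_eq => y _; rewrite patchE/= in_setX/= (negbTE xA).
have ig : (m1 \x m2)%E.-integrable setT g.
  apply/integrable12ltyP; first exact: mg.
  rewrite (_ : (fun x => _) = (fun x => \int[m2]_y ((abse \o f) \_ (A `*` B)) (x, y))%E).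
    by rewrite key -integral_mkcond.
  apply/funext => x; apply: eq_integral => y _.
  by rewrite /g !patchE; case: ifPn => //; rewrite abse0.
have := Fubini ig; rewrite /g key -integral_mkcond => ->.
rewrite [RHS]integral_mkcond; apply: eq_integral => y _; rewrite patchE.
case: ifPn => yB.
  rewrite [RHS]integral_mkcond; apply: eq_integral => x _.
  by rewrite /g !patchE/= in_setX/= yB andbT.
by apply: integral0_eq => x _; rewrite /g patchE/= in_setX/= (negbTE yB) andbF.
Qed.

End parametric_integrals.

(** Lebesgue measure on the line lives on an alias of R whose sigma-algebra is
    that of R only up to conversion.  The instances below of the preceding
    lemmas have types in which only R occurs, so that they unify with statements
    about functions on products of R. *)
Section line.
Context d (X : measurableType d) {R : realType}.
Local Notation lambda := (@lebesgue_measure R).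

Lemma measurable_int_line (B : set R) (f : X * R -> \bar R) :
  measurable B -> measurable_fun [set: X * R] f ->
  measurable_fun [set: X] (fun x => \int[lambda]_(y in B) f (x, y))%E.
Proof. exact: (@measurable_int_param _ _ X (measurableTypeR R) R lambda B f). Qed.

Lemma measurable_Rint_line (B : set R) (f : X * R -> R) :
  measurable B -> measurable_fun [set: X * R] f ->
  measurable_fun [set: X] (fun x => \int[lambda]_(y in B) f (x, y)).
Proof. exact: (@measurable_Rint_param _ _ X (measurableTypeR R) R lambda B f). Qed.

Lemma tonelli_line (m : {sigma_finite_measure set X -> \bar R}) (A : set X) (B : set R)
  (f : X * R -> \bar R) :
  measurable A -> measurable B -> measurable_fun [set: X * R] f ->
  (forall p, 0 <= f p)%E ->
  (\int[m]_(x in A) \int[lambda]_(y in B) f (x, y) =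
   \int[lambda]_(y in B) \int[m]_(x in A) f (x, y))%E.
Proof. exact: (@tonelli_in _ _ X (measurableTypeR R) R m lambda A B f). Qed.

End line.

Section plane.
Context {R : realType}.
Local Notation lambda := (@lebesgue_measure R).

Lemma tonelli_plane (A : set R) (B : set R)
  (f : R * R -> \bar R) :
  measurable A -> measurable B -> measurable_fun [set: R * R] f ->
  (forall p, 0 <= f p)%E ->
  (\int[lambda]_(x in A) \int[lambda]_(y in B) f (x, y) =
   \int[lambda]_(y in B) \int[lambda]_(x in A) f (x, y))%E.
Proof. exact: (@tonelli_in _ _ (measurableTypeR R) (measurableTypeR R) R lambda lambda A B f). Qed.

Lemma fubini_plane (A : set R) (B : set R) (f : R * R -> \bar R) :
  measurable A -> measurable B -> measurable_fun [set: R * R] f ->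
  (\int[lambda]_(x in A) \int[lambda]_(y in B) `|f (x, y)| < +oo)%E ->
  (\int[lambda]_(x in A) \int[lambda]_(y in B) f (x, y) =
   \int[lambda]_(y in B) \int[lambda]_(x in A) f (x, y))%E.
Proof. exact: (@fubini_in _ _ (measurableTypeR R) (measurableTypeR R) R lambda lambda A B f). Qed.

End plane.

Lemma le_abs_Rintegral d (T : measurableType d) (R : realType)
    (m : {measure set T -> \bar R}) (A : set T) (f : T -> R) :
  measurable A -> measurable_fun A f ->
  (`|\int[m]_(x in A) f x|%:E <= \int[m]_(x in A) `|f x|%:E)%E.
Proof.
move=> mA mf.
apply: (@le_trans _ _ `|\int[m]_(x in A) (f x)%:E|%E).
  by rewrite /Rintegral; case: (\int[m]_(x in A) (f x)%:E)%E => [r| |]//=; rewrite normr0// leey.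
by apply: le_abse_integral => //; exact/measurable_EFinP.
Qed.

Section affine_change_of_variable.
Context {R : realType}.
Local Notation lambda := (@lebesgue_measure R).

Lemma measurable_affine (c e : R) :
  measurable_fun [set: measurableTypeR R]
    (fun x : R => (c * x + e)%R : measurableTypeR R).
Proof. by apply: measurable_funD => //; apply: measurable_funM. Qed.

Lemma pushforward_affine_itv (c e a b : R) : c != 0 -> a <= b ->
  (`|c|%:E * lambda ((fun x : R => (c * x + e)%R) @^-1` `]a, b]) = (b - a)%:E)%E.
Proof.
move=> c0 ab; have [c_lt0|c_gt0|/eqP] := ltgtP c 0; last by rewrite (negbTE c0).
- rewrite (_ : _ @^-1` _ = `[(b - e) / c, (a - e) / c[%classic); last first.
    apply/seteqP; split => x; rewrite /= !in_itv/= ler_ndivrMr// ltr_ndivlMr//;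
      by move=> /andP[h1 h2]; apply/andP; split; lra.
  rewrite lebesgue_measure_itv/= lte_fin ltr_ndivlMr// divfK//.
  have [h|h] := ltP (a - e) (b - e).
    rewrite -EFinB -EFinM; congr EFin; rewrite ltr0_norm//; field; exact: c0.
  by rewrite mule0; congr EFin; lra.
- rewrite (_ : _ @^-1` _ = `](a - e) / c, (b - e) / c]%classic); last first.
    apply/seteqP; split => x; rewrite /= !in_itv/= ler_pdivlMr// ltr_pdivrMr//;
      by move=> /andP[h1 h2]; apply/andP; split; lra.
  rewrite lebesgue_measure_itv/= lte_fin ltr_pdivrMr// divfK//.
  have [h|h] := ltP (a - e) (b - e).
    rewrite -EFinB -EFinM; congr EFin; rewrite gtr0_norm//; field; exact: c0.
  by rewrite mule0; congr EFin; lra.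
Qed.

(** Uniqueness of Lebesgue measure: |c| times the image of lambda under an affine
    map gives half-open intervals their length. *)
Lemma lebesgue_affine (c e : R) (A : set R) : c != 0 -> measurable A ->
  (lambda A = `|c|%:E * pushforward lambda (fun x : R => (c * x + e)%R) A)%E.
Proof.
move=> c0 mA.
pose m := measure_function_pushforward__canonical__measure_function_Measure
  lambda (measurable_affine c e).
rewrite (@lebesgue_measure_unique R (mscale (NngNum (normr_ge0 c)) m)) //.
move=> _ [[a b] /= ab] <-; rewrite lebesgue_measure_itv/= lte_fin /mscale/=.
rewrite /pushforward.
have [h|h] := ltP a b; first by rewrite pushforward_affine_itv// ltW.
by rewrite set_itv_ge ?preimage_set0 ?measure0 ?mule0// bnd_simp -leNgt.
Qed.

Lemma ge0_integral_affine (c e : R) (f : R -> \bar R) : c != 0 ->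
  measurable_fun [set: R] f -> (forall x, 0 <= f x)%E ->
  (\int[lambda]_x f x = `|c|%:E * \int[lambda]_x f (c * x + e)%R)%E.
Proof.
move=> c0 mf f0.
pose m := measure_function_pushforward__canonical__measure_function_Measure
  lambda (measurable_affine c e).
rewrite (eq_measure_integral (mscale (NngNum (normr_ge0 c)) m)); last first.
  by move=> A mA _; exact: lebesgue_affine.
rewrite ge0_integral_mscale //; congr (_ * _)%E.
by rewrite (ge0_integral_pushforward (measurable_affine c e)).
Qed.

End affine_change_of_variable.

(** * Lebesgue measure on R^d *)

Section lebesgue_rV_integration.
Context {R : realType}.
Local Notation lambda := (@lebesgue_measure R).

Lemma ge0_integral_rVS n (F : 'rV[R]_n.+1 -> \bar R) :
  measurable_fun [set: 'rV[R]_n.+1] F -> (forall x, 0 <= F x)%E ->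
  (\int[lebesgue_rV n.+1]_x F x =
   \int[lambda]_a \int[lebesgue_rV n]_v F (consrV (a, v)))%E.
Proof.
move=> mF F0.
have mc : measurable_fun [set: measurableTypeR R * 'rV[R]_n] (@consrV R n)
  := @measurable_consrV R n.
have := @ge0_integral_pushforward _ _ _ _ _ _ mc
  (lambda \x lebesgue_rV n)%E setT F measurableT mF (fun x _ => F0 x).
move=> h; apply: (etrans h) => {h}.
rewrite preimage_setT (fubini_tonelli1 (m1 := lambda) (m2 := lebesgue_rV n) (F \o @consrV R n)) //.
  by apply: measurableT_comp => //; exact: measurable_consrV.
by move=> p; exact: F0.
Qed.

(** The integrals over R^d computed below, of Gaussians and of boxes, factor over
    the coordinates. *)
Lemma integral_rV_prod n (f : 'I_n -> R -> R) (I : 'I_n -> R) :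
  (forall i, measurable_fun [set: R] (f i)) -> (forall i x, 0 <= f i x) ->
  (forall i, \int[lambda]_x (f i x)%:E = (I i)%:E)%E ->
  (\int[lebesgue_rV n]_x (\prod_(i < n) f i (x ord0 i))%:E =
   (\prod_(i < n) I i)%:E)%E.
Proof.
elim: n f I => [|n IH] f I mf f0 fI.
  under eq_integral do rewrite big_ord0.
  rewrite big_ord0; apply: (etrans (integral_dirac _ _ _)) => //.
  by rewrite diracT mul1e.
rewrite ge0_integral_rVS; first last.
- by move=> x; rewrite lee_fin prodr_ge0.
- apply/measurable_EFinP; apply: measurable_prod => i _.
  by apply: measurableT_comp => //; exact: measurable_coord.
have int0 i : 0 <= I i.
  by rewrite -lee_fin -fI; apply: integral_ge0 => x _; rewrite lee_fin.
under eq_integral => a _.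
  under eq_integral => v _.
    rewrite big_ord_recl consrV0 EFinM.
    under eq_bigr do rewrite consrVS /=.
    rewrite /=.
    over.
  rewrite ge0_integralZl //=; first last.
  - by rewrite lee_fin.
  - by move=> v _; rewrite lee_fin prodr_ge0.
  - apply/measurable_EFinP; apply: measurable_prod => i _.
    by apply: (@measurableT_comp _ _ _ _ _ _ (f (lift ord0 i))) => //; exact: measurable_coord.
  rewrite (IH (fun i => f (lift ord0 i)) (fun i => I (lift ord0 i))) //.
  over.
rewrite ge0_integralZr //=.
- by rewrite fI big_ord_recl EFinM.
- have h : measurable_fun [set: R] (fun x => (f ord0 x)%:E) by exact/measurable_EFinP.
  exact: h.
- by move=> x _; rewrite lee_fin.
- by rewrite lee_fin prodr_ge0.
Qed.

End lebesgue_rV_integration.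

Section line_rV.
Context {R : realType}.
Local Notation lambda := (@lebesgue_measure R).

Lemma measurable_int_rV n d (X : measurableType d) (f : X * 'rV[R]_n -> \bar R) :
  measurable_fun [set: X * 'rV[R]_n] f ->
  measurable_fun [set: X] (fun x => \int[lebesgue_rV n]_y f (x, y))%E.
Proof. by move=> mf; exact: measurable_int_param. Qed.

Lemma tonelli_line_rV n (A : set R) (f : R * 'rV[R]_n -> \bar R) :
  measurable A -> measurable_fun [set: R * 'rV[R]_n] f -> (forall p, 0 <= f p)%E ->
  (\int[lambda]_(x in A) \int[lebesgue_rV n]_y f (x, y) =
   \int[lebesgue_rV n]_y \int[lambda]_(x in A) f (x, y))%E.
Proof.
move=> mA mf f0.
exact: (@tonelli_in _ _ (measurableTypeR R) _ R lambda (lebesgue_rV n) A setT f).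
Qed.

End line_rV.

Section continuous_measurable.
Context {R : realType} (d : nat).

Let cell (k : nat) (x : R) : int := Num.floor (k.+1%:R * x).

Let measurable_cell k z : measurable (cell k @^-1` [set z]).
Proof.
have mc : measurable_fun [set: R] (fun x : R => (cell k x)%:~R : R).
  apply: nondecreasing_measurable => // x y xy.
  by rewrite ler_int; apply: le_floor; rewrite ler_wpM2l.
rewrite (_ : _ @^-1` _ = setT `&` (fun x => (cell k x)%:~R : R) @^-1` [set z%:~R]).
  exact: mc.
by rewrite setTI; apply/seteqP; split=> x /=; [move=> ->|move=> /intr_inj].
Qed.

Let cells k (p : R * 'rV[R]_d) : int * 'rV[int]_d :=
  (cell k p.1, \row_i cell k (p.2 ord0 i)).

Let corner k (z : int * 'rV[int]_d) : R * 'rV[R]_d :=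
  (z.1%:~R / k.+1%:R, \row_i ((z.2 ord0 i)%:~R / k.+1%:R)).

Let measurable_cells k z : measurable (cells k @^-1` [set z]).
Proof.
rewrite (_ : _ @^-1` _ = (fst @^-1` (cell k @^-1` [set z.1])) `&`
   \big[setI/setT]_(i < d) ((fun p : R * 'rV[R]_d => p.2 ord0 i) @^-1` (cell k @^-1` [set z.2 ord0 i]))).
  apply: measurableI.
    by rewrite -[X in measurable X]setTI; apply: measurable_fst => //; exact: measurable_cell.
  apply: bigsetI_measurable => i _; rewrite -[X in measurable X]setTI.
  apply: (measurableT_comp (measurable_coord i) measurable_snd) => //; exact: measurable_cell.
apply/seteqP; split => [p|p].
  move=> /= <-; split => //; rewrite -bigcap_seq => i _ /=.
  by rewrite /preimage/= mxE.
rewrite -bigcap_seq => -[/= h1 h2]; rewrite /cells h1.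
case: z h1 h2 => z1 z2 /= h1 h2; congr pair; apply/rowP => i; rewrite mxE.
by apply: h2; rewrite /= mem_index_enum.
Qed.

Let corner_cell k (x : R) : `|x - (cell k x)%:~R / k.+1%:R| <= k.+1%:R^-1.
Proof.
have k0 : 0 < k.+1%:R :> R by [].
have /andP[h1 h2] := floor_itv (k.+1%:R * x).
have -> : x - (cell k x)%:~R / k.+1%:R = (k.+1%:R * x - (cell k x)%:~R) / k.+1%:R.
  by field.
rewrite normrM (ger0_norm (x := k.+1%:R^-1)) ?invr_ge0// ler_piMl ?invr_ge0//.
rewrite ger0_norm ?subr_ge0// lerBlDl; apply: ltW.
by move: h2; rewrite intrD.
Qed.

(** A continuous function is the pointwise limit of its values at the corners of
    the cells of a grid, and these are measurable because the grid is countable.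
    No comparison of the Borel sets of the norm topology with the sigma-algebra
    generated by the coordinates is involved. *)
Lemma continuous_measurable_fun_rV (f : R * 'rV[R]_d -> R) :
  continuous f -> measurable_fun [set: R * 'rV[R]_d] f.
Proof.
move=> cf; apply: (@measurable_fun_cvg _ _ _ _ (fun k => f \o corner k \o cells k)).
- move=> k _ Y mY; rewrite setTI.
  rewrite (_ : _ @^-1` _ =
      \bigcup_z (if f (corner k z) \in Y then cells k @^-1` [set z] else set0)).
    apply: countable_bigcupT_measurable => // z.
    by case: ifP => // _; exact: measurable_cells.
  apply/seteqP; split => [p /= Yp|p [z _]].
    by exists (cells k p) => //; rewrite mem_set.
  by case: ifPn => // /set_mem Yz zp; rewrite /= zp.
- move=> p _; apply: (continuous_cvg _ (cf p)).
  apply/cvgrPdist_le => e e0.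
  have : k.+1%:R^-1 @[k --> \oo] --> (0 : R) by exact: cvg_harmonic.
  move=> /cvgrPdist_le /(_ _ e0); apply: filterS => k.
  rewrite sub0r normrN ger0_norm ?invr_ge0// => ke.
  rewrite prod_normE ge_max; apply/andP; split => /=.
    exact: le_trans (corner_cell k _) ke.
  rewrite /Num.Def.normr/= mx_normrE; apply/bigmax_leP; split; first exact: ltW.
  move=> [i j] _; rewrite !mxE/= ord1; exact: le_trans (corner_cell k _) ke.
Qed.

End continuous_measurable.

(** * Improper integrals of powers *)

Section power_integrals.
Context {R : realType}.
Local Notation lambda := (@lebesgue_measure R).

Lemma integral_itv_FTC (f F : R -> R) (a b : R) : a < b ->
  (forall x, a <= x <= b -> is_derive x 1 F (f x)) ->
  (forall x, a <= x <= b -> {for x, continuous f}) ->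
  (\int[lambda]_(x in `[a, b]) (f x)%:E = (F b - F a)%:E)%E.
Proof.
move=> ab dF cf.
have cF x : a <= x <= b -> {for x, continuous F}.
  by move=> xab; apply: differentiable_continuous; apply/derivable1_diffP; have [] := dF _ xab.
have inab x : x \in `]a, b[ -> a <= x <= b.
  by rewrite in_itv/= => /andP[/ltW -> /ltW ->].
rewrite EFinB; apply: continuous_FTC2 => //.
- apply: continuous_in_subspaceT => x /set_mem; rewrite /= in_itv/=; exact: cf.
- split.
  + by move=> x /inab /dF [].
  + by apply: cvg_at_right_filter; apply: cF; rewrite lexx ltW.
  + by apply: cvg_at_left_filter; apply: cF; rewrite lexx ltW.
- by move=> x /inab /dF dFx; rewrite derive1E; exact: derive_val.
Qed.

Lemma continuous_powR (p x : R) : 0 < x -> {for x, continuous (fun y : R => y `^ p)}.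
Proof.
move=> x0; apply: differentiable_continuous; apply/derivable1_diffP.
by have [] := is_derive1_powR p x0.
Qed.

Lemma integral_itv_powR (p a b : R) : p + 1 != 0 -> 0 < a -> a < b ->
  (\int[lambda]_(x in `[a, b]) (x `^ p)%:E =
   ((b `^ (p + 1) - a `^ (p + 1)) / (p + 1))%:E)%E.
Proof.
move=> p1 a0 ab.
apply: etrans (_ : ((p + 1)^-1 * b `^ (p + 1) - (p + 1)^-1 * a `^ (p + 1))%:E = _);
  last by congr EFin; field.
apply: (@integral_itv_FTC _ (fun x => (p + 1)^-1 * x `^ (p + 1))) => //.
- move=> x /andP[ax _]; have x0 : 0 < x by exact: lt_le_trans ax.
  have H := is_derive1_powR (p + 1) x0.
  apply: is_derive_eq; rewrite /GRing.scale/= addrK; field.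
  exact: p1.
- by move=> x /andP[ax _]; apply: continuous_powR; exact: lt_le_trans ax.
Qed.

Lemma integral_itv_inv (a b : R) : 0 < a -> a < b ->
  (\int[lambda]_(x in `[a, b]) (x `^ (-1))%:E = (ln b - ln a)%:E)%E.
Proof.
move=> a0 ab; apply: integral_itv_FTC => // x /andP[ax _];
  have x0 : 0 < x by exact: lt_le_trans ax.
- by have := is_derive1_ln x0; rewrite powR_inv1// ltW.
- exact: continuous_powR.
Qed.

(** Monotone convergence along the exhausting sets F n: the route from proper
    integrals, computed by the fundamental theorem, to the two improper ends of
    a power. *)
Lemma integral_bigcup_le (F : (set R)^nat) (f : R -> R) (A : set R) (M : \bar R) :
  {homo F : n m / (n <= m)%N >-> n `<=` m} ->
  (forall i, measurable (F i)) -> measurable A -> A `<=` \bigcup_i F i ->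
  measurable_fun [set: R] f -> (forall x, 0 <= f x) ->
  (forall n, \int[lambda]_(x in F n) (f x)%:E <= M)%E ->
  (\int[lambda]_(x in A) (f x)%:E <= M)%E.
Proof.
move=> ndF mF mA AF mf f0 leM.
have mf' (B : set R) : measurable_fun B (fun x => (f x)%:E).
  by apply/measurable_EFinP; exact: measurable_funTS.
have mU : measurable (\bigcup_i F i) by exact: bigcupT_measurable.
apply: (@le_trans _ _ (\int[lambda]_(x in \bigcup_i F i) (f x)%:E)%E).
  apply: ge0_subset_integral => //; first exact: mf'.
  by move=> x _; rewrite lee_fin.
have ndF' : {homo F : n m / (n <= m)%N >-> (n <= m)%O}.
  by move=> n m nm; apply/subsetPset => x; exact: ndF nm x.
have h : (\int[lambda]_(x in F i) (f x)%:E @[i --> \oo] -->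
          \int[lambda]_(x in \bigcup_i F i) (f x)%:E)%E.
  apply: ge0_nondecreasing_set_cvg_integral => //; first by move=> i; exact: mf'.
  by move=> i x _; rewrite lee_fin.
rewrite -(cvg_lim _ h) //.
by apply: lime_le; [apply: cvgP h|apply: nearW => n; exact: leM].
Qed.

Lemma bigcup_itv0 (c : R) : 0 < c -> `]0, c]%classic `<=` \bigcup_n `[c / n.+2%:R, c]%classic.
Proof.
move=> c0 x; rewrite /= in_itv/= => /andP[x0 xc].
have [n hn] : exists n : nat, c / x < n%:R.
  by exists (Num.bound (c / x)); apply: archi_boundP; rewrite divr_ge0// ltW.
exists n => //=; rewrite in_itv/= xc andbT ler_pdivrMr// mulrC.
move: hn; rewrite ltr_pdivrMr// => /ltW h; apply: (le_trans h).
by rewrite ler_wpM2r ?(ltW x0)// ler_nat (leq_trans (leqnSn _)).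
Qed.

Lemma nd_itv0 (c : R) : 0 < c ->
  {homo (fun n => `[c / n.+2%:R, c]%classic) : n m / (n <= m)%N >-> n `<=` m}.
Proof.
move=> c0 n m nm x; rewrite /= !in_itv/= => /andP[h ->]; rewrite andbT.
apply: le_trans h; rewrite ler_wpM2l ?(ltW c0)// lef_pV2 ?posrE//.
by rewrite ler_nat !ltnS.
Qed.

Lemma div_lt_self (c : R) n : 0 < c -> c / n.+2%:R < c.
Proof. by move=> c0; rewrite ltr_pdivrMr// ltr_pMr// ltr1n. Qed.

Lemma integral0_powR_le (p c : R) : -1 < p -> 0 < c ->
  (\int[lambda]_(x in `]0%R, c]) (x `^ p)%:E <= (c `^ (p + 1) / (p + 1))%:E)%E.
Proof.
move=> p1 c0; have p0 : 0 < p + 1 by lra.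
apply: (integral_bigcup_le (nd_itv0 c0)) => //.
- exact: bigcup_itv0.
- by move=> x; exact: powR_ge0.
- move=> n; rewrite integral_itv_powR ?gt_eqF ?divr_gt0 ?div_lt_self//.
  rewrite lee_fin ler_wpM2r ?invr_ge0 ?(ltW p0)//.
  by rewrite lerBlDr lerDl powR_ge0.
Qed.

Lemma integraly_powR_lty (q : R) : q < -1 ->
  (\int[lambda]_(x in `[1%R, +oo[) (x `^ q)%:E < +oo)%E.
Proof.
move=> q1; have q0 : 0 < - (q + 1) by lra.
apply: (@le_lt_trans _ _ ((- (q + 1))^-1)%:E); last exact: ltry.
apply: (@integral_bigcup_le (fun n => `[1, n.+2%:R]%classic)) => //.
- move=> n m nm x /=; rewrite !in_itv/= => /andP[-> h] /=.
  by rewrite (le_trans h)// ler_nat !ltnS.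
- move=> x /=; rewrite in_itv/= andbT => x1.
  have [n hn] : exists n : nat, x < n%:R.
    by exists (Num.bound x); apply: archi_boundP; rewrite (le_trans _ x1).
  exists n => //=; rewrite in_itv/= x1/= (le_trans (ltW hn))// ler_nat.
  by rewrite (leq_trans (leqnSn _)).
- by move=> x; exact: powR_ge0.
- move=> n; rewrite integral_itv_powR ?ltr1n//; last by rewrite -oppr_eq0 gt_eqF.
  by rewrite lee_fin powR1 -mulrNN -invrN opprB ler_piMl ?invr_ge0 ?(ltW q0)// lerBlDr lerDl powR_ge0.
Qed.

(** Comparison with the logarithm, the case p = -1, to which x `^ p reduces
    where x <= 1. *)
Lemma integral0_powR_infty (p c : R) : p <= -1 -> 0 < c ->
  (\int[lambda]_(x in `]0%R, c]) (x `^ p)%:E = +oo)%E.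
Proof.
move=> p1 c0.
wlog c1 : c c0 / c <= 1 => [hw|].
  have [/hw|] := leP c 1; first exact.
  move=> c1; apply/eqP; rewrite -leye_eq -(hw 1 _ (lexx _))//.
  apply: ge0_subset_integral => //.
  - by apply/measurable_EFinP; apply: measurable_funTS; exact: measurable_powR.
  - by move=> x _; rewrite lee_fin powR_ge0.
  - move=> x /=; rewrite !in_itv/= => /andP[-> h]; exact: le_trans (ltW c1).
apply/eqyP => A A0.
have [n hn] : exists n : nat, expR A < n%:R.
  by exists (Num.bound (expR A)); apply: archi_boundP; rewrite expR_ge0.
(* The integral of x^-1 over [c / (n + 2), c] is ln (n + 2). *)
apply: (@le_trans _ _ (ln n.+2%:R)%:E).
  rewrite lee_fin -ler_expR lnK ?posrE// (le_trans (ltW hn))// ler_nat.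
  by rewrite (leq_trans (leqnSn _)).
apply: (@le_trans _ _ (\int[lambda]_(x in `[(c / n.+2%:R)%R, c]) (x `^ (-1))%:E)%E).
  rewrite integral_itv_inv ?divr_gt0 ?div_lt_self// lee_fin.
  by rewrite ln_div ?posrE//; lra.
have sub : `[(c / n.+2%:R)%R, c]%classic `<=` `]0%R, c]%classic.
  move=> x /=; rewrite !in_itv/= => /andP[h ->]; rewrite andbT.
  by apply: lt_le_trans h; rewrite divr_gt0.
apply: (@le_trans _ _ (\int[lambda]_(x in `[(c / n.+2%:R)%R, c]) (x `^ p)%:E)%E).
  apply: ge0_le_integral => //.
  - by move=> x _; rewrite lee_fin powR_ge0.
  - by apply/measurable_EFinP; apply: measurable_funTS; exact: measurable_powR.
  - by apply/measurable_EFinP; apply: measurable_funTS; exact: measurable_powR.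
  - move=> x /sub/=; rewrite in_itv/= => /andP[x0 xc]; rewrite lee_fin.
    by apply: ger_powR => //; rewrite x0 (le_trans xc).
apply: ge0_subset_integral => //.
- by apply/measurable_EFinP; apply: measurable_funTS; exact: measurable_powR.
- by move=> x _; rewrite lee_fin powR_ge0.
Qed.

End power_integrals.

(** * The Fourier transform of the Laplace kernel *)

Section laplace_kernel.
Context {R : realType}.
Local Notation lambda := (@lebesgue_measure R).

Lemma is_derive_continuous (f : R -> R) (x df : R) :
  is_derive x 1 f df -> {for x, continuous f}.
Proof.
by move=> [h _]; apply: differentiable_continuous; apply/derivable1_diffP.
Qed.

Lemma is_derive_expR_scale (l x : R) :
  is_derive x 1 (fun y => expR (- (l * y))) (- l * expR (- (l * x))).
Proof.
have h : is_derive x 1 (fun y : R => - (l * y)) (- l).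
  by apply: is_derive_eq; rewrite /GRing.scale/= mulr1.
have := @is_derive1_comp _ expR (fun y : R => - (l * y)) x _ _ (is_derive_expR _) h.
by rewrite mulrC.
Qed.

Lemma is_derive_cos_scale (w x : R) :
  is_derive x 1 (fun y => cos (w * y)) (- w * sin (w * x)).
Proof.
have h : is_derive x 1 (fun y : R => (w * y)) (w).
  by apply: is_derive_eq; rewrite /GRing.scale/= mulr1.
have := @is_derive1_comp _ cos (fun y : R => w * y) x _ _ (is_derive_cos _) h.
by rewrite mulrC mulrN -mulNr.
Qed.

Lemma is_derive_sin_scale (w x : R) :
  is_derive x 1 (fun y => sin (w * y)) (w * cos (w * x)).
Proof.
have h : is_derive x 1 (fun y : R => (w * y)) (w).
  by apply: is_derive_eq; rewrite /GRing.scale/= mulr1.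
have := @is_derive1_comp _ sin (fun y : R => w * y) x _ _ (is_derive_sin _) h.
by rewrite mulrC.
Qed.

(* F below is a primitive of expR (- l x) * (1 + cos (w x)).  Adding 1 to the
   cosine makes the integrand nonnegative, so that the fundamental theorem
   applies on the half-line; the constant is subtracted at the end. *)
Let B (l w x : R) : R := - l^-1 + (w * sin (w * x) - l * cos (w * x)) / (l ^+ 2 + w ^+ 2).

Let F (l w x : R) : R := expR (- (l * x)) * B l w x.

Let is_derive_F (l w x : R) : 0 < l ->
  is_derive x 1 (F l w) (expR (- (l * x)) * (1 + cos (w * x))).
Proof.
move=> l0; have n0 : l ^+ 2 + w ^+ 2 != 0.
  by rewrite gt_eqF// ltr_wpDr ?sqr_ge0// exprn_gt0.
have h1 := is_derive_expR_scale l x.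
have h2 := is_derive_cos_scale w x.
have h3 := is_derive_sin_scale w x.
rewrite /F /B; apply: is_derive_eq; rewrite /GRing.scale/=; field.
by rewrite n0/= gt_eqF.
Qed.

Let F_cvg (l w : R) : 0 < l -> F l w x @[x --> +oo] --> 0.
Proof.
move=> l0; have n0 : 0 < l ^+ 2 + w ^+ 2 by rewrite ltr_wpDr ?sqr_ge0// exprn_gt0.
have e0 : expR (- (l * x)) @[x --> +oo] --> (0 : R).
  apply: (@cvg_comp _ _ _ (fun x => l * x) (fun x => expR (- x)) _ +oo); last exact: cvgr_expR.
  by apply: gt0_cvgMry => //; exact: cvg_id.
pose C := l^-1 + (`|w| + l) / (l ^+ 2 + w ^+ 2).
have BC x : `|B l w x| <= C.
  rewrite (le_trans (ler_normD _ _))// normrN ger0_norm ?invr_ge0 ?(ltW l0)// lerD2l.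
  rewrite normrM (ger0_norm (x := _^-1)) ?invr_ge0 ?(ltW n0)//.
  rewrite ler_wpM2r ?invr_ge0 ?(ltW n0)// (le_trans (ler_normB _ _))//.
  rewrite !normrM (ger0_norm (ltW l0)) lerD// -[leRHS]mulr1 ler_wpM2l// ?(ltW l0)//.
  - exact: sin_max.
  - exact: cos_max.
apply/norm_cvg0P.
apply: (@squeeze_cvgr _ _ _ _ (cst 0) (fun x => expR (- (l * x)) * C)).
- by apply: nearW => x; rewrite normr_ge0/= /F normrM ger0_norm ?expR_ge0// ler_wpM2l ?expR_ge0.
- exact: cvg_cst.
- by rewrite -(mul0r C); apply: cvgMl.
Qed.

Let integral_half (l w : R) : 0 < l ->
  (\int[lambda]_(x in `[0%R, +oo[) (expR (- (l * x)) * (1 + cos (w * x)))%:E =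
   (l^-1 + l / (l ^+ 2 + w ^+ 2))%:E)%E.
Proof.
move=> l0.
have cF x : {for x, continuous (F l w)}.
  exact: (is_derive_continuous (is_derive_F w x l0)).
apply: etrans (_ : (0%:E - (F l w 0)%:E = _)%E); last first.
  rewrite -EFinB /F /B !mulr0 oppr0 expR0 sin0 cos0; congr EFin; field.
  by rewrite (gt_eqF l0) andbT gt_eqF// ltr_wpDr ?sqr_ge0// exprn_gt0.
apply: (@ge0_continuous_FTC2y _ _ (F l w) _ 0).
- move=> x _; rewrite mulr_ge0 ?expR_ge0//.
- apply: continuous_subspaceT => x.
  apply: cvgM.
    exact: (is_derive_continuous (is_derive_expR_scale l x)).
  apply: cvgD; first exact: cvg_cst.
  exact: (is_derive_continuous (is_derive_cos_scale w x)).
- exact: F_cvg.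
- by move=> x _; have [] := is_derive_F w x l0.
- exact: cvg_at_right_filter (cF 0).
- by move=> x _; rewrite derive1E; have := is_derive_F w x l0 => dFx; exact: derive_val.
Qed.

Let integral_line (l w : R) : 0 < l ->
  (\int[lambda]_x (expR (- (l * `|x|)) * (1 + cos (w * x)))%:E =
   (2 * (l^-1 + l / (l ^+ 2 + w ^+ 2)))%:E)%E.
Proof.
move=> l0; rewrite ge0_symfun_integralT.
- rewrite EFinM -(integral_half w l0); congr (_ * _)%E.
  rewrite (_ : [set x | 0 <= x] = `[0, +oo[%classic); last first.
    by apply/seteqP; split => x /=; rewrite in_itv/= andbT.
  apply: eq_integral => x; rewrite inE /= in_itv/= andbT => x0.
  by rewrite ger0_norm.
- move=> x; rewrite mulr_ge0 ?expR_ge0//.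
- move=> x; apply: cvgM.
    apply: (continuous_comp (f := fun x : R => - (l * `|x|)) (g := expR)); last exact: continuous_expR.
    apply: cvgN; apply: cvgMr; exact: norm_continuous.
  apply: cvgD; first exact: cvg_cst.
  exact: (is_derive_continuous (is_derive_cos_scale w x)).
- by move=> x /=; rewrite normrN mulrN cosN.
Qed.

Lemma measurable_laplace l : measurable_fun [set: R] (fun x : R => expR (- (l * `|x|))).
Proof.
apply: measurableT_comp => //; apply: measurable_funN.
by apply: measurable_funM => //; exact: normr_measurable.
Qed.

Lemma measurable_cosM w : measurable_fun [set: R] (fun x : R => cos (w * x)).
Proof.
apply: continuous_measurable_fun => x.
exact: (is_derive_continuous (is_derive_cos_scale w x)).
Qed.

Lemma integrable_laplace l : 0 < l ->
  lambda.-integrable setT (fun x => (expR (- (l * `|x|)))%:E).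
Proof.
move=> l0; apply/integrableP; split.
  by apply/measurable_EFinP; exact: measurable_laplace.
have := integral_line 0 l0.
under eq_integral do rewrite mul0r cos0.
move=> h; apply: (@le_lt_trans _ _ (2 * (l^-1 + l / (l ^+ 2 + 0 ^+ 2)))%:E); last exact: ltry.
rewrite -h; apply: ge0_le_integral => //.
- by apply: measurableT_comp => //; apply/measurable_EFinP; exact: measurable_laplace.
- by apply/measurable_EFinP; apply: measurable_funM => //; exact: measurable_laplace.
- move=> x _ /=; rewrite ger0_norm ?expR_ge0// lee_fin ler_peMr ?expR_ge0//.
  by lra.
Qed.

(** The Fourier transform of the Laplace kernel is the Cauchy kernel.  It is
    positive, which is what makes the comparison of a function with its absolute
    value work. *)
Lemma integral_laplace_cos l w : 0 < l ->
  (\int[lambda]_x (expR (- (l * `|x|)) * cos (w * x))%:E =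
   (2 * l / (l ^+ 2 + w ^+ 2))%:E)%E.
Proof.
move=> l0.
have n0 : l ^+ 2 + w ^+ 2 != 0.
  by rewrite gt_eqF// ltr_wpDr ?sqr_ge0// exprn_gt0.
have h0 : (\int[lambda]_x (expR (- (l * `|x|)))%:E = (2 / l)%:E)%E.
  have := integral_line 0 l0.
  under eq_integral do rewrite mul0r cos0 mulrDr mulr1 EFinD.
  rewrite ge0_integralD //; first last.
  - by apply/measurable_EFinP; exact: measurable_laplace.
  - by apply/measurable_EFinP; exact: measurable_laplace.
  have /fineK <- : (\int[lambda]_x (expR (- (l * `|x|)))%:E)%E \is a fin_num.
    by apply: integrable_fin_num => //; exact: integrable_laplace.
  rewrite -EFinD => -[] h; congr EFin.
  have l1 : l != 0 by rewrite gt_eqF.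
  have -> : 2 / l = (2 * (l^-1 + l / (l ^+ 2 + 0 ^+ 2))) / 2 by field.
  by rewrite -h; field.
transitivity (\int[lambda]_x ((expR (- (l * `|x|)) * (1 + cos (w * x)))%:E
    - (expR (- (l * `|x|)))%:E))%E.
  by apply: eq_integral => x _; rewrite -EFinB; congr EFin; ring.
rewrite integralB //.
- rewrite integral_line// h0 -EFinB; congr EFin; field.
  by rewrite n0 gt_eqF.
- apply/integrableP; split.
    apply/measurable_EFinP; apply: measurable_funM; first exact: measurable_laplace.
    by apply: measurable_funD => //; exact: measurable_cosM.
  under eq_integral => x _.
    rewrite gee0_abs; last first.
      by rewrite lee_fin mulr_ge0 ?expR_ge0.
    over.
  by rewrite integral_line// ltry.
- exact: integrable_laplace.
Qed.

End laplace_kernel.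

(** * Powers as mixtures of Laplace and Cauchy kernels *)

Section subordination.
Context {R : realType}.
Local Notation lambda := (@lebesgue_measure R).

Lemma ge0_integral_scale_pos (c : R) (f : R -> R) : 0 < c ->
  measurable_fun [set: R] f -> (forall x, 0 <= f x) ->
  (\int[lambda]_(x in `]0%R, +oo[) (f x)%:E =
   c%:E * \int[lambda]_(x in `]0%R, +oo[) (f (c * x))%:E)%E.
Proof.
move=> c0 mf f0; rewrite integral_mkcond [in RHS]integral_mkcond.
rewrite (@ge0_integral_affine _ c 0) ?gt_eqF//.
- rewrite gtr0_norm//; congr (_ * _)%E; apply: eq_integral => x _.
  rewrite addr0 !patchE; congr (if _ then _ else _).
  by apply/idP/idP; rewrite !inE/= !in_itv/= !andbT pmulr_rgt0.
- by apply: measurable_patch => //; exact: measurable_EFin_on.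
- by move=> x; rewrite patchE; case: ifPn => // _; rewrite lee_fin.
Qed.

Lemma integral_pos_gt0 (f : R -> R) (k : R) : 0 < k ->
  measurable_fun [set: R] f -> (forall x, 0 <= f x) ->
  (forall x, 2^-1 <= x <= 1 -> k <= f x) ->
  (0 < \int[lambda]_(x in `]0%R, +oo[) (f x)%:E)%E.
Proof.
move=> k0 mf f0 fk.
apply: (@lt_le_trans _ _ (\int[lambda]_(x in `[(2^-1)%R, 1%R]) k%:E)%E).
  rewrite integral_cst//= lebesgue_measure_itv/= lte_fin ifT; last by lra.
  by rewrite -EFinB -EFinM lte_fin mulr_gt0//; lra.
apply: (@le_trans _ _ (\int[lambda]_(x in `[(2^-1)%R, 1%R]) (f x)%:E)%E).
  apply: ge0_le_integral => //.
  - by move=> x _; rewrite lee_fin ltW.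
  - exact: measurable_EFin_on.
apply: ge0_subset_integral => //.
- exact: measurable_EFin_on.
- by move=> x _; rewrite lee_fin.
- move=> x /=; rewrite !in_itv/= => /andP[h _]; rewrite andbT.
  by apply: lt_le_trans h; lra.
Qed.

Lemma integral_pos_lty (f g1 g2 : R -> R) :
  measurable_fun [set: R] f -> (forall x, 0 <= f x) ->
  measurable_fun [set: R] g1 -> measurable_fun [set: R] g2 ->
  (forall x, 0 < x <= 1 -> f x <= g1 x) ->
  (forall x, 1 <= x -> f x <= g2 x) ->
  (\int[lambda]_(x in `]0%R, 1%R]) (g1 x)%:E < +oo)%E ->
  (\int[lambda]_(x in `[1%R, +oo[) (g2 x)%:E < +oo)%E ->
  (\int[lambda]_(x in `]0%R, +oo[) (f x)%:E < +oo)%E.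
Proof.
move=> mf f0 mg1 mg2 fg1 fg2 g1oo g2oo.
rewrite (_ : `]0, +oo[%classic = `]0, 1]%classic `|` `]1, +oo[%classic); last first.
  apply/seteqP; split => x /=; rewrite !in_itv/= !andbT.
    by move=> x0; have [x1|x1] := leP x 1; [left; rewrite x0|right].
  by case=> [/andP[]//|x1]; lra.
rewrite ge0_integral_setU //; last 3 first.
- exact: measurable_EFin_on.
- by move=> x _; rewrite lee_fin.
- apply/eqP/seteqP; split => // x /= [] /=; rewrite !in_itv/= andbT.
  by move=> /andP[_ h1]; rewrite ltNge h1.
apply: lte_add_pinfty.
- apply: le_lt_trans g1oo; apply: ge0_le_integral => //.
  + by move=> x _; rewrite lee_fin.
  + exact: measurable_EFin_on.
  + exact: measurable_EFin_on.
- apply: le_lt_trans g2oo.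
  apply: (@le_trans _ _ (\int[lambda]_(x in `[1%R, +oo[) (f x)%:E)%E).
    apply: ge0_subset_integral => //.
    * exact: measurable_EFin_on.
    * by move=> x _; rewrite lee_fin.
    * by move=> x /=; rewrite !in_itv/= !andbT => /ltW.
  apply: ge0_le_integral => //.
  + by move=> x _; rewrite lee_fin.
  + exact: measurable_EFin_on.
  + exact: measurable_EFin_on.
  + by move=> x /=; rewrite in_itv/= andbT lee_fin; exact: fg2.
Qed.

Lemma integral0_powR_lty (p : R) : -1 < p ->
  (\int[lambda]_(x in `]0%R, 1%R]) (x `^ p)%:E < +oo)%E.
Proof. by move=> p1; apply: le_lt_trans (integral0_powR_le p1 ltr01) (ltry _). Qed.

Lemma powR_ge1 (x p : R) : 0 < x -> x <= 1 -> p <= 0 -> 1 <= x `^ p.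
Proof.
by move=> x0 x1 p0; have := @ger_powR R x; rewrite x0 x1 => /(_ isT _ _ p0); rewrite powRr0.
Qed.

Lemma powR_le1 (x p : R) : 1 <= x -> p <= 0 -> x `^ p <= 1.
Proof. by move=> x1 p0; have := ler_powR x1 p0; rewrite powRr0. Qed.

Lemma measurable_gamma_kernel (s : R) :
  measurable_fun [set: R] (fun t : R => t `^ (s - 1) * expR (- t)).
Proof. by apply: measurable_funM => //; apply: measurableT_comp => //. Qed.

Lemma gamma_integral_bounds (s : R) : 0 < s -> s < 1 ->
  (0 < \int[lambda]_(t in `]0%R, +oo[) (t `^ (s - 1) * expR (- t))%:E < +oo)%E.
Proof.
move=> s0 s1; apply/andP; split.
- apply: (@integral_pos_gt0 _ (expR (-1))).
  + exact: expR_gt0.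
  + exact: measurable_gamma_kernel.
  + by move=> x; rewrite mulr_ge0 ?powR_ge0 ?expR_ge0.
  + move=> x /andP[x2 x1]; rewrite -[leLHS]mul1r ler_pM ?expR_ge0//; last first.
      by rewrite ler_expR lerN2.
    by apply: powR_ge1 => //; lra.
- apply: (@integral_pos_lty _ (fun t => t `^ (s - 1)) (fun t => 2 * t `^ (- 2))) => //.
  + exact: measurable_gamma_kernel.
  + by move=> x; rewrite mulr_ge0 ?powR_ge0 ?expR_ge0.
  + by apply: measurable_funM.
  + move=> x /andP[x0 x1]; rewrite ler_piMr ?powR_ge0// -[leRHS]expR0 ler_expR; lra.
  (* Near infinity, expR (- x) <= 2 / x ^ 2. *)
  + move=> x x1; have x0 : 0 < x by exact: lt_le_trans x1.
    apply: (@le_trans _ _ (1 * expR (- x))).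
      by rewrite ler_wpM2r ?expR_ge0//; apply: powR_le1 => //; lra.
    rewrite mul1r expRN powRN powR_mulrn ?(ltW x0)//.
    rewrite -[leRHS]invrK invfM invrK lef_pV2 ?posrE ?expR_gt0//; last first.
      by rewrite mulr_gt0 ?exprn_gt0.
    have := @expR_ge1Dxn R x 1 (ltW x0); rewrite (_ : 2`! = 2)// => h.
    by lra.
  + by apply: integral0_powR_lty; lra.
  + under eq_integral do rewrite EFinM.
    rewrite ge0_integralZl //=; last 2 first.
    * by apply: measurable_EFin_on; exact: measurable_powR.
    * by move=> x _; rewrite lee_fin powR_ge0.
    rewrite lte_mul_pinfty//; apply: integraly_powR_lty; lra.
Qed.

Lemma Gamma_gt0 (s : R) : 0 < s -> s < 1 -> 0 < Gamma s.
Proof.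
move=> s0 s1; have /andP[h1 h2] := gamma_integral_bounds s0 s1.
by rewrite /Gamma /Rintegral fine_gt0// h1.
Qed.

(** A negative power is a mixture of exponentials: substitute l = m / t in Euler's
    integral. *)
Lemma laplace_powR (h : R) : 0 < h < 1 -> exists2 c : R, 0 < c &
  forall t : R, 0 < t ->
  (\int[lambda]_(l in `]0%R, +oo[) (l `^ (h - 1) * expR (- (l * t)))%:E =
   (c * t `^ (- h))%:E)%E.
Proof.
move=> /andP[h0 h1]; have /andP[g0 goo] := gamma_integral_bounds h0 h1.
set I := (X in (0 < X)%E) in g0; rewrite -/I in goo.
have fI : (fine I)%:E = I by rewrite fineK// ge0_fin_numE// ltW.
exists (fine I); first by rewrite fine_gt0// g0.
move=> t t0.
rewrite (@ge0_integral_scale_pos t^-1) ?invr_gt0//; last 2 first.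
- apply: measurable_funM => //; apply: measurableT_comp => //.
  by apply: measurable_funN; exact: measurable_funM.
- by move=> x; rewrite mulr_ge0 ?powR_ge0 ?expR_ge0.
transitivity ((t^-1)%:E * \int[lambda]_(x in `]0%R, +oo[)
   ((t `^ (1 - h))%:E * (x `^ (h - 1) * expR (- x))%:E))%E.
  congr (_ * _)%E; apply: eq_integral => x; rewrite inE/= in_itv/= andbT => x0.
  rewrite powRM ?invr_ge0 ?(ltW t0) ?(ltW x0)// -EFinM; congr EFin.
  rewrite -powR_inv1 ?(ltW t0)// -powRrM mulN1r opprB -mulrA; congr (_ * (_ * _)).
  rewrite powR_inv1 ?(ltW t0)//; congr (expR (- _)); field.
  by rewrite gt_eqF.
rewrite ge0_integralZl //=; last 3 first.
- by apply: measurable_EFin_on; exact: measurable_gamma_kernel.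
- by move=> x _; rewrite lee_fin mulr_ge0 ?powR_ge0 ?expR_ge0.
- by rewrite lee_fin powR_ge0.
rewrite -/I -fI muleA -!EFinM; congr EFin.
rewrite mulrC; congr (_ * _); rewrite -powR_inv1 ?(ltW t0)// -powRD.
  by congr (_ `^ _); ring.
by apply/implyP => _; rewrite gt_eqF.
Qed.

Lemma measurable_cauchy (w : R) :
  measurable_fun [set: R] (fun l : R => 2 * l / (l ^+ 2 + w ^+ 2)).
Proof.
apply: measurable_funM; first exact: measurable_funM.
apply: (measurableT_comp (@measurable_invr R)).
by apply: measurable_funD => //; exact: measurable_funX.
Qed.

Let measurable_abs_cauchy (h w : R) : measurable_fun [set: R]
  (fun l : R => l `^ (h - 1) * (2 * `|l| / (l ^+ 2 + w ^+ 2))).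
Proof.
apply: measurable_funM => //; apply: measurable_funM.
  by apply: measurable_funM => //; exact: normr_measurable.
apply: (measurableT_comp (@measurable_invr R)).
by apply: measurable_funD => //; exact: measurable_funX.
Qed.

(** The mixture of Cauchy kernels with the same weights is again a power, by the
    substitution l = |w| m.  Since the Cauchy kernel is the Fourier transform of
    the Laplace kernel, this and the previous lemma together compute the Fourier
    transform of |t|^(-h), up to a constant, without ever treating it as a
    distribution. *)
Lemma cauchy_powR (h : R) : 0 < h < 1 -> exists2 c : R, 0 < c &
  forall w : R, w != 0 ->
  (\int[lambda]_(l in `]0%R, +oo[) (l `^ (h - 1) * (2 * l / (l ^+ 2 + w ^+ 2)))%:E =
   (c * `|w| `^ (h - 1))%:E)%E.
Proof.
move=> /andP[h0 h1].
(* The absolute value makes the integrand nonnegative on the whole line. *)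
pose f (l : R) := l `^ (h - 1) * (2 * `|l| / (l ^+ 2 + 1 ^+ 2)).
have mf : measurable_fun [set: R] f by exact: measurable_abs_cauchy.
have f0 x : 0 <= f x.
  by rewrite mulr_ge0 ?powR_ge0// divr_ge0 ?mulr_ge0// addr_ge0 ?sqr_ge0.
pose I := (\int[lambda]_(l in `]0%R, +oo[) (f l)%:E)%E.
have Igt0 : (0 < I)%E.
  apply: (@integral_pos_gt0 _ (2^-1)) => // x /andP[x2 x1].
  rewrite -[leLHS]mul1r ler_pM//.
    by apply: powR_ge1 => //; lra.
  rewrite ger0_norm; last by lra.
  rewrite ler_pdivlMr; nra.
have Ioo : (I < +oo)%E.
  apply: (@integral_pos_lty _ (fun t => 2 * t `^ (h - 1)) (fun t => 2 * t `^ (h - 2))) => //.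
  + by apply: measurable_funM.
  + by apply: measurable_funM.
  + move=> x /andP[x0 x1]; rewrite /f [leRHS]mulrC ler_wpM2l ?powR_ge0//.
    rewrite ger0_norm; last by lra.
    rewrite ler_pdivrMr; nra.
  + move=> x x1; have x0 : 0 < x by exact: lt_le_trans x1.
    have -> : x `^ (h - 2) = x `^ (h - 1) * x `^ (-1).
      rewrite -powRD; last by apply/implyP => _; rewrite gt_eqF.
      by congr (_ `^ _); ring.
    rewrite /f [leRHS]mulrCA ler_wpM2l ?powR_ge0// powR_inv1 ?(ltW x0)// ger0_norm ?(ltW x0)//.
    rewrite -mulrA ler_wpM2l// ler_pdivrMr; last by nra.
    rewrite mulrDr expr2 mulrA mulVf ?gt_eqF// mul1r lerDl mulr_ge0//.
    by rewrite invr_ge0 ltW.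
  + under eq_integral do rewrite EFinM.
    rewrite ge0_integralZl //=; last 2 first.
    * by apply: measurable_EFin_on; exact: measurable_powR.
    * by move=> x _; rewrite lee_fin powR_ge0.
    rewrite lte_mul_pinfty//; apply: integral0_powR_lty; lra.
  + under eq_integral do rewrite EFinM.
    rewrite ge0_integralZl //=; last 2 first.
    * by apply: measurable_EFin_on; exact: measurable_powR.
    * by move=> x _; rewrite lee_fin powR_ge0.
    rewrite lte_mul_pinfty//; apply: integraly_powR_lty; lra.
have fI : (fine I)%:E = I by rewrite fineK// ge0_fin_numE// ltW.
exists (fine I); first by rewrite fine_gt0// Igt0.
move=> w w0; have w1 : 0 < `|w| by rewrite normr_gt0.
pose g (l : R) := l `^ (h - 1) * (2 * `|l| / (l ^+ 2 + w ^+ 2)).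
transitivity (\int[lambda]_(l in `]0%R, +oo[) (g l)%:E)%E.
  apply: eq_integral => x; rewrite inE/= in_itv/= andbT => x0.
  by rewrite /g ger0_norm ?(ltW x0).
rewrite (@ge0_integral_scale_pos `|w|)//; last 2 first.
- exact: measurable_abs_cauchy.
- by move=> x; rewrite mulr_ge0 ?powR_ge0// divr_ge0 ?mulr_ge0// addr_ge0 ?sqr_ge0.
transitivity ((`|w|)%:E * \int[lambda]_(x in `]0%R, +oo[)
   ((`|w| `^ (h - 1) / `|w|)%:E * (f x)%:E))%E.
  congr (_ * _)%E; apply: eq_integral => x; rewrite inE/= in_itv/= andbT => x0.
  rewrite /g /f powRM ?(ltW w1) ?(ltW x0)// -EFinM; congr EFin.
  rewrite normrM normr_id (ger0_norm (ltW x0)) exprMn -[w ^+ 2]real_normK ?num_real//.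
  field; rewrite !gt_eqF//; first by nra.
  by rewrite addr_gt0 ?exprn_gt0// mulr_gt0.
rewrite ge0_integralZl //=; last 2 first.
- have h2 : measurable_fun (`]0, +oo[%classic : set R) (fun x : R => (f x)%:E).
    exact: measurable_EFin_on.
  exact: h2.
- by move=> x _; rewrite lee_fin.
rewrite -/I -fI muleA -!EFinM; congr EFin.
by field; rewrite gt_eqF.
Qed.

End subordination.

(** * The power spectrum of a function on [0, T] *)

Definition power_spectrum {R : realType} (T : R) (f : R -> R) (t : R) : R :=
  (\int[@lebesgue_measure R]_(u in `[0, T]) (cos (t * u) * f u)) ^+ 2 +
  (\int[@lebesgue_measure R]_(u in `[0, T]) (sin (t * u) * f u)) ^+ 2.

Lemma normc_fourier0T {R : realType} (T : R) (f : R -> R) (t : R) :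
  (complex.ComplexField.Normc.normc (fourier0T T f t)) ^+ 2 = power_spectrum T f t.
Proof.
by rewrite /fourier0T /= sqr_sqrtr ?addr_ge0 ?sqr_ge0// sqrrN.
Qed.

Lemma power_spectrum_ge0 {R : realType} (T : R) (f : R -> R) (t : R) :
  0 <= power_spectrum T f t.
Proof. by rewrite addr_ge0 ?sqr_ge0. Qed.

Section fourier_laplace.
Context {R : realType} (T : R).
Local Notation lambda := (@lebesgue_measure R).
Variable f : R -> R.
Hypothesis mf : measurable_fun [set: R] f.
Hypothesis intf : lambda.-integrable (`[0, T] : set R) (EFin \o f).

Local Notation A := (`[0%R, T]%classic : set R).
Let C (t : R) := \int[lambda]_(u in `[0, T]) (cos (t * u) * f u).
Let S (t : R) := \int[lambda]_(u in `[0, T]) (sin (t * u) * f u).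

Lemma integrable_bounded_mul (g : R -> R) : measurable_fun [set: R] g ->
  (forall u, `|g u| <= 1) -> lambda.-integrable A (fun u => (g u * f u)%:E).
Proof.
move=> mg g1; apply: le_integrable intf => //.
  by apply: measurable_EFin_on; exact: measurable_funM.
move=> u _ /=; rewrite lee_fin normrM ler_piMl//.
Qed.

Lemma measurable_sinM (w : R) : measurable_fun [set: R] (fun x : R => sin (w * x)).
Proof.
apply: continuous_measurable_fun => x.
exact: (is_derive_continuous (is_derive_sin_scale w x)).
Qed.

Lemma fourier_inner (t a b : R) :
  (\int[lambda]_(u in A) ((a * cos (t * u) + b * sin (t * u)) * f u)%:E =
   (a * C t + b * S t)%:E)%E.
Proof.
have ic := integrable_bounded_mul (measurable_cosM t) (fun u => cos_max _).
have i_s := integrable_bounded_mul (measurable_sinM t) (fun u => sin_max _).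
transitivity (\int[lambda]_(u in A) (a%:E * (cos (t * u) * f u)%:E + b%:E * (sin (t * u) * f u)%:E))%E.
  by apply: eq_integral => u _; rewrite -!EFinM -EFinD; congr EFin; ring.
rewrite integralD //=; [|exact: integrableZl..].
rewrite !integralZl //= EFinD !EFinM /C /S /Rintegral !fineK//;
  exact: integrable_fin_num.
Qed.

(** cos (t (u - v)) = cos (t u) cos (t v) + sin (t u) sin (t v).  The factor e
    keeps the weight inside the integral, ready for the exchange below. *)
Lemma fourier_sq (e t : R) :
  ((e * power_spectrum T f t)%:E =
   \int[lambda]_(u in A) \int[lambda]_(v in A) (e * (cos (t * (u - v)) * (f u * f v)))%:E)%E.
Proof.
have -> : e * power_spectrum T f t = (e * C t) * C t + (e * S t) * S t.
  by rewrite /power_spectrum -/(C t) -/(S t); ring.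
rewrite -fourier_inner; apply: eq_integral => u _.
have -> : (e * C t * cos (t * u) + e * S t * sin (t * u)) * f u =
   (e * f u * cos (t * u)) * C t + (e * f u * sin (t * u)) * S t by ring.
rewrite -fourier_inner; apply: eq_integral => v _; congr EFin.
by rewrite mulrBr cosB; ring.
Qed.

Lemma measurable_fourier_sq : measurable_fun [set: R] (fun t => power_spectrum T f t).
Proof.
have mm : measurable_fun [set: R * R] (fun p : R * R => p.1 * p.2).
  by apply: measurable_funM.
have m2 : measurable_fun [set: R * R] (fun p : R * R => f p.2) by exact: measurableT_comp.
apply: measurable_funD; apply: measurable_funX.
- apply: (@measurable_Rint_line _ _ _ A (fun p : R * R => cos (p.1 * p.2) * f p.2)) => //.
  apply: measurable_funM => //; apply: measurableT_comp => //.
  by apply: continuous_measurable_fun; exact: continuous_cos.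
- apply: (@measurable_Rint_line _ _ _ A (fun p : R * R => sin (p.1 * p.2) * f p.2)) => //.
  apply: measurable_funM => //; apply: measurableT_comp => //.
  by apply: continuous_measurable_fun; exact: continuous_sin.
Qed.

Let N1 : (\int[lambda]_(u in A) `|f u|%:E < +oo)%E.
Proof. by have /integrableP[_] := intf. Qed.

Let mabsf : measurable_fun [set: R] (fun u => `|f u|).
Proof. exact: measurableT_comp. Qed.

Let measurable_integrand l : measurable_fun [set: (R * R) * R]
  (fun p => expR (- (l * `|p.1.1|)) * (cos (p.1.1 * (p.1.2 - p.2)) * (f p.1.2 * f p.2))).
Proof.
have m11 : measurable_fun [set: (R * R) * R] (fun p : (R * R) * R => p.1.1).
  exact: measurableT_comp.
have m12 : measurable_fun [set: (R * R) * R] (fun p : (R * R) * R => p.1.2).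
  exact: measurableT_comp.
have m2 : measurable_fun [set: (R * R) * R] (fun p : (R * R) * R => p.2) by exact: measurable_snd.
apply: measurable_funM.
  exact: (measurableT_comp (measurable_laplace l) m11).
apply: measurable_funM.
  apply: measurableT_comp.
    by apply: continuous_measurable_fun; exact: continuous_cos.
  by apply: measurable_funM => //; apply: measurable_funB.
by apply: measurable_funM; apply: (measurableT_comp mf).
Qed.

Let integrand_le l t u v :
  `|expR (- (l * `|t|)) * (cos (t * (u - v)) * (f u * f v))| <=
   expR (- (l * `|t|)) * `|f u| * `|f v|.
Proof.
rewrite !normrM ger0_norm ?expR_ge0// -mulrA ler_wpM2l ?expR_ge0//.
by rewrite ler_piMl ?mulr_ge0// cos_max.
Qed.

Let integral_laplace_abs_lty l : 0 < l ->
  (\int[lambda]_t (expR (- (l * `|t|)))%:E < +oo)%E.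
Proof.
move=> l0; have /integrableP[_] := integrable_laplace l0.
by under eq_integral do rewrite gee0_abs ?lee_fin ?expR_ge0//.
Qed.

(** Averaging |F f|^2 against a Laplace density in frequency amounts to testing
    f (u) f (v) against a Cauchy kernel in u - v.  For integrable f everything
    converges absolutely, so this is Fubini's theorem and the Fourier transform of
    the Laplace kernel. *)
Lemma fourier_laplace (l : R) : 0 < l ->
  (\int[lambda]_t (expR (- (l * `|t|)) * power_spectrum T f t)%:E =
   \int[lambda]_(u in A) \int[lambda]_(v in A)
     (2 * l / (l ^+ 2 + (u - v) ^+ 2) * (f u * f v))%:E)%E.
Proof.
move=> l0.
pose g (t u v : R) := expR (- (l * `|t|)) * (cos (t * (u - v)) * (f u * f v)).
have mg : measurable_fun [set: (R * R) * R] (fun p => (g p.1.1 p.1.2 p.2)%:E).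
  by apply: measurable_EFin_on; exact: measurable_integrand.
have mgt t : measurable_fun [set: R * R] (fun p : R * R => (g t p.1 p.2)%:E).
  have h : measurable_fun [set: R * R] (fun p : R * R => ((t, p.1), p.2)).
    by apply: measurable_fun_pair => //; apply: measurable_fun_pair.
  exact: (measurableT_comp mg h).
have mgu u : measurable_fun [set: R * R] (fun p : R * R => (g p.1 u p.2)%:E).
  have h : measurable_fun [set: R * R] (fun p : R * R => ((p.1, u), p.2)).
    by apply: measurable_fun_pair => //; apply: measurable_fun_pair.
  exact: (measurableT_comp mg h).
have mgtu t u : measurable_fun [set: R] (fun v : R => (g t u v)%:E).
  have h : measurable_fun [set: R] (fun v : R => (u, v)).
    by apply: measurable_fun_pair.
  exact: (measurableT_comp (mgt t) h).
have mgtuA t u : measurable_fun A (fun v : R => (g t u v)%:E).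
  exact: measurable_funTS.
have mgtuAa t u : measurable_fun A (fun v : R => `|(g t u v)%:E|%E).
  exact: measurableT_comp.
pose n := fine (\int[lambda]_(u in A) `|f u|%:E)%E.
have nE : (\int[lambda]_(u in A) `|f u|%:E = n%:E)%E.
  by rewrite fineK// ge0_fin_numE// integral_ge0.
have n0 : 0 <= n by rewrite -lee_fin -nE integral_ge0.
pose b := fine (\int[lambda]_t (expR (- (l * `|t|)))%:E)%E.
have bE : (\int[lambda]_t (expR (- (l * `|t|)))%:E = b%:E)%E.
  by rewrite fineK// ge0_fin_numE ?integral_laplace_abs_lty// integral_ge0.
have int_abs (c : R) : 0 <= c -> (\int[lambda]_(v in A) (c * `|f v|)%:E = (c * n)%:E)%E.
  move=> c0; under eq_integral do rewrite EFinM.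
  rewrite ge0_integralZl// ?nE//.
    exact: measurable_EFin_on.
have int_lap (c : R) : 0 <= c ->
    (\int[lambda]_t (expR (- (l * `|t|)) * c)%:E = (b * c)%:E)%E.
  move=> c0; under eq_integral do rewrite EFinM.
  rewrite ge0_integralZr// ?bE//.
    by apply: measurable_EFin_on; exact: measurable_laplace.
transitivity (\int[lambda]_t \int[lambda]_(u in A) \int[lambda]_(v in A) (g t u v)%:E)%E.
  by apply: eq_integral => t _; rewrite -fourier_sq.
transitivity (\int[lambda]_(u in A) \int[lambda]_t \int[lambda]_(v in A) (g t u v)%:E)%E.
  apply: (@fubini_plane _ setT A
    (fun p : R * R => (\int[lambda]_(v in A) (g p.1 p.2 v)%:E)%E)) => //.
    exact: (@measurable_int_line _ _ _ A (fun p : R * R * R => (g p.1.1 p.1.2 p.2)%:E)).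
  apply: (@le_lt_trans _ _ (\int[lambda]_t (expR (- (l * `|t|)) * (n * n))%:E)%E);
    last by rewrite int_lap ?ltry// mulr_ge0.
  apply: ge0_le_integral => //.
  - by move=> t _; exact: integral_ge0.
  - apply: (@measurable_int_line _ _ _ A (fun p : R * R =>
      `|(\int[lambda]_(v in A) (g p.1 p.2 v)%:E)%E|%E)) => //.
    apply: measurableT_comp => //.
    exact: (@measurable_int_line _ _ _ A (fun p : R * R * R => (g p.1.1 p.1.2 p.2)%:E)).
  - apply: measurable_EFin_on; apply: measurable_funM => //; exact: measurable_laplace.
  - move=> t _; rewrite mulrA (mulrAC _ n) -int_abs ?mulr_ge0 ?expR_ge0//.
    apply: ge0_le_integral => //.
    + apply: measurable_funTS; apply: measurableT_comp => //.
      exact: (@measurable_int_line _ _ _ A (fun p : R * R => (g t p.1 p.2)%:E)).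
    + by apply: measurable_EFin_on; exact: measurable_funM.
    + move=> u _; rewrite mulrAC -int_abs ?mulr_ge0 ?expR_ge0//.
      apply: (le_trans (le_abse_integral _ _ _)) => //.
        exact: mgtuA.
      apply: ge0_le_integral => //.
      * exact: mgtuAa.
      * by apply: measurable_EFin_on; exact: measurable_funM.
      * by move=> v _; rewrite lee_fin integrand_le.
apply: eq_integral => u _.
transitivity (\int[lambda]_(v in A) \int[lambda]_t (g t u v)%:E)%E.
  apply: (@fubini_plane _ setT A (fun p : R * R => (g p.1 u p.2)%:E)) => //.
  apply: (@le_lt_trans _ _ (\int[lambda]_t (expR (- (l * `|t|)) * (`|f u| * n))%:E)%E);
    last by rewrite int_lap ?ltry// mulr_ge0.
  apply: ge0_le_integral => //.
  - by move=> t _; exact: integral_ge0.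
  - apply: (@measurable_int_line _ _ _ A (fun p : R * R => `|(g p.1 u p.2)%:E|%E)) => //.
    exact: measurableT_comp.
  - apply: measurable_EFin_on; apply: measurable_funM => //; exact: measurable_laplace.
  - move=> t _; rewrite mulrA -int_abs ?mulr_ge0 ?expR_ge0//.
    apply: ge0_le_integral => //.
    + exact: mgtuAa.
    + by apply: measurable_EFin_on; exact: measurable_funM.
    + by move=> v _; rewrite lee_fin integrand_le.
apply: eq_integral => v _; rewrite EFinM -integral_laplace_cos//.
transitivity (\int[lambda]_t ((f u * f v)%:E * (expR (- (l * `|t|)) * cos ((u - v) * t))%:E))%E.
  by apply: eq_integral => t _; rewrite /g -EFinM (mulrC t); congr EFin; ring.
rewrite [RHS]muleC integralZl; [by []|exact: measurableT|].
apply: le_integrable (integrable_laplace l0) => //.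
  apply: measurable_EFin_on; apply: measurable_funM; first exact: measurable_laplace.
  exact: measurable_cosM.
move=> t _ /=; rewrite lee_fin normrM ger0_norm ?expR_ge0// ler_piMr ?expR_ge0//.
exact: cos_max.
Qed.

End fourier_laplace.

(** * Spectrum and Riesz kernel in one dimension *)

Lemma measurable_fun_powR d (X : measurableType d) (R : realType) (p : R) (f : X -> R) :
  measurable_fun [set: X] f -> measurable_fun [set: X] (fun x => f x `^ p).
Proof.
by move=> mf; apply: (@measurableT_comp _ _ _ _ _ _ (fun x : R => x `^ p)).
Qed.

Lemma eq_integral_off_point {R : realType} (D : set R) (r : R) (f g : R -> \bar R) :
  measurable D -> measurable_fun [set: R] f -> measurable_fun [set: R] g ->
  (forall x, D x -> x != r -> f x = g x) ->
  (\int[@lebesgue_measure R]_(x in D) f x = \int[@lebesgue_measure R]_(x in D) g x)%E.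
Proof.
move=> mD mf mg fg; have mDr : measurable (D `\ r) by exact: measurableD.
rewrite -(integral_setD1 mDr); last exact: measurable_funTS.
rewrite -[RHS](integral_setD1 mDr); last exact: measurable_funTS.
by apply: eq_integral => x; rewrite inE/= => -[Dx /eqP]; exact: fg.
Qed.

Section kernel_line.
Context {R : realType} (T : R).
Local Notation lambda := (@lebesgue_measure R).
Local Notation A := (`[0%R, T]%classic : set R).
Local Notation P := (`]0%R, +oo[%classic : set R).

Lemma measurable_kernel (h : R) :
  measurable_fun [set: R * R] (fun p : R * R => `|p.1 - p.2| `^ (h - 1)).
Proof.
apply: measurable_fun_powR; apply: measurableT_comp => //; exact: measurable_funB.
Qed.

(* On l > 0 the absolute value of l changes nothing; on the whole line it makes
   F nonnegative, as Tonelli's theorem asks. *)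
Let F (h : R) (g : R -> R) (l u v : R) : R :=
  l `^ (h - 1) * (2 * `|l| / (l ^+ 2 + (u - v) ^+ 2) * (g u * g v)).

Let F_ge0 (h : R) (g : R -> R) (l u v : R) :
  (forall u, 0 <= g u) -> 0 <= F h g l u v.
Proof.
move=> g0; apply: mulr_ge0; first exact: powR_ge0.
apply: mulr_ge0; last exact: mulr_ge0.
by rewrite divr_ge0 ?mulr_ge0 ?addr_ge0 ?sqr_ge0.
Qed.

Let measurable_F (h : R) (g : R -> R) : measurable_fun [set: R] g ->
  measurable_fun [set: (R * R) * R] (fun p => F h g p.1.1 p.1.2 p.2).
Proof.
move=> mg.
have m11 : measurable_fun [set: (R * R) * R] (fun p : (R * R) * R => p.1.1).
  exact: measurableT_comp.
have m12 : measurable_fun [set: (R * R) * R] (fun p : (R * R) * R => p.1.2).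
  exact: measurableT_comp.
have m2 : measurable_fun [set: (R * R) * R] (fun p : (R * R) * R => p.2).
  exact: measurable_snd.
have ma : measurable_fun [set: (R * R) * R] (fun p : (R * R) * R => `|p.1.1|).
  exact: measurableT_comp.
apply: measurable_funM; first exact: measurable_fun_powR.
apply: measurable_funM; last first.
  by apply: measurable_funM; apply: (measurableT_comp mg).
apply: measurable_funM; first exact: measurable_funM.
apply: (measurableT_comp (@measurable_invr R)).
apply: measurable_funD; first exact: measurable_funX.
by apply: measurable_funX; exact: measurable_funB.
Qed.

Let measurable_Fu (h : R) (g : R -> R) u : measurable_fun [set: R] g ->
  measurable_fun [set: R * R] (fun p : R * R => (F h g p.1 u p.2)%:E).
Proof.
move=> mg; apply: measurable_EFin_on.
have hh : measurable_fun [set: R * R] (fun p : R * R => ((p.1, u), p.2)).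
  by apply: measurable_fun_pair => //; apply: measurable_fun_pair.
exact: (measurableT_comp (measurable_F h mg) hh).
Qed.

(** Integrating the Cauchy kernels over the parameter l gives the Riesz kernel
    |u - v|^(h-1), by Tonelli.  The hypothesis on c says nothing on the diagonal
    u = v, which is null for dv at each u. *)
Lemma cauchy_mixture (h c : R) (g : R -> R) :
  (forall w : R, w != 0 ->
    (\int[lambda]_(l in P) (l `^ (h - 1) * (2 * l / (l ^+ 2 + w ^+ 2)))%:E =
     (c * `|w| `^ (h - 1))%:E)%E) ->
  0 <= c -> measurable_fun [set: R] g -> (forall u, 0 <= g u) ->
  (\int[lambda]_(l in P) \int[lambda]_(u in A) \int[lambda]_(v in A) (F h g l u v)%:E =
   c%:E * \int[lambda]_(u in A) \int[lambda]_(v in A)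
      (g u * g v * `|u - v| `^ (h - 1))%:E)%E.
Proof.
move=> cE c0 mg g0.
have F0 l u v : 0 <= F h g l u v by exact: F_ge0.
transitivity (\int[lambda]_(u in A) \int[lambda]_(l in P) \int[lambda]_(v in A) (F h g l u v)%:E)%E.
  apply: (@tonelli_plane _ P A (fun p : R * R => (\int[lambda]_(v in A) (F h g p.1 p.2 v)%:E)%E)) => //.
    apply: (@measurable_int_line _ _ _ A (fun p : R * R * R => (F h g p.1.1 p.1.2 p.2)%:E)) => //.
    by apply: measurable_EFin_on; exact: measurable_F.
  by move=> p; apply: integral_ge0 => v _; rewrite lee_fin.
have mK : measurable_fun [set: R * R] (fun p : R * R => (g p.1 * g p.2 * `|p.1 - p.2| `^ (h - 1))%:E).
  apply: measurable_EFin_on; apply: measurable_funM; last exact: measurable_kernel.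
  by apply: measurable_funM; apply: (measurableT_comp mg).
rewrite -ge0_integralZl //; last 2 first.
- apply: measurable_funTS.
  exact: (@measurable_int_line _ _ _ A (fun p : R * R => (g p.1 * g p.2 * `|p.1 - p.2| `^ (h - 1))%:E)).
- by move=> u _; apply: integral_ge0 => v _; rewrite lee_fin mulr_ge0 ?mulr_ge0 ?powR_ge0.
apply: eq_integral => u _.
transitivity (\int[lambda]_(v in A) \int[lambda]_(l in P) (F h g l u v)%:E)%E.
  apply: (@tonelli_plane _ P A (fun p : R * R => (F h g p.1 u p.2)%:E)) => //.
    exact: measurable_Fu.
  by move=> p; rewrite lee_fin.
have mKu : measurable_fun [set: R] (fun v : R => (g u * g v * `|u - v| `^ (h - 1))%:E).
  exact: (measurableT_comp mK (pair1_measurable u)).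
rewrite -ge0_integralZl //; last 2 first.
- exact: measurable_funTS.
- by move=> v _; rewrite lee_fin mulr_ge0 ?mulr_ge0 ?powR_ge0.
apply: (@eq_integral_off_point _ _ u) => //.
- apply: (@measurable_int_line _ _ _ P (fun p : R * R => (F h g p.2 u p.1)%:E)) => //.
  exact: (measurableT_comp (measurable_Fu h u mg) (@measurable_swap _ _ _ _)).
- by apply: emeasurable_funM.
move=> v _ vu; have uv : u - v != 0 by rewrite subr_eq0 eq_sym.
transitivity (\int[lambda]_(l in P) ((l `^ (h - 1) * (2 * l / (l ^+ 2 + (u - v) ^+ 2)))%:E * (g u * g v)%:E))%E.
  apply: eq_integral => l; rewrite inE/= in_itv/= andbT => l0.
  by rewrite /F gtr0_norm// -EFinM !mulrA.
rewrite ge0_integralZr //; last 3 first.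
- apply: measurable_EFin_on; apply: measurable_funM => //; exact: measurable_cauchy.
- move=> l; rewrite /= in_itv/= andbT => l0.
  by rewrite lee_fin mulr_ge0 ?powR_ge0// divr_ge0 ?mulr_ge0 ?addr_ge0 ?sqr_ge0// ltW.
- by rewrite lee_fin mulr_ge0.
by rewrite cE// -!EFinM; congr EFin; ring.
Qed.

(** The same exchange on the frequency side: the weight |t|^(-h) is a mixture of
    Laplace kernels, except at t = 0. *)
Lemma spectrum_mixture (h c : R) (f : R -> R) :
  (forall t : R, 0 < t ->
    (\int[lambda]_(l in P) (l `^ (h - 1) * expR (- (l * t)))%:E =
     (c * t `^ (- h))%:E)%E) ->
  0 <= c -> measurable_fun [set: R] f ->
  (c%:E * \int[lambda]_t (power_spectrum T f t * `|t| `^ (- h))%:E =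
   \int[lambda]_(l in P) ((l `^ (h - 1))%:E *
     \int[lambda]_t (expR (- (l * `|t|)) * power_spectrum T f t)%:E))%E.
Proof.
move=> cE c0 mf.
have mS := measurable_fourier_sq T mf.
have S0 := power_spectrum_ge0 T f.
rewrite -ge0_integralZl //; last 2 first.
- apply: measurable_EFin_on; apply: measurable_funM => //.
  by apply: measurable_fun_powR; try exact: normr_measurable.
- by move=> t _; rewrite lee_fin mulr_ge0 ?powR_ge0.
have mG : measurable_fun [set: R * R] (fun p : R * R =>
    p.2 `^ (h - 1) * (expR (- (p.2 * `|p.1|)) * power_spectrum T f p.1)).
  apply: measurable_funM; first by apply: measurable_fun_powR; exact: measurable_snd.
  apply: measurable_funM; last exact: (measurableT_comp mS).
  apply: measurableT_comp => //; apply: measurableT_comp => //; apply: measurable_funM => //.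
  exact: measurableT_comp.
transitivity (\int[lambda]_t \int[lambda]_(l in P)
    (l `^ (h - 1) * (expR (- (l * `|t|)) * power_spectrum T f t))%:E)%E.
  apply: (@eq_integral_off_point _ _ 0) => //.
  + apply: emeasurable_funM => //; apply: measurable_EFin_on; apply: measurable_funM => //.
    by apply: measurable_fun_powR; try exact: normr_measurable.
  + apply: (@measurable_int_line _ _ _ P (fun p : R * R =>
      (p.2 `^ (h - 1) * (expR (- (p.2 * `|p.1|)) * power_spectrum T f p.1))%:E)) => //.
    apply: measurable_EFin_on; exact: mG.
  move=> t _ t0; have t1 : 0 < `|t| by rewrite normr_gt0.
  transitivity (\int[lambda]_(l in P) ((l `^ (h - 1) * expR (- (l * `|t|)))%:E * (power_spectrum T f t)%:E))%E.
    rewrite ge0_integralZr //.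
    + by rewrite cE// -!EFinM; congr EFin; ring.
    + apply: measurable_EFin_on; apply: measurable_funM => //; apply: measurableT_comp => //.
      by apply: measurableT_comp => //; exact: measurable_funM.
    + by move=> l _; rewrite lee_fin mulr_ge0 ?powR_ge0 ?expR_ge0.
    + by rewrite lee_fin.
  by apply: eq_integral => l _; rewrite -EFinM mulrA.
transitivity (\int[lambda]_(l in P) \int[lambda]_t
    (l `^ (h - 1) * (expR (- (l * `|t|)) * power_spectrum T f t))%:E)%E.
  apply: (@tonelli_plane _ setT P (fun p : R * R =>
    (p.2 `^ (h - 1) * (expR (- (p.2 * `|p.1|)) * power_spectrum T f p.1))%:E)) => //.
    exact: measurable_EFin_on.
  by move=> p; rewrite lee_fin mulr_ge0 ?powR_ge0// mulr_ge0 ?expR_ge0.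
apply: eq_integral => l; rewrite inE/= in_itv/= andbT => l0.
under eq_integral do rewrite EFinM.
rewrite ge0_integralZl //; last 3 first.
- apply: measurable_EFin_on; apply: measurable_funM => //; exact: measurable_laplace.
- by move=> t _; rewrite lee_fin mulr_ge0 ?expR_ge0.
- by rewrite lee_fin powR_ge0.
Qed.

Let measurable_laplace_spectrum (f : R -> R) : measurable_fun [set: R] f ->
  measurable_fun [set: R] (fun l => \int[lambda]_t (expR (- (l * `|t|)) * power_spectrum T f t)%:E)%E.
Proof.
move=> mf; have mS := measurable_fourier_sq T mf.
apply: (@measurable_int_line _ _ _ setT
   (fun p : R * R => (expR (- (p.1 * `|p.2|)) * power_spectrum T f p.2)%:E)) => //.
apply: measurable_EFin_on; apply: measurable_funM; last exact: (measurableT_comp mS).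
apply: measurableT_comp => //; apply: measurableT_comp => //; apply: measurable_funM => //.
exact: measurableT_comp.
Qed.

Let measurable_cauchy_form (l : R) (g : R -> R) : measurable_fun [set: R] g ->
  measurable_fun [set: R * R]
   (fun p : R * R => (2 * l / (l ^+ 2 + (p.1 - p.2) ^+ 2) * (g p.1 * g p.2))%:E).
Proof.
move=> mg; apply: measurable_EFin_on; apply: measurable_funM; last first.
  by apply: measurable_funM; apply: (measurableT_comp mg).
apply: measurable_funM => //; apply: (measurableT_comp (@measurable_invr R)).
by apply: measurable_funD => //; apply: measurable_funX; exact: measurable_funB.
Qed.

(** Each Laplace average of the spectrum is a quadratic form in f with the
    nonnegative Cauchy kernel, so it can only grow when f is replaced by |f|. *)
Lemma spectrum_abs_le (f : R -> R) (l : R) : 0 < l -> measurable_fun [set: R] f ->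
  lambda.-integrable A (EFin \o f) ->
  (\int[lambda]_t (expR (- (l * `|t|)) * power_spectrum T f t)%:E <=
   \int[lambda]_t (expR (- (l * `|t|)) * power_spectrum T (fun u => `|f u|) t)%:E)%E.
Proof.
move=> l0 mf intf.
have mf' : measurable_fun [set: R] (fun u => `|f u|) by exact: measurableT_comp.
have intf' : lambda.-integrable A (EFin \o (fun u => `|f u|)).
  exact: (integrable_norm intf).
rewrite (fourier_laplace mf intf l0) (fourier_laplace mf' intf' l0).
have c0 w : 0 <= 2 * l / (l ^+ 2 + w ^+ 2).
  by rewrite divr_ge0 ?mulr_ge0 ?addr_ge0 ?sqr_ge0// ltW.
have mC := @measurable_cauchy_form l.
have mCu (g : R -> R) u : measurable_fun [set: R] g -> measurable_fun A
   (fun v : R => (2 * l / (l ^+ 2 + (u - v) ^+ 2) * (g u * g v))%:E).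
  move=> mg; apply: measurable_funTS.
  exact: (measurableT_comp (mC g mg) (pair1_measurable u)).
apply: (le_trans (lee_abs _)).
have mI (g : R -> R) : measurable_fun [set: R] g -> measurable_fun A
   (fun u : R => \int[lambda]_(v in A) (2 * l / (l ^+ 2 + (u - v) ^+ 2) * (g u * g v))%:E)%E.
  move=> mg; apply: measurable_funTS.
  apply: (@measurable_int_line _ _ _ A
   (fun p : R * R => (2 * l / (l ^+ 2 + (p.1 - p.2) ^+ 2) * (g p.1 * g p.2))%:E)) => //.
  exact: mC.
apply: (le_trans (le_abse_integral _ _ _)) => //; first exact: mI.
apply: ge0_le_integral => //.
- by apply: measurableT_comp => //; exact: mI.
- exact: mI.
move=> u _; apply: (le_trans (le_abse_integral _ _ _)) => //; first exact: mCu.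
apply: ge0_le_integral => //.
- by apply: measurableT_comp => //; exact: mCu.
- exact: mCu.
- by move=> v _; rewrite lee_fin normrM (ger0_norm (c0 _)) normrM.
Qed.

(** For nonnegative f every exchange is an instance of Tonelli's theorem, hence an
    identity in [0, +oo]: neither side is assumed finite. *)
Lemma spectrum_kernel_eq (h c1 c2 : R) (f : R -> R) :
  (forall t : R, 0 < t ->
    (\int[lambda]_(l in P) (l `^ (h - 1) * expR (- (l * t)))%:E =
     (c1 * t `^ (- h))%:E)%E) ->
  (forall w : R, w != 0 ->
    (\int[lambda]_(l in P) (l `^ (h - 1) * (2 * l / (l ^+ 2 + w ^+ 2)))%:E =
     (c2 * `|w| `^ (h - 1))%:E)%E) ->
  0 <= c1 -> 0 <= c2 -> measurable_fun [set: R] f ->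
  lambda.-integrable A (EFin \o f) -> (forall u, 0 <= f u) ->
  (c1%:E * \int[lambda]_t (power_spectrum T f t * `|t| `^ (- h))%:E =
   c2%:E * \int[lambda]_(u in A) \int[lambda]_(v in A)
      (f u * f v * `|u - v| `^ (h - 1))%:E)%E.
Proof.
move=> E1 E2 c10 c20 mf intf f0.
rewrite (spectrum_mixture E1)// -(cauchy_mixture E2)//.
apply: eq_integral => l; rewrite inE/= in_itv/= andbT => l0.
have c0 w : 0 <= 2 * l / (l ^+ 2 + w ^+ 2).
  by rewrite divr_ge0 ?mulr_ge0 ?addr_ge0 ?sqr_ge0// ltW.
have mC := measurable_cauchy_form l mf.
rewrite (fourier_laplace mf intf l0) -ge0_integralZl //; first last.
- by rewrite lee_fin powR_ge0.
- move=> u _; apply: integral_ge0 => v _.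
  by rewrite lee_fin; apply: mulr_ge0 (c0 _) _; exact: mulr_ge0.
- apply: measurable_funTS.
  exact: (@measurable_int_line _ _ _ A
   (fun p : R * R => (2 * l / (l ^+ 2 + (p.1 - p.2) ^+ 2) * (f p.1 * f p.2))%:E)).
apply: eq_integral => u _.
rewrite -ge0_integralZl //; first last.
- by rewrite lee_fin powR_ge0.
- by move=> v _; rewrite lee_fin; apply: mulr_ge0 (c0 _) _; exact: mulr_ge0.
- apply: measurable_funTS.
  exact: (measurableT_comp mC (pair1_measurable u)).
by apply: eq_integral => v _; rewrite -EFinM /F gtr0_norm.
Qed.

(** For f of arbitrary sign the inequality holds under the mixture, l by l. *)
Lemma spectrum_kernel_le (h c1 : R) (f : R -> R) :
  (forall t : R, 0 < t ->
    (\int[lambda]_(l in P) (l `^ (h - 1) * expR (- (l * t)))%:E =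
     (c1 * t `^ (- h))%:E)%E) ->
  0 <= c1 -> measurable_fun [set: R] f ->
  lambda.-integrable A (EFin \o f) ->
  (c1%:E * \int[lambda]_t (power_spectrum T f t * `|t| `^ (- h))%:E <=
   c1%:E * \int[lambda]_t (power_spectrum T (fun u => `|f u|) t * `|t| `^ (- h))%:E)%E.
Proof.
move=> E1 c10 mf intf.
have mf' : measurable_fun [set: R] (fun u => `|f u|) by exact: measurableT_comp.
have mI (g : R -> R) : measurable_fun [set: R] g -> measurable_fun P
   (fun l => (l `^ (h - 1))%:E * \int[lambda]_t (expR (- (l * `|t|)) * power_spectrum T g t)%:E)%E.
  move=> mg; apply: measurable_funTS; apply: emeasurable_funM.
    by apply: measurable_EFin_on; exact: measurable_powR.
  exact: measurable_laplace_spectrum.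
rewrite (spectrum_mixture E1 c10 mf) (spectrum_mixture E1 c10 mf').
apply: ge0_le_integral; first exact: measurable_itv.
- move=> l _; rewrite mule_ge0 ?lee_fin ?powR_ge0//; apply: integral_ge0 => t _.
  by rewrite lee_fin mulr_ge0 ?expR_ge0 ?power_spectrum_ge0.
- exact: mI.
- exact: mI.
move=> l; rewrite /= in_itv/= andbT => l0.
by apply: lee_wpmul2l; [rewrite lee_fin powR_ge0|exact: spectrum_abs_le].
Qed.

End kernel_line.

(** * Spectral form and kernel form on spacetime *)

Section kernel_space.
Context {R : realType} (d : nat) (T : R).
Local Notation lambda := (@lebesgue_measure R).
Local Notation mu := (@lebesgue_rV R d).
Local Notation A := (`[0%R, T]%classic : set R).
Implicit Types phi : R * 'rV[R]_d -> R.

Lemma measurable_slice phi x : measurable_fun [set: R * 'rV[R]_d] phi ->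
  measurable_fun [set: R] (fun u => phi (u, x)).
Proof.
move=> mphi.
exact: (measurableT_comp mphi (pair2_measurable x)).
Qed.

Lemma measurable_trig_transform (g : R -> R) phi :
  measurable_fun [set: R] g -> measurable_fun [set: R * 'rV[R]_d] phi ->
  measurable_fun [set: R * 'rV[R]_d]
    (fun p => \int[lambda]_(t in A) (g (p.1 * t) * phi (t, p.2))).
Proof.
move=> mg mphi.
apply: (@measurable_Rint_line _ _ _ A (fun q : (R * 'rV[R]_d) * R => g (q.1.1 * q.2) * phi (q.2, q.1.2))) => //.
apply: measurable_funM.
  apply: (measurableT_comp mg); apply: measurable_funM => //.
  exact: measurableT_comp.
apply: (measurableT_comp mphi); apply: measurable_fun_pair => //.
exact: measurableT_comp.
Qed.

Lemma measurable_spectrum_space phi : measurable_fun [set: R * 'rV[R]_d] phi ->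
  measurable_fun [set: R * 'rV[R]_d]
    (fun p => power_spectrum T (fun t => phi (t, p.2)) p.1).
Proof.
move=> mphi; apply: measurable_funD; apply: measurable_funX;
  apply: measurable_trig_transform => //; apply: continuous_measurable_fun.
- exact: continuous_cos.
- exact: continuous_sin.
Qed.

(** Up to a constant factor, the squared norm of the space H; the next form is
    what membership in |H| bounds. *)
Definition spectral_form (H : R) phi : \bar R :=
  (\int[lambda]_tau \int[mu]_x
     ((complex.ComplexField.Normc.normc (fourier0Tx T phi tau x)) ^+ 2 *
      `|tau| `^ (- (2 * H - 1)))%:E)%E.

Definition kernel_form (H : R) phi : \bar R :=
  (\int[lambda]_(u in `[0%R, T]) \int[lambda]_(v in `[0%R, T]) \int[mu]_x
     (`|phi (u, x)| * `|phi (v, x)| * `|u - v| `^ (2 * H - 2))%:E)%E.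

Lemma spectral_formE (H : R) phi : measurable_fun [set: R * 'rV[R]_d] phi ->
  (spectral_form H phi = \int[mu]_x \int[lambda]_t
    (power_spectrum T (fun u => phi (u, x)) t * `|t| `^ (- (2 * H - 1)))%:E)%E.
Proof.
move=> mphi; rewrite /spectral_form.
transitivity (\int[lambda]_t \int[mu]_x
    (power_spectrum T (fun u => phi (u, x)) t * `|t| `^ (- (2 * H - 1)))%:E)%E.
  by apply: eq_integral => t _; apply: eq_integral => x _; rewrite /fourier0Tx normc_fourier0T.
apply: (@tonelli_line_rV R d setT (fun p => (power_spectrum T (fun u => phi (u, p.2)) p.1 *
    `|p.1| `^ (- (2 * H - 1)))%:E)) => //.
- apply: measurable_EFin_on; apply: measurable_funM; first exact: measurable_spectrum_space.
  by apply: measurable_fun_powR; apply: measurableT_comp.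
- by move=> p; rewrite lee_fin mulr_ge0 ?powR_ge0// power_spectrum_ge0.
Qed.

Let kern (H : R) phi (u v : R) x : R :=
  `|phi (u, x)| * `|phi (v, x)| * `|u - v| `^ (2 * H - 2).

Let kern_ge0 H phi u v x : 0 <= kern H phi u v x.
Proof. by rewrite mulr_ge0 ?powR_ge0// mulr_ge0. Qed.

Let measurable_kern H phi : measurable_fun [set: R * 'rV[R]_d] phi ->
  measurable_fun [set: (R * 'rV[R]_d) * R] (fun q => (kern H phi q.1.1 q.2 q.1.2)%:E).
Proof.
move=> mphi; apply: measurable_EFin_on; apply: measurable_funM.
  apply: measurable_funM; apply: measurableT_comp => //.
    apply: (measurableT_comp mphi); apply: measurable_fun_pair => //; exact: measurableT_comp.
  apply: (measurableT_comp mphi); apply: measurable_fun_pair => //; exact: measurableT_comp.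
apply: measurable_fun_powR; apply: measurableT_comp => //.
by apply: measurable_funB => //; exact: measurableT_comp.
Qed.

Lemma kernel_formE (H : R) phi : measurable_fun [set: R * 'rV[R]_d] phi ->
  (kernel_form H phi = \int[mu]_x \int[lambda]_(u in A) \int[lambda]_(v in A)
    (`|phi (u, x)| * `|phi (v, x)| * `|u - v| `^ (2 * H - 2))%:E)%E.
Proof.
move=> mphi; have mk := measurable_kern H mphi.
transitivity (\int[lambda]_(u in A) \int[mu]_x \int[lambda]_(v in A) (kern H phi u v x)%:E)%E; last first.
  apply: (@tonelli_line_rV R d A (fun p => \int[lambda]_(v in A) (kern H phi p.1 v p.2)%:E)%E) => //.
    exact: (@measurable_int_line _ _ _ A (fun q : (R * 'rV[R]_d) * R => (kern H phi q.1.1 q.2 q.1.2)%:E)).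
  by move=> p; apply: integral_ge0 => v _; rewrite lee_fin.
apply: eq_integral => u _.
apply: (@tonelli_line_rV R d A (fun p => (kern H phi u p.1 p.2)%:E)) => //; last first.
  by move=> p; rewrite lee_fin.
have hh : measurable_fun [set: R * 'rV[R]_d] (fun p : R * 'rV[R]_d => ((u, p.2), p.1)).
  by apply: measurable_fun_pair => //; apply: measurable_fun_pair.
exact: (measurableT_comp mk hh).
Qed.

Lemma measurable_kernel_slice (H : R) phi : measurable_fun [set: R * 'rV[R]_d] phi ->
  measurable_fun [set: 'rV[R]_d] (fun x => \int[lambda]_(u in A) \int[lambda]_(v in A)
    (`|phi (u, x)| * `|phi (v, x)| * `|u - v| `^ (2 * H - 2))%:E)%E.
Proof.
move=> mphi; have mk := measurable_kern H mphi.
apply: (@measurable_int_line _ _ _ A (fun q : 'rV[R]_d * R =>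
   \int[lambda]_(v in A) (kern H phi q.2 v q.1)%:E)%E) => //.
have hh : measurable_fun [set: 'rV[R]_d * R * R] (fun p : 'rV[R]_d * R * R => ((p.1.2, p.1.1), p.2)).
  apply: measurable_fun_pair => //.
  by apply: measurable_fun_pair; apply: measurableT_comp.
exact: (@measurable_int_line _ _ _ A (fun q : ('rV[R]_d * R) * R => (kern H phi q.1.2 q.2 q.1.1)%:E)
  _ (measurableT_comp mk hh)).
Qed.

Lemma measurable_spectral_slice (H : R) phi : measurable_fun [set: R * 'rV[R]_d] phi ->
  measurable_fun [set: 'rV[R]_d] (fun x => \int[lambda]_t
    (power_spectrum T (fun u => phi (u, x)) t * `|t| `^ (- (2 * H - 1)))%:E)%E.
Proof.
move=> mphi; apply: (@measurable_int_line _ _ _ setT (fun q : 'rV[R]_d * R =>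
   (power_spectrum T (fun u => phi (u, q.1)) q.2 * `|q.2| `^ (- (2 * H - 1)))%:E)) => //.
apply: measurable_EFin_on; apply: measurable_funM.
  exact: (measurableT_comp (measurable_spectrum_space mphi) (@measurable_swap _ _ _ _)).
by apply: measurable_fun_powR; apply: measurableT_comp.
Qed.

End kernel_space.

Section comparison.
Context {R : realType}.
Local Notation lambda := (@lebesgue_measure R).
Local Notation P := (`]0%R, +oo[%classic : set R).

(** The comparison behind every estimate of the norm.  The constant K depends on
    neither the dimension nor T nor phi.  The sections phi (., x) only need to be
    integrable for almost all x: in dimension at least 2 the section of the heat
    kernel through its singularity is not. *)
Theorem spectral_kernel (H : R) : 2^-1 < H < 1 -> exists2 K : R, 0 < K &
  forall (d : nat) (T : R) (phi : R * 'rV[R]_d -> R),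
  measurable_fun [set: R * 'rV[R]_d] phi ->
  {ae lebesgue_rV d, forall x, lambda.-integrable (`[0, T] : set R) (fun u => (phi (u, x))%:E)} ->
  (spectral_form T H phi <= K%:E * kernel_form T H phi)%E /\
  ((forall p, 0 <= phi p) -> (spectral_form T H phi = K%:E * kernel_form T H phi)%E).
Proof.
move=> /andP[H2 H1]; pose h := 2 * H - 1.
have h01 : 0 < h < 1 by apply/andP; rewrite /h; split; lra.
have [c1 c10 E1] := laplace_powR h01.
have [c2 c20 E2] := cauchy_powR h01.
have hE : h - 1 = 2 * H - 2 by rewrite /h; ring.
exists (c2 / c1); first exact: divr_gt0.
move=> d T phi mphi intphi.
rewrite spectral_formE// kernel_formE//.
have c12 (x : \bar R) : (0 <= x)%E -> ((c2 / c1)%:E * x = c1^-1%:E * (c2%:E * x))%E.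
  by move=> x0; rewrite muleA -EFinM mulrC.
have cK (x : \bar R) : (0 <= x)%E -> (x = c1^-1%:E * (c1%:E * x))%E.
  by move=> x0; rewrite muleA -EFinM mulVf ?gt_eqF// mul1e.
have k0 x : (0 <= \int[lambda]_(u in `[0%R, T]) \int[lambda]_(v in `[0%R, T])
    (`|phi (u, x)| * `|phi (v, x)| * `|u - v| `^ (2 * H - 2))%:E)%E.
  apply: integral_ge0 => u _; apply: integral_ge0 => v _.
  by rewrite lee_fin mulr_ge0 ?powR_ge0// mulr_ge0.
have s0 (f : R -> R) : (0 <= \int[lambda]_t (power_spectrum T f t * `|t| `^ (- (2 * H - 1)))%:E)%E.
  by apply: integral_ge0 => t _; rewrite lee_fin mulr_ge0 ?powR_ge0// power_spectrum_ge0.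
have mks := measurable_kernel_slice T H mphi.
have mss := measurable_spectral_slice T H mphi.
have eqabs x : lambda.-integrable (`[0, T] : set R) (fun u => (phi (u, x))%:E) ->
  (\int[lambda]_t (power_spectrum T (fun u => `|phi (u, x)|) t * `|t| `^ (- (2 * H - 1)))%:E =
   (c2 / c1)%:E * \int[lambda]_(u in `[0%R, T]) \int[lambda]_(v in `[0%R, T])
    (`|phi (u, x)| * `|phi (v, x)| * `|u - v| `^ (2 * H - 2))%:E)%E.
  move=> ix; rewrite c12// [LHS]cK//; congr (_ * _)%E.
  have mx := measurable_slice x mphi.
  have := @spectrum_kernel_eq R T h c1 c2 (fun u => `|phi (u, x)|) E1 E2 (ltW c10) (ltW c20).
  rewrite hE; apply => //; first exact: measurableT_comp.
  exact: (integrable_norm ix).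
rewrite -ge0_integralZl //; last by rewrite lee_fin divr_ge0// ltW.
split.
- apply: ae_ge0_le_integral => //.
  + by move=> x _; rewrite mule_ge0// lee_fin divr_ge0// ltW.
  + by apply: emeasurable_funM.
  + move: intphi; apply: filterS => x ix _; rewrite -(eqabs x ix) [leLHS]cK ?s0 // [leRHS]cK ?s0 //.
    apply: lee_wpmul2l; first by rewrite lee_fin invr_ge0 ltW.
    have := @spectrum_kernel_le R T h c1 (fun u => phi (u, x)) E1 (ltW c10).
    by apply => //; exact: measurable_slice.
- move=> phi0; apply: ge0_ae_eq_integral => //.
  + by apply: emeasurable_funM.
  + by move=> x _; rewrite mule_ge0// lee_fin divr_ge0// ltW.
  + move: intphi; apply: filterS => x ix _; rewrite -(eqabs x ix).
    have -> // : (fun u => phi (u, x)) = (fun u => `|phi (u, x)|).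
    by apply/funext => u; rewrite ger0_norm.
Qed.

End comparison.

(** * Space integrals of the heat kernel *)

Section heat_space.
Context {R : realType}.
Local Notation lambda := (@lebesgue_measure R).

Lemma integral_gauss_scale (c m : R) : 0 < c ->
  (\int[lambda]_y (expR (- (c * (m - y) ^+ 2)))%:E = (Num.sqrt (pi / c))%:E)%E.
Proof.
move=> c0; have s0 : 0 < Num.sqrt c by rewrite sqrtr_gt0.
have := @ge0_integral_affine R (Num.sqrt c) (- (Num.sqrt c * m)) (fun x => (gauss_fun x)%:E).
rewrite gt_eqF// integralT_gauss ger0_norm ?(ltW s0)// => H.
have {H} := H isT _ _.
have mg : measurable_fun [set: R] (fun x : R => (gauss_fun x)%:E).
  by apply: measurable_EFin_on; exact: measurable_gauss_fun.
move=> /(_ mg) H; have {H} := H (fun x => _).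
have g0 (x : R) : (0 <= (gauss_fun x)%:E)%E by rewrite lee_fin gauss_fun_ge0.
move=> /(_ g0).
have -> : (fun y : R => (gauss_fun (Num.sqrt c * y + - (Num.sqrt c * m)))%:E) =
          (fun y : R => (expR (- (c * (m - y) ^+ 2)))%:E).
  apply/funext => y; rewrite /gauss_fun -mulrBr exprMn sqr_sqrtr ?(ltW c0)//.
  by rewrite -[(y - m) ^+ 2]sqrrN opprB.
move=> E; rewrite sqrtrM ?pi_ge0// sqrtrV ?(ltW c0)// mulrC EFinM E muleA -EFinM.
by rewrite mulVf ?gt_eqF// mul1e.
Qed.

(* The heat kernel on the line, of which the one on R^d is a product. *)
Let g (a z : R) : R := (Num.sqrt (4 * pi * a))^-1 * expR (- (z ^+ 2 / (4 * a))).

Let g_ge0 a z : 0 <= g a z.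
Proof. by rewrite mulr_ge0 ?expR_ge0// invr_ge0 sqrtr_ge0. Qed.

Let measurable_g a : measurable_fun [set: R] (g a).
Proof.
apply: measurable_funM => //; apply: measurableT_comp => //; apply: measurable_funN.
by apply: measurable_funM => //; exact: measurable_funX.
Qed.

Lemma heat_prod (d : nat) (a : R) (z : 'rV[R]_d) : 0 < a ->
  heat a z = \prod_(i < d) g a (z ord0 i).
Proof.
move=> a0; rewrite /heat a0 big_split/= prodr_const card_ord; congr (_ * _).
  have p0 : 0 <= 4 * pi * a by rewrite !mulr_ge0 ?pi_ge0// ltW.
  rewrite powRN [d%:R / 2]mulrC powRrM powR12_sqrt// powR_mulrn ?sqrtr_ge0//.
  by rewrite exprVn.
rewrite /sqnorm mulr_suml -sumrN expR_sum.
by apply: eq_bigr => i _.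
Qed.

Lemma heat_le0 (d : nat) (a : R) (z : 'rV[R]_d) : a <= 0 -> heat a z = 0.
Proof. by move=> a0; rewrite /heat ltNge a0. Qed.

Lemma heat_ge0 (d : nat) (a : R) (z : 'rV[R]_d) : 0 <= heat a z.
Proof.
by rewrite /heat; case: ifP => // _; rewrite mulr_ge0 ?powR_ge0 ?expR_ge0.
Qed.

Lemma measurable_heat (d : nat) : measurable_fun [set: R * 'rV[R]_d]
  (fun p => heat p.1 p.2).
Proof.
rewrite /heat; apply: measurable_fun_ifT => //.
  by apply: measurable_fun_ltr.
apply: measurable_funM.
  by apply: measurable_fun_powR; exact: measurable_funM.
apply: measurableT_comp => //; apply: measurable_funN; apply: measurable_funM.
  apply: measurable_sum => i; apply: measurable_funX.
  exact: (measurableT_comp (measurable_coord i) measurable_snd).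
by apply: (measurableT_comp (@measurable_invr R)); exact: measurable_funM.
Qed.

Lemma measurable_heat_tx (d : nat) (t : R) (x : 'rV[R]_d) :
  measurable_fun [set: R * 'rV[R]_d] (heat_tx t x).
Proof.
have hh : measurable_fun [set: R * 'rV[R]_d] (fun p : R * 'rV[R]_d => (t - p.1, x - p.2)).
  apply: measurable_fun_pair; first exact: measurable_funB.
  apply: measurable_fun_rV => i.
  rewrite (_ : (fun p => _) = fun p : R * 'rV[R]_d => x ord0 i - p.2 ord0 i); last first.
    by apply/funext => p; rewrite !mxE.
  apply: measurable_funB => //.
  exact: (measurableT_comp (measurable_coord i) measurable_snd).
exact: (measurableT_comp (@measurable_heat d) hh).
Qed.

Let integral_g (a m : R) : 0 < a -> (\int[lambda]_y (g a (m - y))%:E = 1)%E.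
Proof.
move=> a0; under eq_integral do rewrite EFinM.
rewrite ge0_integralZl //; last first.
- apply: measurable_EFin_on; apply: measurableT_comp => //; apply: measurable_funN.
  by apply: measurable_funM => //; apply: measurable_funX; exact: measurable_funB.
have c0 : 0 < (4 * a)^-1 by rewrite invr_gt0 mulr_gt0.
have := integral_gauss_scale m c0.
under eq_integral do rewrite mulrC.
move=> ->; rewrite invrK -EFinM; congr EFin.
rewrite (_ : pi * (4 * a) = 4 * pi * a); last by ring.
by rewrite mulVf// gt_eqF// sqrtr_gt0 !mulr_gt0 ?pi_gt0.
Qed.

Let integral_gg (a b m : R) : 0 < a -> 0 < b ->
  (\int[lambda]_y (g a (m - y) * g b (m - y))%:E = ((Num.sqrt (4 * pi * (a + b)))^-1)%:E)%E.
Proof.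
move=> a0 b0; pose c := (4 * a)^-1 + (4 * b)^-1.
have c0 : 0 < c by rewrite addr_gt0// invr_gt0 mulr_gt0.
transitivity (\int[lambda]_y (((Num.sqrt (4 * pi * a))^-1 * (Num.sqrt (4 * pi * b))^-1)%:E *
    (expR (- (c * (m - y) ^+ 2)))%:E))%E.
  apply: eq_integral => y _; rewrite -EFinM; congr EFin.
  rewrite /g mulrACA -expRD; congr (_ * expR _); rewrite /c; ring.
rewrite ge0_integralZl //; last first.
- apply: measurable_EFin_on; apply: measurableT_comp => //; apply: measurable_funN.
  by apply: measurable_funM => //; apply: measurable_funX; exact: measurable_funB.
rewrite integral_gauss_scale// -EFinM; congr EFin.
rewrite /c; move: (pi_gt0 R); move: pi => p p0.
have pa : 0 <= 4 * p * a by rewrite !mulr_ge0 ?(ltW p0) ?(ltW a0).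
have pb : 0 <= 4 * p * b by rewrite !mulr_ge0 ?(ltW p0) ?(ltW b0).
have pab : 0 <= 4 * p * (a + b) by rewrite mulrDr addr_ge0.
rewrite -!sqrtrV // -!sqrtrM ?mulr_ge0 ?invr_ge0//.
congr Num.sqrt; field.
by rewrite !gt_eqF//= addr_gt0.
Qed.

Lemma integral_heat (d : nat) (a : R) (x : 'rV[R]_d) : 0 < a ->
  (\int[lebesgue_rV d]_y (heat a (x - y))%:E = 1)%E.
Proof.
move=> a0; under eq_integral do rewrite heat_prod//.
transitivity (\int[lebesgue_rV d]_y (\prod_(i < d) g a (x ord0 i - y ord0 i))%:E)%E.
  by apply: eq_integral => y _; congr EFin; apply: eq_bigr => i _; rewrite !mxE.
rewrite (@integral_rV_prod _ _ (fun i z => g a (x ord0 i - z)) (fun=> 1)) //.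
- by rewrite big1.
- move=> i; apply: (measurableT_comp (measurable_g a)); exact: measurable_funB.
- by move=> i; exact: integral_g.
Qed.

(** The semigroup property at the diagonal: G_a * G_b = G_(a+b), evaluated at 0. *)
Lemma integral_heat_heat (d : nat) (a b : R) (x : 'rV[R]_d) : 0 < a -> 0 < b ->
  (\int[lebesgue_rV d]_y (heat a (x - y) * heat b (x - y))%:E =
   ((4 * pi * (a + b)) `^ (- (d%:R / 2)))%:E)%E.
Proof.
move=> a0 b0.
transitivity (\int[lebesgue_rV d]_y (\prod_(i < d)
    (g a (x ord0 i - y ord0 i) * g b (x ord0 i - y ord0 i)))%:E)%E.
  apply: eq_integral => y _; congr EFin; rewrite !heat_prod// -big_split/=.
  by apply: eq_bigr => i _; rewrite !mxE.
rewrite (@integral_rV_prod _ _ (fun i z => g a (x ord0 i - z) * g b (x ord0 i - z))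
   (fun=> (Num.sqrt (4 * pi * (a + b)))^-1)) //.
- rewrite prodr_const card_ord; congr EFin.
  have pab : 0 <= 4 * pi * (a + b).
    by move: (pi_gt0 R); move: pi => p p0; rewrite !mulr_ge0 ?addr_ge0 ?(ltW p0) ?(ltW a0) ?(ltW b0).
  rewrite powRN [d%:R / 2]mulrC powRrM powR12_sqrt//.
  by rewrite powR_mulrn ?sqrtr_ge0// exprVn.
- move=> i; apply: measurable_funM.
    apply: (measurableT_comp (measurable_g a)); exact: measurable_funB.
  apply: (measurableT_comp (measurable_g b)); exact: measurable_funB.
- by move=> i z; exact: mulr_ge0.
- by move=> i; exact: integral_gg.
Qed.

End heat_space.

(** * Time integrals of the heat kernel *)

Section riesz_kernel.
Context {R : realType}.
Local Notation lambda := (@lebesgue_measure R).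

(** On each side of u the kernel is a translate or a reflection of w^q on (0, c]. *)
Lemma riesz_kernel_le (q c u : R) : -1 < q -> q < 0 -> 0 < c -> 0 <= u <= c ->
  (\int[lambda]_(v in `[0%R, c]) (`|u - v| `^ q)%:E <=
   (2 * (c `^ (q + 1) / (q + 1)))%:E)%E.
Proof.
move=> q1 q0 c0 /andP[u0 uc].
have [k [mk k0 kE kint]] : exists k : R -> \bar R, [/\ measurable_fun [set: R] k,
    (forall w, 0 <= k w)%E, (forall w, 0 < w -> w <= c -> k w = (w `^ q)%:E) &
    (\int[lambda]_w k w <= (c `^ (q + 1) / (q + 1))%:E)%E].
  exists ((fun w => (w `^ q)%:E) \_ (`]0, c]%classic : set R)); split.
  - apply: measurable_patch => //.
    by apply: measurable_EFin_on; exact: measurable_powR.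
  - by move=> w; rewrite patchE; case: ifP => // _; rewrite lee_fin powR_ge0.
  - by move=> w w0 wc; rewrite patchE ifT// inE/= in_itv/= w0.
  - by rewrite -integral_mkcond; exact: integral0_powR_le.
have mk1 : measurable_fun [set: R] (fun v : R => k (-1 * v + u)).
  by apply: (measurableT_comp mk); apply: measurable_funD => //; apply: measurable_funM.
have mk2 : measurable_fun [set: R] (fun v : R => k (1 * v + - u)).
  by apply: (measurableT_comp mk); apply: measurable_funD => //; apply: measurable_funM.
have k1E : (\int[lambda]_v k (-1 * v + u)%R = \int[lambda]_w k w)%E.
  have n0 : -1 != 0 :> R by rewrite oppr_eq0 oner_eq0.
  by have := ge0_integral_affine u n0 mk k0; rewrite normrN1 mul1e.
have k2E : (\int[lambda]_v k (1 * v + - u)%R = \int[lambda]_w k w)%E.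
  by have := ge0_integral_affine (- u) (oner_neq0 R) mk k0; rewrite normr1 mul1e.
have mD : measurable_fun [set: R] (fun v : R => (`|u - v| `^ q)%:E).
  apply: measurable_EFin_on; apply: measurable_fun_powR; apply: measurableT_comp => //.
  exact: measurable_funB.
apply: (@le_trans _ _ (\int[lambda]_(v in `[0%R, c]) (k (-1 * v + u)%R + k (1 * v + - u)%R))%E).
  apply: ge0_le_integral => //.
  - exact: measurable_funTS.
  - by apply: measurable_funTS; exact: emeasurable_funD.
  - move=> v; rewrite /= in_itv/= => /andP[v0 vc].
    have [uv|vu|->] := ltgtP u v.
    + rewrite [X in (_ + X)%E]kE; [|lra|lra].
      rewrite ler0_norm ?opprB; last by lra.
      by rewrite mul1r leeDr.
    + rewrite [X in (X + _)%E]kE; [|lra|lra].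
      rewrite ger0_norm; last by lra.
      by rewrite mulN1r addrC leeDl.
    + by rewrite subrr normr0 powR0 ?lt_eqF// adde_ge0.
apply: (@le_trans _ _ (\int[lambda]_v (k (-1 * v + u)%R + k (1 * v + - u)%R))%E).
  apply: ge0_subset_integral => //; first exact: emeasurable_funD.
  by move=> v _; rewrite adde_ge0.
rewrite ge0_integralD// k1E k2E mulr_natl mulr2n EFinD; exact: leeD.
Qed.

Lemma integral_time_reverse (T t : R) (psi : R -> \bar R) : 0 <= t <= T ->
  measurable_fun [set: R] psi -> (forall a, 0 <= psi a)%E ->
  (forall a, a <= 0 -> psi a = 0%E) ->
  (\int[lambda]_(u in `[0%R, T]) psi (t - u)%R = \int[lambda]_(a in `]0%R, t]) psi a)%E.
Proof.
move=> /andP[t0 tT] mpsi psi0 psiz.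
rewrite [LHS]integral_mkcond [RHS]integral_mkcond.
rewrite [RHS](@ge0_integral_affine _ (-1) t) ?oppr_eq0//; last 2 first.
- exact: measurable_patch.
- by move=> a; rewrite patchE; case: ifP.
rewrite normrN1 mul1e; apply: eq_integral => u _; rewrite !patchE.
have -> : -1 * u + t = t - u by ring.
case: ifPn => [|/negP]; rewrite inE/= in_itv/=.
  move=> /andP[u0 uT]; case: ifPn => // /negP; rewrite inE/= in_itv/= => h.
  by apply: psiz; rewrite leNgt; apply/negP => h'; apply: h; rewrite h'/=; lra.
move=> h; case: ifPn => //; rewrite inE/= in_itv/= => /andP[h1 h2].
by exfalso; apply: h; lra.
Qed.

Lemma powR_anti (p x y : R) : 0 <= p -> 0 < x -> x <= y -> y `^ (- p) <= x `^ (- p).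
Proof.
move=> p0 x0 xy; have y0 : 0 < y by exact: lt_le_trans xy.
by rewrite !powRN lef_pV2 ?posrE ?powR_gt0// ge0_ler_powR// nnegrE ltW.
Qed.

End riesz_kernel.

Section heat_time.
Context {R : realType}.
Local Notation lambda := (@lebesgue_measure R).

Let S (p q a b : R) : R := (4 * pi * (a + b)) `^ (- p) * `|a - b| `^ q.

Let S_ge0 p q a b : 0 <= S p q a b.
Proof. by rewrite mulr_ge0 ?powR_ge0. Qed.

Let measurable_S p q : measurable_fun [set: R * R] (fun z : R * R => S p q z.1 z.2).
Proof.
apply: measurable_funM; apply: measurable_fun_powR.
  by apply: measurable_funM => //; exact: measurable_funD.
by apply: measurableT_comp => //; exact: measurable_funB.
Qed.

(* S is bounded by M on the half b <= a of the square, where a + b >= a. *)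
Let M (p q a b : R) : R := (if b <= a then 1 else 0) * (a `^ (- p) * `|a - b| `^ q).

Let M_ge0 p q a b : 0 <= M p q a b.
Proof. by rewrite /M; case: ifP => _; rewrite ?mul0r// mul1r mulr_ge0 ?powR_ge0. Qed.

Let measurable_M p q : measurable_fun [set: R * R] (fun z : R * R => M p q z.1 z.2).
Proof.
apply: measurable_funM.
  by apply: measurable_fun_ifT => //; exact: measurable_fun_ler.
apply: measurable_funM; apply: measurable_fun_powR => //.
by apply: measurableT_comp => //; exact: measurable_funB.
Qed.

Let measurable_at (F : R -> R -> R) a :
  measurable_fun [set: R * R] (fun z : R * R => F z.1 z.2) ->
  measurable_fun [set: R] (F a).
Proof.
move=> mF.
exact: (measurableT_comp mF (pair1_measurable a)).
Qed.

Let integral_M (p q t : R) : 0 <= p -> -1 < q -> q < 0 -> p < q + 2 -> 0 < t ->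
  (\int[lambda]_(a in `]0%R, t]) \int[lambda]_(b in `]0%R, t]) (M p q a b)%:E < +oo)%E.
Proof.
move=> p0 q1 q0 pq t0.
apply: (@le_lt_trans _ _ (\int[lambda]_(a in `]0%R, t]) ((2 / (q + 1))%:E * (a `^ (q + 1 - p))%:E))%E).
  apply: ge0_le_integral => //.
  - by move=> a _; apply: integral_ge0 => b _; rewrite lee_fin.
  - apply: measurable_funTS.
    apply: (@measurable_int_line _ _ _ `]0, t]%classic (fun z : R * R => (M p q z.1 z.2)%:E)) => //.
    by apply: measurable_EFin_on; exact: measurable_M.
  - apply: measurable_funTS; apply: emeasurable_funM => //.
    by apply: measurable_EFin_on; exact: measurable_powR.
  move=> a; rewrite /= in_itv/= => /andP[a0 at_].
  apply: (@le_trans _ _ (\int[lambda]_(b in `[0%R, a]) ((a `^ (- p))%:E * (`|a - b| `^ q)%:E))%E).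
    rewrite [leLHS]integral_mkcond [leRHS]integral_mkcond; apply: ge0_le_integral => //.
    + by move=> b _; rewrite patchE; case: ifP => // _; rewrite lee_fin.
    + apply: measurable_patch => //; apply: measurable_EFin_on.
      exact: (measurable_at (F := M p q)).
    + apply: measurable_patch => //; apply: emeasurable_funM => //.
      apply: measurable_EFin_on; apply: measurable_fun_powR; apply: measurableT_comp => //.
      exact: measurable_funB.
    + move=> b _; rewrite !patchE; case: ifPn => [|_].
        rewrite inE/= in_itv/= => /andP[b0 bt]; rewrite /M; case: ifPn => [ba|ba].
          by rewrite ifT ?mul1r// inE/= in_itv/= ba ltW.
        by rewrite mul0r; case: ifP => // _; rewrite -EFinM lee_fin mulr_ge0 ?powR_ge0.
      by case: ifP => // _; rewrite -EFinM lee_fin mulr_ge0 ?powR_ge0.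
  rewrite ge0_integralZl ?lee_fin ?powR_ge0 //; last first.
    apply: measurable_EFin_on; apply: measurable_fun_powR; apply: measurableT_comp => //.
    exact: measurable_funB.
  apply: (@le_trans _ _ ((a `^ (- p))%:E * (2 * (a `^ (q + 1) / (q + 1)))%:E)%E).
    apply: lee_wpmul2l; first by rewrite lee_fin powR_ge0.
    by apply: riesz_kernel_le => //; rewrite lexx ltW.
  rewrite -!EFinM lee_fin [a `^ (q + 1 - p)]powRD; last by apply/implyP => _; rewrite gt_eqF.
  rewrite le_eqVlt; apply/orP; left; apply/eqP; field.
  by apply/eqP => h; lra.
rewrite ge0_integralZl //; last first.
- by rewrite lee_fin divr_ge0//; lra.
- by move=> x _; rewrite lee_fin powR_ge0.
- by apply: measurable_EFin_on; exact: measurable_powR.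
rewrite lte_mul_pinfty//; first by rewrite lee_fin divr_ge0//; lra.
by apply: le_lt_trans (integral0_powR_le _ t0) (ltry _); lra.
Qed.

(** The overlap is homogeneous of degree q - p on a square of dimension 2, whence
    the threshold p < q + 2.  On the half b <= a of the square, bounding (a + b)^(-p)
    by a^(-p) and integrating the Riesz kernel over b leaves a^(q+1-p). *)
Lemma overlap_lty (p q t : R) : 0 <= p -> -1 < q -> q < 0 -> p < q + 2 -> 0 < t ->
  (\int[lambda]_(a in `]0%R, t]) \int[lambda]_(b in `]0%R, t])
    ((4 * pi * (a + b)) `^ (- p) * `|a - b| `^ q)%:E < +oo)%E.
Proof.
move=> p0 q1 q0 pq t0; have I := integral_M p0 q1 q0 pq t0.
have mMp : measurable_fun [set: R * R] (fun z : R * R => (M p q z.1 z.2)%:E).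
  by apply: measurable_EFin_on; exact: measurable_M.
have mMp' : measurable_fun [set: R * R] (fun z : R * R => (M p q z.2 z.1)%:E).
  exact: (measurableT_comp mMp (@measurable_swap _ _ _ _)).
have I' : (\int[lambda]_(a in `]0%R, t]) \int[lambda]_(b in `]0%R, t]) (M p q b a)%:E < +oo)%E.
  have -> // : (\int[lambda]_(a in `]0%R, t]) \int[lambda]_(b in `]0%R, t]) (M p q b a)%:E =
    \int[lambda]_(b in `]0%R, t]) \int[lambda]_(a in `]0%R, t]) (M p q b a)%:E)%E.
  apply: (@tonelli_plane _ `]0, t]%classic `]0, t]%classic (fun z : R * R => (M p q z.2 z.1)%:E)) => //.
  by move=> z; rewrite lee_fin.
have mSp : measurable_fun [set: R * R] (fun z : R * R => (S p q z.1 z.2)%:E).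
  by apply: measurable_EFin_on; exact: measurable_S.
apply: (@le_lt_trans _ _ (\int[lambda]_(a in `]0%R, t])
   (\int[lambda]_(b in `]0%R, t]) (M p q a b)%:E +
    \int[lambda]_(b in `]0%R, t]) (M p q b a)%:E))%E).
  apply: ge0_le_integral => //.
  - by move=> a _; apply: integral_ge0 => b _; rewrite lee_fin S_ge0.
  - apply: measurable_funTS.
    exact: (@measurable_int_line _ _ _ `]0, t]%classic (fun z : R * R => (S p q z.1 z.2)%:E)).
  - apply: measurable_funTS; apply: emeasurable_funD.
    + exact: (@measurable_int_line _ _ _ `]0, t]%classic (fun z : R * R => (M p q z.1 z.2)%:E)).
    + exact: (@measurable_int_line _ _ _ `]0, t]%classic (fun z : R * R => (M p q z.2 z.1)%:E)).
  move=> a; rewrite /= in_itv/= => /andP[a0 at_].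
  have m1 : measurable_fun [set: R] (fun b : R => M p q a b) by exact: (measurable_at (F := M p q)).
  have m2 : measurable_fun [set: R] (fun b : R => M p q b a).
    exact: (measurable_at (F := fun a b => M p q b a) a (proj1 (measurable_EFinP _ _) mMp')).
  have m3 : measurable_fun [set: R] (fun b : R => S p q a b) by exact: (measurable_at (F := S p q)).
  rewrite -ge0_integralD //; [|by move=> b _; rewrite lee_fin|exact: measurable_EFin_on|
    by move=> b _; rewrite lee_fin|exact: measurable_EFin_on].
  apply: ge0_le_integral => //.
  - by move=> b _; rewrite lee_fin S_ge0.
  - exact: measurable_EFin_on.
  - by apply: emeasurable_funD; exact: measurable_EFin_on.
  move=> b; rewrite /= in_itv/= => /andP[b0 bt]; rewrite -EFinD lee_fin.
  have pi1 : 1 <= 4 * pi :> R by have := pi_ge2 R; move: pi => x hx; lra.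
  have key (x y : R) : 0 < x -> 0 < y -> y <= x -> S p q x y <= M p q x y.
    move=> x0 y0 yx; rewrite /M yx mul1r ler_wpM2r ?powR_ge0//.
    apply: powR_anti => //.
    by apply: (@le_trans _ _ (1 * (x + y))); [lra|rewrite ler_wpM2r//; lra].
  rewrite -/(S p q a b); have [ba|/ltW ab] := leP b a.
    by rewrite (le_trans (key a b a0 b0 ba))// lerDl.
  have -> : S p q a b = S p q b a by rewrite /S addrC distrC.
  by rewrite (le_trans (key b a b0 a0 ab))// lerDr.
rewrite ge0_integralD; [exact: lte_add_pinfty I I'|by []| | | |].
- by move=> a _; apply: integral_ge0 => b _; rewrite lee_fin.
- apply: measurable_funTS.
  exact: (@measurable_int_line _ _ _ `]0, t]%classic (fun z : R * R => (M p q z.1 z.2)%:E)).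
- by move=> a _; apply: integral_ge0 => b _; rewrite lee_fin.
- apply: measurable_funTS.
  exact: (@measurable_int_line _ _ _ `]0, t]%classic (fun z : R * R => (M p q z.2 z.1)%:E)).
Qed.

(** At and beyond the threshold the part b <= a / 2 of the square already gives a
    divergent integral: there 4 pi (a + b) <= 8 pi a and |a - b| <= a. *)
Lemma overlap_infty (p q t : R) : 0 <= p -> q < 0 -> q + 2 <= p -> 0 < t ->
  (\int[lambda]_(a in `]0%R, t]) \int[lambda]_(b in `]0%R, t])
    ((4 * pi * (a + b)) `^ (- p) * `|a - b| `^ q)%:E = +oo)%E.
Proof.
move=> p0 q0 pq t0; pose c : R := (8 * pi) `^ (- p) / 2.
have c0 : 0 < c by rewrite divr_gt0// powR_gt0// mulr_gt0// pi_gt0.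
have mSp : measurable_fun [set: R * R] (fun z : R * R => (S p q z.1 z.2)%:E).
  by apply: measurable_EFin_on; exact: measurable_S.
apply/eqP; rewrite -leye_eq.
apply: (@le_trans _ _ (\int[lambda]_(a in `]0%R, t]) (c%:E * (a `^ (q + 1 - p))%:E))%E).
  rewrite ge0_integralZl //; last 3 first.
  - by apply: measurable_EFin_on; exact: measurable_powR.
  - by move=> x _; rewrite lee_fin powR_ge0.
  - by rewrite lee_fin ltW.
  rewrite integral0_powR_infty//; last by lra.
  by rewrite gt0_muley// lte_fin.
apply: ge0_le_integral => //.
- by move=> a _; rewrite -EFinM lee_fin mulr_ge0 ?powR_ge0// ltW.
- apply: measurable_funTS; apply: emeasurable_funM => //.
  by apply: measurable_EFin_on; exact: measurable_powR.
- apply: measurable_funTS.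
  exact: (@measurable_int_line _ _ _ `]0, t]%classic (fun z : R * R => (S p q z.1 z.2)%:E)).
move=> a; rewrite /= in_itv/= => /andP[a0 at_].
have mS : measurable_fun [set: R] (fun b : R => S p q a b) by exact: (measurable_at (F := S p q)).
apply: (@le_trans _ _ (\int[lambda]_(b in `]0%R, (a / 2)%R]) ((8 * pi * a) `^ (- p) * a `^ q)%:E)%E).
  rewrite integral_cst//= lebesgue_measure_itv/= lte_fin divr_gt0// sube0 -!EFinM lee_fin.
  have e0 : 0 <= 8 * pi :> R by rewrite mulr_ge0 ?pi_ge0.
  rewrite /c [(8 * pi * a) `^ _]powRM ?(ltW a0)//.
  have -> : q + 1 - p = - p + q + 1 by ring.
  rewrite powRD; last by apply/implyP => _; rewrite gt_eqF.
  rewrite powRD; last by apply/implyP => _; rewrite gt_eqF.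
  by rewrite powRr1 ?(ltW a0)// le_eqVlt; apply/orP; left; apply/eqP; ring.
apply: (@le_trans _ _ (\int[lambda]_(b in `]0%R, (a / 2)%R]) (S p q a b)%:E)%E).
  apply: ge0_le_integral => //.
  - by move=> b _; rewrite lee_fin mulr_ge0 ?powR_ge0.
  - exact: measurable_EFin_on.
  move=> b; rewrite /= in_itv/= => /andP[b0 b2]; rewrite lee_fin ler_pM ?powR_ge0//.
  - apply: powR_anti => //; first by rewrite !mulr_gt0 ?pi_gt0// addr_gt0.
    have := pi_gt0 R; move: pi => x x0.
    have -> : 8 * x * a = 4 * x * (a + a) by ring.
    by rewrite ler_wpM2l ?mulr_ge0 ?(ltW x0)//; lra.
  - rewrite -[q]opprK; apply: powR_anti; first by lra.
    + by rewrite normr_gt0; apply/eqP; lra.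
    + by rewrite ger0_norm; lra.
apply: ge0_subset_integral => //.
- exact: measurable_EFin_on.
- by move=> b _; rewrite lee_fin S_ge0.
- by move=> b /=; rewrite !in_itv/= => /andP[-> h]/=; lra.
Qed.

End heat_time.

(** * The norm of the heat kernel *)

Section heat_norm.
Context {R : realType} (d : nat).
Local Notation lambda := (@lebesgue_measure R).
Local Notation mu := (@lebesgue_rV R d).

Lemma measurable_fun_heat d' (X : measurableType d') (g : X -> R) (z : X -> 'rV[R]_d) :
  measurable_fun [set: X] g -> measurable_fun [set: X] z ->
  measurable_fun [set: X] (fun q => heat (g q) (z q)).
Proof.
move=> mg mz; have h := measurable_fun_pair mg mz.
exact: (measurableT_comp (@measurable_heat R d) h).
Qed.

Lemma measurable_subr_rV (x : 'rV[R]_d) :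
  measurable_fun [set: 'rV[R]_d] (fun y : 'rV[R]_d => x - y).
Proof.
apply: measurable_fun_rV => i.
rewrite (_ : (fun p => _) = fun p : 'rV[R]_d => x ord0 i - p ord0 i); last first.
  by apply/funext => p; rewrite !mxE.
by apply: measurable_funB => //; exact: measurable_coord.
Qed.

(** In the reversed times a = t - u and b = t - v the space integral of the
    product of the two heat kernels depends only on a + b. *)
Lemma kernel_form_heat (T H t : R) (x : 'rV[R]_d) : 0 <= t <= T ->
  (kernel_form T H (heat_tx t x) =
   \int[lambda]_(a in `]0%R, t]) \int[lambda]_(b in `]0%R, t])
     ((4 * pi * (a + b)) `^ (- (d%:R / 2)) * `|a - b| `^ (2 * H - 2))%:E)%E.
Proof.
move=> t0T.
pose f (a b : R) (y : 'rV[R]_d) : R :=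
  heat a (x - y) * heat b (x - y) * `|a - b| `^ (2 * H - 2).
have f0 a b y : 0 <= f a b y by rewrite !mulr_ge0 ?powR_ge0 ?heat_ge0.
have mf : measurable_fun [set: (R * R) * 'rV[R]_d] (fun q => (f q.1.1 q.1.2 q.2)%:E).
  have mh (g : (R * R) * 'rV[R]_d -> R) : measurable_fun [set: (R * R) * 'rV[R]_d] g ->
      measurable_fun [set: (R * R) * 'rV[R]_d] (fun q => heat (g q) (x - q.2)).
    move=> mg; apply: measurable_fun_heat => //.
    exact: (measurableT_comp (measurable_subr_rV x) measurable_snd).
  have m11 : measurable_fun [set: (R * R) * 'rV[R]_d] (fun q : (R * R) * 'rV[R]_d => q.1.1).
    exact: measurableT_comp.
  have m12 : measurable_fun [set: (R * R) * 'rV[R]_d] (fun q : (R * R) * 'rV[R]_d => q.1.2).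
    exact: measurableT_comp.
  apply: measurable_EFin_on; apply: measurable_funM.
    by apply: measurable_funM; exact: mh.
  by apply: measurable_fun_powR; apply: measurableT_comp => //; exact: measurable_funB.
pose Psi a b := (\int[mu]_y (f a b y)%:E)%E.
have mPsi : measurable_fun [set: R * R] (fun p : R * R => Psi p.1 p.2).
  exact: (@measurable_int_rV _ _ _ _ (fun q : (R * R) * 'rV[R]_d => (f q.1.1 q.1.2 q.2)%:E)).
have mPsia a : measurable_fun [set: R] (Psi a).
  exact: (measurableT_comp mPsi (pair1_measurable a)).
have Psi0 a b : (0 <= Psi a b)%E by apply: integral_ge0 => y _; rewrite lee_fin.
have Psi1 a b : a <= 0 -> Psi a b = 0%E.
  by move=> a0; apply: integral0_eq => y _; rewrite /f heat_le0// !mul0r.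
have Psi2 a b : b <= 0 -> Psi a b = 0%E.
  by move=> a0; apply: integral0_eq => y _; rewrite /f (heat_le0 _ a0) mulr0 mul0r.
have PsiE a b : 0 < a -> 0 < b ->
    Psi a b = ((4 * pi * (a + b)) `^ (- (d%:R / 2)) * `|a - b| `^ (2 * H - 2))%:E.
  move=> a0 b0; rewrite /Psi /f; under eq_integral do rewrite EFinM.
  rewrite ge0_integralZr ?lee_fin ?powR_ge0//.
  - by rewrite integral_heat_heat// EFinM.
  - apply: measurable_EFin_on; apply: measurable_funM;
      apply: measurable_fun_heat => //; exact: measurable_subr_rV.
  - by move=> y _; rewrite lee_fin mulr_ge0 ?heat_ge0.
pose psi a := (\int[lambda]_(b in `]0%R, t]) Psi a b)%E.
transitivity (\int[lambda]_(u in `[0%R, T]) psi (t - u)%R)%E.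
  apply: eq_integral => u _.
  transitivity (\int[lambda]_(v in `[0%R, T]) Psi (t - u)%R (t - v)%R)%E; last first.
    exact: (integral_time_reverse t0T (mPsia (t - u)) (Psi0 (t - u)) (fun b => @Psi2 _ b)).
  apply: eq_integral => v _; apply: eq_integral => y _.
  have -> : `|u - v| = `|(t - u) - (t - v)|.
    by rewrite distrC; congr `|_|; ring.
  by rewrite /f /heat_tx /= (ger0_norm (heat_ge0 _ _)) (ger0_norm (heat_ge0 _ _)).
transitivity (\int[lambda]_(a in `]0%R, t]) psi a)%E.
  apply: integral_time_reverse => //.
  - exact: (@measurable_int_line _ _ _ `]0, t]%classic (fun p : R * R => Psi p.1 p.2)).
  - by move=> a; exact: integral_ge0.
  - by move=> a a0; apply: integral0_eq => b _; exact: Psi1.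
apply: eq_integral => a; rewrite inE/= in_itv/= => /andP[a0 _].
apply: eq_integral => b; rewrite inE/= in_itv/= => /andP[b0 _].
exact: PsiE.
Qed.

(** The heat kernel has mass at most 1 at each time, so its integral over
    [0, T] x R^d is at most T. *)
Lemma heat_tx_integrable (T t : R) (x : 'rV[R]_d) :
  {ae mu, forall y, lambda.-integrable (`[0, T] : set R)
     (fun u => (heat_tx t x (u, y))%:E)}.
Proof.
pose g y := (\int[lambda]_(u in `[0%R, T]) (heat_tx t x (u, y))%:E)%E.
have g0 y : (0 <= g y)%E by apply: integral_ge0 => u _; rewrite lee_fin heat_ge0.
have mh := measurable_heat_tx t x.
have mhE : measurable_fun [set: R * 'rV[R]_d] (fun p => (heat_tx t x p)%:E).
  exact: measurable_EFin_on.
have mg : measurable_fun [set: 'rV[R]_d] g.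
  apply: (@measurable_int_line _ _ _ `[0, T]%classic
    (fun q : 'rV[R]_d * R => (heat_tx t x (q.2, q.1))%:E)) => //.
  exact: (measurableT_comp mhE (@measurable_swap _ _ _ _)).
have gE : (\int[mu]_y g y = \int[lambda]_(u in `[0%R, T]) \int[mu]_y (heat_tx t x (u, y))%:E)%E.
  symmetry; apply: (@tonelli_line_rV R d `[0, T]%classic (fun p => (heat_tx t x p)%:E)) => //.
  by move=> p; rewrite lee_fin heat_ge0.
have ig : mu.-integrable setT g.
  apply/integrableP; split => //.
  under eq_integral do rewrite gee0_abs//.
  rewrite gE; apply: (@le_lt_trans _ _ (\int[lambda]_(u in `[0%R, T]) 1)%E).
    apply: ge0_le_integral => //.
    - by move=> u _; apply: integral_ge0 => y _; rewrite lee_fin heat_ge0.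
    - apply: measurable_funTS.
      exact: (@measurable_int_rV _ _ _ _ (fun q : R * 'rV[R]_d => (heat_tx t x q)%:E)).
    - move=> u _; rewrite /heat_tx/=; have [tu|tu] := ltP 0 (t - u).
        by rewrite integral_heat.
      rewrite integral0_eq ?lee_fin// => y _.
      by rewrite heat_le0.
  by rewrite integral_cst//= mul1e lebesgue_measure_itv/=; case: ifP => _; rewrite ltry.
have := integrable_ae measurableT ig; apply: filterS => y /(_ I) gy.
apply/integrableP; split.
  by apply: measurable_EFin_on; exact: measurable_slice.
under eq_integral do rewrite gee0_abs ?lee_fin ?heat_ge0//.
by move: gy; rewrite ge0_fin_numE.
Qed.

Lemma calH_const_gt0 (H : R) : 2^-1 < H < 1 -> 0 < alphaH H * cH H.
Proof.
move=> /andP[H2 H1]; have G1 : 0 < Gamma (H - 2^-1) by apply: Gamma_gt0; lra.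
have G2 : 0 < Gamma (1 - H) by apply: Gamma_gt0; lra.
rewrite /alphaH /cH; apply: mulr_gt0; first by apply: mulr_gt0; lra.
apply: mulr_gt0; last exact: divr_gt0.
by rewrite invr_gt0; apply: mulr_gt0; apply: powR_gt0 => //; exact: pi_gt0.
Qed.

Lemma sqrte_lty (y : \bar R) : (0 <= y)%E -> (sqrte y < +oo)%E <-> (y < +oo)%E.
Proof. by case: y => [r| |] //= _; split => _; rewrite ltry. Qed.

Lemma in_abs_calH_heat (T H t : R) (x : 'rV[R]_d) :
  2^-1 < H < 1 -> 0 <= t <= T -> d%:R / 4 < H -> in_abs_calH T H (heat_tx t x).
Proof.
move=> /andP[H2 H1] tT dH; split; first exact: measurable_funTS (measurable_heat_tx t x).
have -> : (\int[lambda]_(u in `[0%R, T]) \int[lambda]_(v in `[0%R, T]) \int[mu]_x0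
     (`|heat_tx t x (u, x0)| * `|heat_tx t x (v, x0)| * `|u - v| `^ (2 * H - 2))%:E)%E =
   kernel_form T H (heat_tx t x) by [].
rewrite kernel_form_heat//; move: tT => /andP[]; rewrite le_eqVlt => /predU1P[<- _|t0 _].
  by rewrite set_itv_ge ?integral_set0// bnd_simp ltxx.
by apply: overlap_lty => //; lra.
Qed.

(** With p = d / 2 and q = 2 H - 2, the condition p < q + 2 reads d / 4 < H.
    The heat kernel is nonnegative, so its norm is exactly a multiple of its
    kernel form; the necessity of the condition shows at t = T. *)
Lemma calH_norm_heat (T H : R) : 0 < T -> 2^-1 < H < 1 ->
  (forall (t : R) (x : 'rV[R]_d), 0 <= t <= T -> (calH_norm T H (heat_tx t x) < +oo)%E)
  <-> d%:R / 4 < H.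
Proof.
move=> T0 HH; have [K K0 HK] := spectral_kernel HH.
have c0 := calH_const_gt0 HH.
have k0 t x : (0 <= kernel_form T H (heat_tx t x : R * 'rV[R]_d -> R))%E.
  apply: integral_ge0 => u _; apply: integral_ge0 => v _; apply: integral_ge0 => y _.
  by rewrite lee_fin mulr_ge0 ?powR_ge0// mulr_ge0.
have nE (t : R) (x : 'rV[R]_d) : calH_norm2 T H (heat_tx t x) =
   ((alphaH H * cH H)%:E * (K%:E * kernel_form T H (heat_tx t x)))%E.
  have [_ <- //] := HK d T _ (measurable_heat_tx t x) (heat_tx_integrable T t x).
  by move=> p; exact: heat_ge0.
have n0 (t : R) (x : 'rV[R]_d) : (0 <= calH_norm2 T H (heat_tx t x))%E.
  by rewrite nE !mule_ge0// lee_fin ltW.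
split=> [h|dH t x tT].
- rewrite ltNge; apply/negP => Hd.
  have TT : 0 <= T <= T by rewrite lexx ltW.
  have /(sqrte_lty (n0 _ _)) := h T 0 TT.
  move: HH => /andP[H2 H1].
  rewrite nE kernel_form_heat// overlap_infty//; [|lra..].
  by rewrite gt0_muley ?lte_fin// gt0_muley ?lte_fin.
- apply/(sqrte_lty (n0 _ _)); rewrite nE.
  have [_ kf] := in_abs_calH_heat x HH tT dH.
  rewrite lte_mul_pinfty ?lee_fin ?(ltW c0)//.
  by rewrite lte_mul_pinfty ?lee_fin ?(ltW K0).
Qed.

End heat_norm.

(** * Explicit smooth functions *)

Section flat_function.
Context {R : realType}.

(** At k = 0 this is the classical flat function exp (- 1 / x) 1_(x > 0); the
    extra inverse powers make the family stable under differentiation. *)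
Definition flat (k : nat) (x : R) : R :=
  if 0 < x then x^-1 ^+ k * expR (- x^-1) else 0.

Lemma flat_ge0 k x : 0 <= flat k x.
Proof.
by rewrite /flat; case: ifP => // x0; rewrite mulr_ge0 ?expR_ge0// exprn_ge0// invr_ge0 ltW.
Qed.

(** Each flat function vanishes at least linearly at 0, because
    exp (1 / x) >= x^-(k+1) / (k + 1)!.  As flat k h / h = flat k.+1 h, this is the
    differentiability of all of them at 0. *)
Lemma flat_le k x : flat k x <= (k.+1)`!%:R * `|x|.
Proof.
rewrite /flat; case: ifPn => [x0|_]; last by rewrite mulr_ge0.
have y0 : 0 <= x^-1 by rewrite invr_ge0 ltW.
rewrite expRN gtr0_norm//.
have f0 : 0 < (k.+1)`!%:R :> R by rewrite ltr0n fact_gt0.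
rewrite ler_pdivrMr ?expR_gt0//.
have h := @expR_ge1Dxn R x^-1 k y0.
apply: (@le_trans _ _ ((k.+1)`!%:R * x * (x^-1 ^+ k.+1 / (k.+1)`!%:R))).
  rewrite exprS le_eqVlt; apply/orP; left; apply/eqP; field.
  by rewrite (gt_eqF f0) (gt_eqF x0).
rewrite ler_wpM2l//; first by rewrite mulr_ge0 ?ltW.
by apply: le_trans h; rewrite lerDr.
Qed.

Lemma is_derive_flat k (x : R) : is_derive x 1 (flat k) (flat k.+2 x - k%:R * flat k.+1 x).
Proof.
have [x0|x0|<-] := ltgtP 0 x.
- pose f := fun y : R => y^-1 ^+ k * expR (- y^-1).
  apply: (@near_eq_is_derive _ _ _ f).
    near=> y; rewrite /f /flat ifT//; near: y.
    exact: lt_nbhsr.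
  have xn : x != 0 by rewrite gt_eqF.
  have dV : is_derive x 1 (fun y : R => y^-1) (- x ^- 2).
    apply: DeriveDef; first by apply: derivableV.
    by rewrite deriveV// derive_id /GRing.scale/= mulr1.
  have dE : is_derive x 1 (fun y : R => expR (- y^-1)) (expR (- x^-1) * x ^- 2).
    have dN : is_derive x 1 (fun y : R => - y^-1) (x ^- 2).
      by apply: is_derive_eq; rewrite opprK.
    exact: (@is_derive1_comp _ expR (fun y : R => - y^-1) x _ _ (is_derive_expR _) dN).
  have dX : is_derive x 1 (fun y : R => y^-1 ^+ k) ((k%:R * x^-1 ^+ k.-1) * - x ^- 2).
    have := @is_deriveX _ _ (fun y : R => y^-1) k x 1 _ dV.
    by rewrite exprfctE.
  have := @is_deriveM _ _ _ _ x 1 _ _ dX dE.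
  rewrite /flat !x0 /GRing.scale/= => h; apply: (is_derive_eq h).
  case: k {f dX h} => [|k] /=; rewrite ?expr0 ?exprVn !exprS ?expr0; field; rewrite ?xn//.
  by rewrite expf_neq0.
- apply: (@near_eq_is_derive _ _ _ (cst 0)).
    near=> y; rewrite /flat ifF//; apply/negbTE; rewrite -leNgt ltW//; near: y.
    exact: lt_nbhsl.
  rewrite /flat ltNge (ltW x0)/= mulr0 subr0; exact: is_derive_cst.
- have key : h^-1 *: (((flat k) \o shift 0) (h *: 1) - flat k 0) @[h --> 0^'] --> (0 : R).
    apply/cvgr0Pnorm_le => e e0.
    have m0 : 0 < (k.+2)`!%:R :> R by rewrite ltr0n fact_gt0.
    near=> h.
    have -> : h^-1 *: (((flat k) \o shift 0) (h *: 1) - flat k 0) = flat k.+1 h.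
      rewrite /flat ltxx subr0 /= /shift addr0 /GRing.scale/= mulr1.
      by case: ifPn => _; rewrite ?mulr0// exprS mulrA.
    rewrite ger0_norm ?flat_ge0//; apply: (le_trans (flat_le _ _)).
    rewrite mulrC -ler_pdivlMr//; near: h.
    apply: dnbhs0_le; exact: divr_gt0.
  rewrite {2 3}/flat ltxx mulr0 subr0; apply: DeriveDef.
    by apply/cvg_ex; exists 0.
  exact: cvg_lim key.
Unshelve. all: by end_near. Qed.

End flat_function.

Section smooth_class.
Context {R : realType} {V : normedModType R}.

(** Affinity enters only through the directional derivatives, which are constant
    in the base point. *)
Definition affine_form (l : V -> R) := (forall p, differentiable l p) /\
  (exists D : V -> R, forall p v, 'D_v l p = D v).

(** A syntactic class of smooth functions: differentiating a member along any
    direction gives another member, so that smoothness needs no estimate on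
    iterated derivatives. *)
Inductive flat_poly : (V -> R) -> Prop :=
| flat_poly_cst c : flat_poly (fun=> c)
| flat_poly_flat k l : affine_form l -> flat_poly (fun p => flat k (l p))
| flat_polyD f g : flat_poly f -> flat_poly g -> flat_poly (fun p => f p + g p)
| flat_polyM f g : flat_poly f -> flat_poly g -> flat_poly (fun p => f p * g p).

Lemma differentiable_flat_poly f : flat_poly f -> forall p, differentiable f p.
Proof.
elim => [c p|k l [dl _] p|{}f g _ IHf _ IHg p|{}f g _ IHf _ IHg p].
- exact: differentiable_cst.
- apply: (differentiable_comp (dl p)); apply/derivable1_diffP.
  by have [] := is_derive_flat k (l p).
- exact: differentiableD.
- exact: differentiableM.
Qed.

Lemma derive_flat_poly f v : flat_poly f -> flat_poly (fun p => 'D_v f p).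
Proof.
move=> pf; elim: pf => [c|k l al|{}f g pf IHf pg IHg|{}f g pf IHf pg IHg].
- rewrite (_ : 'D_v _ = fun=> 0); first exact: flat_poly_cst.
  by apply/funext => p; rewrite derive_cst.
- have [dl [D DE]] := al.
  rewrite (_ : 'D_v _ =
      fun p => (flat k.+2 (l p) + - k%:R * flat k.+1 (l p)) * D v).
    apply: flat_polyM; last exact: flat_poly_cst.
    apply: flat_polyD; first exact: flat_poly_flat.
    by apply: flat_polyM; [exact: flat_poly_cst|exact: flat_poly_flat].
  apply/funext => p; have dF := is_derive_flat k (l p).
  have dk : differentiable (flat k) (l p) by apply/derivable1_diffP; case: dF.
  rewrite deriveE; last exact: differentiable_comp.
  have -> : 'd (fun p0 : V => flat k (l p0)) p v = 'd (flat k) (l p) ('d l p v).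
    by rewrite (@diff_comp _ _ _ _ l (flat k) p (dl p) dk).
  have -> : 'd l p v = D v *: 1 by rewrite -deriveE// DE /GRing.scale/= mulr1.
  rewrite linearZ/= -deriveE// derive_val.
  by rewrite /GRing.scale/= mulNr mulrC.
- rewrite (_ : 'D_v _ = fun p => 'D_v f p + 'D_v g p); first exact: flat_polyD.
  apply/funext => p; rewrite -deriveD//; apply: diff_derivable;
    exact: differentiable_flat_poly.
- rewrite (_ : 'D_v _ = fun p => f p * 'D_v g p + g p * 'D_v f p).
    by apply: flat_polyD; apply: flat_polyM.
  apply/funext => p.
  have := @deriveM _ _ f g p v; rewrite /GRing.scale/= => -> //;
    apply: diff_derivable; exact: differentiable_flat_poly.
Qed.

Lemma smooth_flat_poly f : flat_poly f -> smooth f.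
Proof.
move=> pf vs x; apply: differentiable_flat_poly.
by elim: vs => [//|v vs IH] /=; exact: derive_flat_poly.
Qed.

Lemma flat_poly_prod (I : Type) (s : seq I) (F : I -> V -> R) :
  (forall i, flat_poly (F i)) -> flat_poly (fun p => \prod_(i <- s) F i p).
Proof.
move=> pF; elim: s => [|i s IH].
  rewrite (_ : (fun p => _) = fun=> 1); first exact: flat_poly_cst.
  by apply/funext => p; rewrite big_nil.
rewrite (_ : (fun p => _) = fun p => F i p * \prod_(j <- s) F j p).
  exact: flat_polyM.
by apply/funext => p; rewrite big_cons.
Qed.

End smooth_class.

Section coordinates.
Context {R : realType} (d : nat).
Local Notation V := (R * 'rV[R]_d)%type.

Lemma affine_form_linear (f : {linear V -> R}) (b : R) : continuous f ->
  affine_form (fun p : V => f p + b).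
Proof.
move=> cf; have df p : differentiable f p by exact: linear_differentiable.
split=> [p|]; first exact: (differentiableD (df p) (differentiable_cst b p)).
exists f => p v.
have := @deriveD _ _ _ f (cst b) p v (diff_derivable (df p)) (derivable_cst _ _ _).
rewrite derive_cst addr0 => /= h; apply: (etrans h); rewrite deriveE//.
exact: (congr1 (fun k => k v) (diff_lin p cf)).
Qed.

Lemma affine_form_fst (a b : R) : affine_form (fun p : V => a * p.1 + b).
Proof.
pose g (p : V) := a * p.1.
have lg : linear g.
  by move=> c p q; rewrite /g /= /GRing.scale/=; ring.
pose gM := GRing.isLinear.Build R V R _ g lg.
pose gL : {linear V -> R} := HB.pack g gM.
apply: (@affine_form_linear gL) => p; apply: cvgMr; exact: cvg_fst.
Qed.

Lemma affine_form_coord (a b : R) (i : 'I_d) :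
  affine_form (fun p : V => a * p.2 ord0 i + b).
Proof.
pose g (p : V) := a * p.2 ord0 i.
have lg : linear g.
  by move=> c p q; rewrite /g /= !mxE /GRing.scale/=; ring.
pose gM := GRing.isLinear.Build R V R _ g lg.
pose gL : {linear V -> R} := HB.pack g gM.
apply: (@affine_form_linear gL) => p; apply: cvgMr.
apply: (@cvg_comp _ _ _ snd (fun v : 'rV[R]_d => v ord0 i) _ (nbhs p.2)); first exact: cvg_snd.
exact: coord_continuous.
Qed.

End coordinates.

(** * Test functions approximating open boxes *)

Section bumps.
Context {R : realType}.

(** flat 0 (n (x - a) - 1) * flat 0 (n (b - x) - 1), with the affine arguments in
    normal form.  The shifts by 1 keep the support at distance 1 / n from the ends
    of ]a, b[. *)
Definition bump (n : nat) (a b x : R) : R :=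
  flat 0 (n%:R * x + (- (n%:R * a) - 1)) * flat 0 (- n%:R * x + (n%:R * b - 1)).

Lemma flat0_le1 (x : R) : flat 0 x <= 1.
Proof.
rewrite /flat expr0 mul1r; case: ifPn => // x0.
by rewrite -[leRHS]expR0 ler_expR oppr_le0 invr_ge0 ltW.
Qed.

Lemma bump_ge0 n a b x : 0 <= bump n a b x.
Proof. by rewrite mulr_ge0 ?flat_ge0. Qed.

Lemma bump_le1 n a b x : bump n a b x <= 1.
Proof. by rewrite -[leRHS]mulr1 ler_pM ?flat_ge0 ?flat0_le1. Qed.

Lemma bump_neq0 n a b x : bump n a b x != 0 ->
  1 < n%:R * (x - a) /\ 1 < n%:R * (b - x).
Proof.
rewrite /bump mulf_eq0 negb_or => /andP[]; rewrite /flat.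
case: ifPn => [h1 _|_]; last by rewrite eqxx.
case: ifPn => [h2 _|_]; last by rewrite eqxx.
by split; lra.
Qed.

Lemma flat0_cvg1 (c e : R) : 0 < c -> flat 0 (n%:R * c + e) @[n --> \oo] --> (1 : R).
Proof.
move=> c0; apply/cvgrPdist_le => r r0.
near=> n.
have hn : (r^-1 + `|e|) / c <= n%:R by near: n; exact: nbhs_infty_ger.
have hy : r^-1 <= n%:R * c + e.
  by move: hn; rewrite ler_pdivrMr// => h; have := ler_norm (- e); rewrite normrN; lra.
have r1 : 0 < r^-1 by rewrite invr_gt0.
have y0 : 0 < n%:R * c + e by exact: lt_le_trans hy.
rewrite ger0_norm ?subr_ge0 ?flat0_le1// /flat y0 expr0 mul1r.
have := expR_ge1Dx (- (n%:R * c + e)^-1).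
have : (n%:R * c + e)^-1 <= r by rewrite -[leRHS]invrK lef_pV2 ?posrE.
by lra.
Unshelve. all: by end_near. Qed.

Lemma bump_cvg a b x :
  bump n a b x @[n --> \oo] --> ((a < x < b)%R%:R : R).
Proof.
have [|h] := boolP (a < x < b); last first.
  rewrite (_ : (fun n => _) = fun=> 0); first exact: cvg_cst.
  apply/funext => n; apply/eqP; apply: contraNT h => /bump_neq0[h1 h2].
  have n0 : 0 <= n%:R :> R by [].
  by apply/andP; split; rewrite ltNge; apply/negP => h; nra.
move=> /andP[ax xb]; rewrite -[X in _ --> X]mulr1; apply: cvgM.
- rewrite (_ : (fun n => _) = fun n => flat 0 (n%:R * (x - a) + (-1))).
    by apply: flat0_cvg1; rewrite subr_gt0.
  by apply/funext => n; congr flat; ring.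
- rewrite (_ : (fun n => _) = fun n => flat 0 (n%:R * (b - x) + (-1))).
    by apply: flat0_cvg1; rewrite subr_gt0.
  by apply/funext => n; congr flat; ring.
Qed.

End bumps.

Section box_functions.
Context {R : realType} (d : nat).
Local Notation V := (R * 'rV[R]_d)%type.

Definition open_box (a b : R) (lo hi : 'I_d -> R) : set V :=
  [set p : V | a < p.1 < b /\ forall i, lo i < p.2 ord0 i < hi i].

Definition box_bump n (a b : R) (lo hi : 'I_d -> R) (p : V) : R :=
  bump n a b p.1 * \prod_(i < d) bump n (lo i) (hi i) (p.2 ord0 i).

Lemma box_bump_ge0 n a b lo hi p : 0 <= box_bump n a b lo hi p.
Proof. by rewrite mulr_ge0 ?bump_ge0// prodr_ge0// => i _; exact: bump_ge0. Qed.

Lemma prod_in01 (s : seq 'I_d) (F : 'I_d -> R) : (forall i, 0 <= F i <= 1) ->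
  0 <= \prod_(i <- s) F i <= 1.
Proof.
move=> F01; elim: s => [|i s /andP[h0 h1]]; first by rewrite big_nil ler01 lexx.
have /andP[f0 f1] := F01 i.
by rewrite big_cons mulr_ge0//= -[leRHS]mulr1 ler_pM.
Qed.

Lemma box_bump_neq0 n a b lo hi p : box_bump n a b lo hi p != 0 ->
  bump n a b p.1 != 0 /\ forall i, bump n (lo i) (hi i) (p.2 ord0 i) != 0.
Proof.
rewrite mulf_eq0 negb_or => /andP[-> /prodf_neq0 h]; split => // i; exact: h.
Qed.

Lemma bump_neq0_itv n (a b x : R) : bump n a b x != 0 -> a < x < b.
Proof.
move=> /bump_neq0[h1 h2]; have n0 : 0 <= n%:R :> R by [].
by apply/andP; split; rewrite ltNge; apply/negP => h; nra.
Qed.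

Lemma box_bump_le n a b lo hi p :
  box_bump n a b lo hi p <= \1_(open_box a b lo hi) p.
Proof.
rewrite indicE; have [pB|pB] := boolP (p \in _).
  have /andP[h0 h1] := @prod_in01 (index_enum _) (fun i => bump n (lo i) (hi i) (p.2 ord0 i))
    (fun i => (introT andP (conj (bump_ge0 _ _ _ _) (bump_le1 _ _ _ _)))).
  by rewrite -[leRHS]mulr1 ler_pM ?bump_ge0 ?bump_le1.
rewrite le_eqVlt; apply/orP; left; apply: contraNT pB => /box_bump_neq0[h1 h2].
by rewrite inE; split => [|i]; [exact: bump_neq0_itv h1|exact: bump_neq0_itv (h2 i)].
Qed.

Lemma cvg_prod_seq (s : seq 'I_d) (F : nat -> 'I_d -> R) (l : 'I_d -> R) :
  (forall i, F n i @[n --> \oo] --> l i) ->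
  (\prod_(i <- s) F n i) @[n --> \oo] --> \prod_(i <- s) l i.
Proof.
move=> Fl; elim: s => [|i s IH].
  rewrite (_ : (fun n => _) = fun=> 1); first by rewrite big_nil; exact: cvg_cst.
  by apply/funext => n; rewrite big_nil.
rewrite (_ : (fun n => _) = fun n => F n i * \prod_(j <- s) F n j).
  by rewrite big_cons; apply: cvgM.
by apply/funext => n; rewrite big_cons.
Qed.

Lemma box_bump_cvg a b lo hi p :
  box_bump n a b lo hi p @[n --> \oo] --> (\1_(open_box a b lo hi) p : R).
Proof.
have -> : \1_(open_box a b lo hi) p = (a < p.1 < b)%R%:R *
    \prod_(i < d) ((lo i < p.2 ord0 i < hi i)%R%:R : R) :> R.
  rewrite indicE; have [|pB] := boolP (p \in _).
    by rewrite inE => -[/= -> h]; rewrite big1 ?mulr1// => i _; rewrite h.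
  apply/eqP; rewrite eq_sym; apply: contraNT pB.
  rewrite mulf_eq0 negb_or => /andP[h1 /prodf_neq0 h2]; rewrite inE; split.
    by move: h1; case: (a < p.1 < b) => //; rewrite eqxx.
  by move=> i; have := h2 i isT; case: (lo i < _ < hi i) => //; rewrite eqxx.
apply: cvgM; first exact: bump_cvg.
by apply: (@cvg_prod_seq _ (fun n i => bump n (lo i) (hi i) (p.2 ord0 i))) => i; exact: bump_cvg.
Qed.

Lemma flat_poly_box n a b lo hi : flat_poly (box_bump n a b lo hi).
Proof.
apply: flat_polyM; first apply: flat_polyM.
- by apply: flat_poly_flat; exact: affine_form_fst.
- by apply: flat_poly_flat; exact: affine_form_fst.
apply: flat_poly_prod => i; apply: flat_polyM.
- by apply: flat_poly_flat; exact: affine_form_coord.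
- by apply: flat_poly_flat; exact: affine_form_coord.
Qed.

(** With a compact set carrying g in place of the closure of its support, the
    class is visibly stable under linear combinations. *)
Definition flat_test (T : R) (g : V -> R) : Prop :=
  flat_poly g /\ exists K : set V,
    [/\ compact K, K `<=` spacetime T & forall p, g p != 0 -> K p].

Lemma flat_test_test_function T g : flat_test T g -> test_function (spacetime T) g.
Proof.
move=> [pg [K [cK KT gK]]].
have clK : closure [set x | g x != 0] `<=` K.
  have cl : closed K by apply: compact_closed => //; exact: norm_hausdorff.
  by rewrite [X in _ `<=` X](closure_id K).1//; apply: closure_subset => p; exact: gK.
split; first exact: smooth_flat_poly.
  by apply: (subclosed_compact _ cK clK); exact: closed_closure.
exact: subset_trans KT.
Qed.

(** The time support [a + 1/n, b - 1/n] stays inside ]0, T[ even for a = 0 and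
    b = T: the boxes may touch the boundary of spacetime.  The margin used is
    1 / (n + 1), which makes sense at n = 0 too. *)
Lemma flat_test_box T n a b lo hi : 0 <= a -> b <= T ->
  flat_test T (box_bump n a b lo hi).
Proof.
move=> a0 bT; split; first exact: flat_poly_box.
exists (`[a + n.+1%:R^-1, b - n.+1%:R^-1]%classic `*`
   [set v : 'rV[R]_d | forall i, `[lo i, hi i]%classic (v ord0 i)]); split.
- apply: compact_setX; first exact: segment_compact.
  apply: (@rV_compact R d (fun i => `[lo i, hi i]%classic)) => i; exact: segment_compact.
- have n0 : 0 < n.+1%:R^-1 :> R by rewrite invr_gt0.
  move=> p [/= h _]; split => //=; move: h; rewrite !in_itv/= => /andP[h1 h2].
  by move: n0 h1 h2; move: (n.+1%:R^-1) => w n0 h1 h2; apply/andP; split; lra.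
- move=> p /box_bump_neq0[/bump_neq0[h1 h2] h]; split; last first.
    by move=> i; have /andP[/ltW h3 /ltW h4] := bump_neq0_itv (h i); rewrite /= in_itv/= h3.
  have n0 : 0 <= n%:R :> R by [].
  have n1 : 0 < n.+1%:R :> R by [].
  have s1 : n.+1%:R * n.+1%:R^-1 = 1 :> R by rewrite mulfV// gt_eqF.
  have s2 : n.+1%:R = n%:R + 1 :> R by rewrite natr1.
  move: n1 s1; rewrite s2; set m := (n%:R : R) in h1 h2 n0 *; set w := (m + 1)^-1 => n1 s1.
  by rewrite /= in_itv/=; apply/andP; split; nra.
Qed.

Lemma flat_test0 T : flat_test T (fun=> 0).
Proof.
split; first exact: flat_poly_cst.
by exists set0; split => //; [exact: compact0|move=> p; rewrite eqxx].
Qed.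

Lemma flat_testD T g1 g2 : flat_test T g1 -> flat_test T g2 ->
  flat_test T (fun p => g1 p + g2 p).
Proof.
move=> [pg1 [K1 [cK1 KT1 gK1]]] [pg2 [K2 [cK2 KT2 gK2]]].
split; first exact: flat_polyD.
exists (K1 `|` K2); split; first exact: compactU.
  by rewrite subUset.
move=> p; have [->|h] := eqVneq (g1 p) 0; last by left; exact: gK1.
by rewrite add0r => h; right; exact: gK2.
Qed.

Lemma flat_testZ T c g : flat_test T g -> flat_test T (fun p => c * g p).
Proof.
move=> [pg [K [cK KT gK]]]; split.
  by apply: flat_polyM => //; exact: flat_poly_cst.
exists K; split => // p; rewrite mulf_eq0 negb_or => /andP[_]; exact: gK.
Qed.

End box_functions.

(** * The square norm on spacetime *)

Section square_norm.
Context {R : realType} (d : nat) (T : R).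
Local Notation lambda := (@lebesgue_measure R).
Local Notation mu := (@lebesgue_rV R d).
Local Notation V := (R * 'rV[R]_d)%type.
Local Notation D := (@spacetime R d T).

Definition sqnorm2 (f : V -> R) : \bar R :=
  (\int[(lambda \x mu)]_(p in D) (f p ^+ 2)%:E)%E.

Lemma measurable_spacetime : measurable D.
Proof. exact: (@measurableX _ _ (measurableTypeR R) 'rV[R]_d). Qed.

Lemma sqnorm2_ge0 (f : V -> R) : (0 <= sqnorm2 f)%E.
Proof. by apply: integral_ge0 => p _; rewrite lee_fin sqr_ge0. Qed.

Lemma measurable_sqr (f : V -> R) : measurable_fun [set: V] f ->
  measurable_fun [set: V] (fun p => (f p ^+ 2)%:E).
Proof. by move=> mf; apply: measurable_EFin_on; exact: measurable_funX. Qed.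

Lemma sqnorm2E (f : V -> R) : measurable_fun [set: V] f ->
  (sqnorm2 f = \int[lambda]_(u in `[0%R, T]) \int[mu]_x (f (u, x) ^+ 2)%:E)%E.
Proof.
move=> mf; have mf2 := measurable_sqr mf.
rewrite /sqnorm2 integral_mkcond.
have mg : measurable_fun [set: measurableTypeR R * 'rV[R]_d] ((fun p => (f p ^+ 2)%:E) \_ D).
  by apply: measurable_patch; [exact: measurable_spacetime|exact: mf2].
rewrite (fubini_tonelli1 (m1 := lambda) (m2 := mu) _ mg); last first.
  by move=> p; rewrite patchE; case: ifP => // _; rewrite lee_fin sqr_ge0.
transitivity (\int[lambda]_(u in `]0%R, T[) \int[mu]_x (f (u, x) ^+ 2)%:E)%E.
  rewrite [RHS]integral_mkcond; apply: eq_integral => u _; rewrite [RHS]patchE.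
  case: ifPn => uT.
    by apply: eq_integral => x _; rewrite patchE ifT// in_setX uT in_setT.
  by apply: integral0_eq => x _; rewrite patchE ifF// in_setX (negbTE uT).
symmetry; apply: integral_itv_bndoo.
apply: measurable_funTS.
exact: (@measurable_int_rV _ _ _ _ (fun p : V => (f p ^+ 2)%:E)).
Qed.

Lemma sqnorm2D (f g : V -> R) : measurable_fun [set: V] f -> measurable_fun [set: V] g ->
  (sqnorm2 (fun p => f p + g p)%R <= 2%:E * sqnorm2 f + 2%:E * sqnorm2 g)%E.
Proof.
move=> mf mg; have mD := measurable_spacetime.
have mf2 : measurable_fun D (fun p => (f p ^+ 2)%:E) by apply: measurable_funTS; exact: measurable_sqr.
have mg2 : measurable_fun D (fun p => (g p ^+ 2)%:E) by apply: measurable_funTS; exact: measurable_sqr.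
rewrite /sqnorm2 -ge0_integralZl//; last by move=> p _; rewrite lee_fin sqr_ge0.
rewrite -[X in (_ <= _ + X)%E]ge0_integralZl//; last by move=> p _; rewrite lee_fin sqr_ge0.
rewrite -ge0_integralD//; first last.
- exact: emeasurable_funM.
- by move=> p _; rewrite -EFinM lee_fin mulr_ge0 ?sqr_ge0.
- exact: emeasurable_funM.
- by move=> p _; rewrite -EFinM lee_fin mulr_ge0 ?sqr_ge0.
apply: ge0_le_integral => //.
- by move=> p _; rewrite lee_fin sqr_ge0.
- by apply: measurable_funTS; apply: measurable_sqr; exact: measurable_funD.
- by apply: emeasurable_funD; exact: emeasurable_funM.
- move=> p _; rewrite -!EFinM -EFinD lee_fin.
  have := sqr_ge0 (f p - g p); nra.
Qed.

Lemma sqnorm2Z (c : R) (f : V -> R) : measurable_fun [set: V] f ->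
  (sqnorm2 (fun p => c * f p)%R = (c ^+ 2)%:E * sqnorm2 f)%E.
Proof.
move=> mf; have mD := measurable_spacetime.
rewrite /sqnorm2 -ge0_integralZl//; last 3 first.
- by apply: measurable_funTS; exact: measurable_sqr.
- by move=> p _; rewrite lee_fin sqr_ge0.
- by rewrite lee_fin sqr_ge0.
by apply: eq_integral => p _; rewrite exprMn EFinM.
Qed.

Lemma le_sqnorm2 (f g : V -> R) : measurable_fun [set: V] f -> measurable_fun [set: V] g ->
  (forall p, `|f p| <= `|g p|) -> (sqnorm2 f <= sqnorm2 g)%E.
Proof.
move=> mf mg fg; have mD := measurable_spacetime.
apply: ge0_le_integral => //.
- by move=> p _; rewrite lee_fin sqr_ge0.
- by apply: measurable_funTS; exact: measurable_sqr.
- by apply: measurable_funTS; exact: measurable_sqr.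
- by move=> p _; rewrite lee_fin -[f p ^+ 2]real_normK ?num_real// -[g p ^+ 2]real_normK ?num_real// lerXn2r ?nnegrE.
Qed.

(** Dominated convergence for the squared distance, the majorant being h ^ 2. *)
Lemma sqnorm2_dominated_cvg (f_ : nat -> V -> R) (f h : V -> R) :
  (forall n, measurable_fun [set: V] (f_ n)) -> measurable_fun [set: V] f ->
  measurable_fun [set: V] h -> (sqnorm2 h < +oo)%E ->
  (forall p, D p -> f_ n p @[n --> \oo] --> f p) ->
  (forall n p, `|f p - f_ n p| <= `|h p|) ->
  (sqnorm2 (fun p => f p - f_ n p)%R @[n --> \oo] --> 0)%E.
Proof.
move=> mf_ mf mh hoo cf fh; have mD := measurable_spacetime.
have h0 p : (0 <= (h p ^+ 2)%:E)%E by rewrite lee_fin sqr_ge0.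
have := @dominated_cvg _ (measurableTypeR R * 'rV[R]_d)%type R (lambda \x mu)%E D mD
  (fun n p => ((f p - f_ n p) ^+ 2)%:E) (cst 0%E) (fun p => (h p ^+ 2)%:E).
rewrite integral0 => H; apply: H.
- move=> n; apply: measurable_funTS; apply: measurable_sqr; exact: measurable_funB.
- move=> p Dp; apply: cvg_EFin; first exact: nearW.
  rewrite [X in X @ _ --> _](_ : _ = fun n => (f p - f_ n p) * (f p - f_ n p)); last first.
    by apply/funext => n /=; rewrite expr2.
  rewrite [X in _ --> X](_ : _ = (f p - f p) * (f p - f p)); last by rewrite subrr mul0r.
  by apply: cvgM; apply: cvgB; (try exact: cvg_cst); exact: cf.
- by [].
- apply/integrableP; split; first by apply: measurable_funTS; exact: measurable_sqr.
  by under eq_integral do rewrite gee0_abs//.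
- move=> n p _ /=; rewrite lee_fin ger0_norm ?sqr_ge0//.
  by rewrite -real_normK ?num_real// -[h p ^+ 2]real_normK ?num_real// lerXn2r ?nnegrE.
Qed.

Lemma measurable_open_box a b (lo hi : 'I_d -> R) : measurable (open_box a b lo hi).
Proof.
rewrite (_ : open_box a b lo hi = (`]a, b[%classic : set (measurableTypeR R)) `*`
   \big[setI/setT]_(i < d) ((fun v : 'rV[R]_d => v ord0 i) @^-1` `]lo i, hi i[%classic)).
  apply: measurableX => //; apply: bigsetI_measurable => i _.
  by rewrite -[X in measurable X]setTI; apply: measurable_coord.
rewrite -bigcap_seq; apply/seteqP; split => [p [h1 h2]|p [h1 h2]]; split => //=.
- by move=> i _ /=; rewrite in_itv; exact: h2.
- by move=> i; have := h2 i (mem_index_enum _); rewrite /= in_itv.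
Qed.

Lemma sqnorm2_box_lty a b (lo hi : 'I_d -> R) :
  (sqnorm2 (\1_(open_box a b lo hi)) < +oo)%E.
Proof.
have mB : measurable_fun [set: V] (\1_(open_box a b lo hi) : V -> R).
  by apply: measurable_indic; exact: measurable_open_box.
rewrite sqnorm2E//.
pose I i : R := if lo i < hi i then hi i - lo i else 0.
apply: (@le_lt_trans _ _ (\int[lambda]_(u in `[0%R, T]) (\prod_(i < d) I i)%:E)%E); last first.
  by rewrite integral_cst//= lebesgue_measure_itv/=; case: ifP => _; rewrite ?mule0 ltry.
apply: ge0_le_integral => //.
- by move=> u _; apply: integral_ge0 => x _; rewrite lee_fin sqr_ge0.
- apply: measurable_funTS.
  by apply: (@measurable_int_rV _ _ _ _ (fun p : V => (\1_(open_box a b lo hi) p ^+ 2)%:E)); exact: measurable_sqr.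
- move=> u _; rewrite -(@integral_rV_prod _ _ (fun i => \1_(`]lo i, hi i[%classic)) I)//.
  + apply: ge0_le_integral => //.
    * exact: (measurableT_comp (measurable_sqr mB) (pair1_measurable u)).
    * apply: measurable_EFin_on; apply: measurable_prod => i _.
      apply: (@measurableT_comp _ _ _ _ _ _ (\1_(`]lo i, hi i[%classic) : R -> R)) => //.
      exact: measurable_coord.
    * move=> x _; rewrite lee_fin indicE; have [|_] := boolP (_ \in _).
        rewrite inE => -[_ h]; rewrite expr1n big1// => i _.
        by rewrite indicE mem_set//= in_itv; exact: h.
      by rewrite expr0n prodr_ge0.
  + by move=> i; rewrite integral_indic//= setIT lebesgue_measure_itv/= lte_fin /I; case: ifP.
Qed.

End square_norm.

(** * Density of test functions in L^2 *)

Section density.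
Import HBNNSimple.
Context {R : realType} (d : nat) (T : R).
Local Notation V := (R * 'rV[R]_d)%type.
Local Notation D := (@spacetime R d T).

Definition approximable (f : V -> R) : Prop :=
  measurable_fun [set: V] f /\
  forall e : R, 0 < e -> exists2 g, flat_test T g &
    (sqnorm2 T (fun p => f p - g p)%R <= e%:E)%E.

Lemma measurable_flat_test (g : V -> R) : flat_test T g -> measurable_fun [set: V] g.
Proof.
move=> [pg _]; apply: continuous_measurable_fun_rV => p.
exact/differentiable_continuous/differentiable_flat_poly.
Qed.

Lemma sqnorm2_0 : sqnorm2 T (fun _ : V => 0) = 0%E.
Proof. by apply: integral0_eq => p _; rewrite expr0n. Qed.

Lemma approximable_test (g : V -> R) : flat_test T g -> approximable g.
Proof.
move=> tg; split; first exact: measurable_flat_test.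
move=> e e0; exists g => //.
rewrite (_ : (fun p => _) = fun=> 0); first by rewrite sqnorm2_0 lee_fin ltW.
by apply/funext => p; rewrite subrr.
Qed.

(** The factors 4 come from the bound (x + y)^2 <= 2 x^2 + 2 y^2. *)
Lemma approximable_close (f : V -> R) : measurable_fun [set: V] f ->
  (forall e : R, 0 < e -> exists2 g, approximable g &
    (sqnorm2 T (fun p => f p - g p)%R <= e%:E)%E) -> approximable f.
Proof.
move=> mf H; split => // e e0.
have e4 : 0 < e / 4 by rewrite divr_gt0.
have [g [mg Hg] fg] := H _ e4.
have [k tk gk] := Hg _ e4.
have mk := measurable_flat_test tk.
exists k => //.
rewrite (_ : (fun p => _) = fun p => (f p - g p) + (g p - k p)); last first.
  by apply/funext => p; ring.
apply: (le_trans (sqnorm2D T _ _)); [exact: measurable_funB|exact: measurable_funB|].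
apply: (@le_trans _ _ (2%:E * (e / 4)%:E + 2%:E * (e / 4)%:E)%E).
  by apply: leeD; apply: lee_wpmul2l => //.
by rewrite -!EFinM -EFinD lee_fin; lra.
Qed.

Lemma approximableD (f1 f2 : V -> R) : approximable f1 -> approximable f2 ->
  approximable (fun p => f1 p + f2 p).
Proof.
move=> [mf1 H1] [mf2 H2]; split; first exact: measurable_funD.
move=> e e0; have e4 : 0 < e / 4 by rewrite divr_gt0.
have [g1 t1 h1] := H1 _ e4; have [g2 t2 h2] := H2 _ e4.
have m1 := measurable_flat_test t1; have m2 := measurable_flat_test t2.
exists (fun p => g1 p + g2 p); first exact: flat_testD.
rewrite (_ : (fun p => _) = fun p => (f1 p - g1 p) + (f2 p - g2 p)); last first.
  by apply/funext => p; ring.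
apply: (le_trans (sqnorm2D T _ _)); [exact: measurable_funB|exact: measurable_funB|].
apply: (@le_trans _ _ (2%:E * (e / 4)%:E + 2%:E * (e / 4)%:E)%E).
  by apply: leeD; apply: lee_wpmul2l => //.
by rewrite -!EFinM -EFinD lee_fin; lra.
Qed.

Lemma approximableZ (c : R) (f : V -> R) : approximable f -> approximable (fun p => c * f p).
Proof.
move=> [mf H]; split; first exact: measurable_funM.
move=> e e0; have c0 : 0 < c ^+ 2 + 1 by rewrite ltr_wpDl ?sqr_ge0.
have [g tg h] := H (e / (c ^+ 2 + 1)) (divr_gt0 e0 c0).
have mg := measurable_flat_test tg.
exists (fun p => c * g p); first exact: flat_testZ.
rewrite (_ : (fun p => _) = fun p => c * (f p - g p)); last first.
  by apply/funext => p; ring.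
rewrite sqnorm2Z; last exact: measurable_funB.
apply: (@le_trans _ _ ((c ^+ 2)%:E * (e / (c ^+ 2 + 1))%:E)%E).
  by apply: lee_wpmul2l => //; rewrite lee_fin sqr_ge0.
rewrite -EFinM lee_fin mulrA ler_pdivrMr// mulrC ler_wpM2l ?ltW//.
by rewrite ltrDl.
Qed.

Lemma approximableB (f1 f2 : V -> R) : approximable f1 -> approximable f2 ->
  approximable (fun p => f1 p - f2 p).
Proof.
move=> H1 H2; have := approximableD H1 (approximableZ (-1) H2).
by rewrite (_ : (fun p => _) = fun p => f1 p - f2 p)//; apply/funext => p; rewrite mulN1r.
Qed.

Lemma approximable_sum (I : eqType) (s : seq I) (F : I -> V -> R) :
  (forall i, i \in s -> approximable (F i)) -> approximable (fun p => \sum_(i <- s) F i p).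
Proof.
elim: s => [|i s IH] aF.
  rewrite (_ : (fun p => _) = fun=> 0); first by apply: approximable_test; exact: flat_test0.
  by apply/funext => p; rewrite big_nil.
rewrite (_ : (fun p => _) = fun p => F i p + \sum_(j <- s) F j p); last first.
  by apply/funext => p; rewrite big_cons.
apply: approximableD; first by apply: aF; rewrite mem_head.
by apply: IH => j js; apply: aF; rewrite inE js orbT.
Qed.

Lemma approximable_lim (f_ : nat -> V -> R) (f h : V -> R) :
  (forall n, approximable (f_ n)) -> measurable_fun [set: V] f ->
  measurable_fun [set: V] h -> (sqnorm2 T h < +oo)%E ->
  (forall p, D p -> f_ n p @[n --> \oo] --> f p) ->
  (forall n p, `|f p - f_ n p| <= `|h p|) -> approximable f.
Proof.
move=> af mf mh hoo cf fh; apply: approximable_close => // e e0.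
have := @sqnorm2_dominated_cvg R d T f_ f h (fun n => (af n).1) mf mh hoo cf fh.
move=> /fine_cvgP[fin /cvgrPdist_le /(_ _ e0)] near_e.
have [n [finn le_e]] : exists n, sqnorm2 T (fun p => f p - f_ n p)%R \is a fin_num /\
    `|0 - (fine \o (fun n => sqnorm2 T (fun p => f p - f_ n p)%R)) n| <= e.
  by apply: (@filter_ex _ \oo); near=> n; split; near: n.
exists (f_ n) => //; rewrite -(fineK finn) lee_fin.
by move: le_e; rewrite sub0r normrN /= ger0_norm// fine_ge0// sqnorm2_ge0.
Unshelve. all: by end_near. Qed.

Lemma approximable_box (a b : R) (lo hi : 'I_d -> R) : 0 <= a -> b <= T ->
  approximable (\1_(open_box a b lo hi)).
Proof.
move=> a0 bT.
have mB : measurable_fun [set: V] (\1_(open_box a b lo hi) : V -> R).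
  by apply: measurable_indic; exact: measurable_open_box.
apply: (@approximable_lim (fun n => box_bump n a b lo hi) _ (\1_(open_box a b lo hi))) => //.
- by move=> n; apply: approximable_test; exact: flat_test_box.
- exact: sqnorm2_box_lty.
- by move=> p _; exact: box_bump_cvg.
- move=> n p; have h0 := box_bump_ge0 n a b lo hi p; have h1 := box_bump_le n a b lo hi p.
  by rewrite !ger0_norm ?subr_ge0 ?(le_trans h0)// gerBl.
Qed.

(* Indicators are cut down to Box N, which has finite measure and exhausts
   spacetime as N grows. *)
Let Box (N : nat) : set V := open_box 0 T (fun=> - N%:R) (fun=> N%:R).

Let good (N : nat) : set (set V) :=
  [set S | measurable S /\ approximable (\1_(S `&` Box N))].

Let mBox N : measurable (Box N).
Proof. exact: measurable_open_box. Qed.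

Let G : set (set V) := [set S | exists a b lo hi, S = open_box a b lo hi].

Lemma open_boxI (a b a' b' : R) (lo hi lo' hi' : 'I_d -> R) :
  open_box a b lo hi `&` open_box a' b' lo' hi' =
  open_box (Num.max a a') (Num.min b b') (fun i => Num.max (lo i) (lo' i))
    (fun i => Num.min (hi i) (hi' i)).
Proof.
apply/seteqP; split => p /=.
  move=> [[/andP[h1 h2] h3] [/andP[h4 h5] h6]]; split.
    by rewrite gt_max lt_min h1 h2 h4.
  by move=> i; have /andP[? ?] := h3 i; have /andP[? ?] := h6 i; rewrite gt_max lt_min; apply/andP; split; apply/andP.
move=> []; rewrite gt_max lt_min => /andP[/andP[h1 h2] /andP[h3 h4]] h5; split; split.
- by rewrite h1 h3.
- by move=> i; have := h5 i; rewrite gt_max lt_min => /andP[/andP[-> _] /andP[-> _]].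
- by rewrite h2 h4.
- by move=> i; have := h5 i; rewrite gt_max lt_min => /andP[/andP[_ ->] /andP[_ ->]].
Qed.

Let setI_closed_G : setI_closed G.
Proof.
move=> _ _ [a [b [lo [hi ->]]]] [a' [b' [lo' [hi' ->]]]].
by rewrite open_boxI; do 4 eexists; reflexivity.
Qed.

Let coord_bound (p : V) : exists N : nat, forall i, `|p.2 ord0 i| < N%:R.
Proof.
exists (Num.bound (\sum_(i < d) `|p.2 ord0 i|)) => i.
apply: le_lt_trans (archi_boundP _); last exact: sumr_ge0.
by rewrite (bigD1 i)//= lerDl sumr_ge0.
Qed.

Let coord_bound2 (p : V) : exists N : nat,
  `|p.1| < N%:R /\ forall i, `|p.2 ord0 i| < N%:R.
Proof.
have [N hN] := coord_bound p.
exists (maxn N (Num.bound `|p.1|)); split.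
  apply: lt_le_trans (archi_boundP _) _; first exact: normr_ge0.
  by rewrite ler_nat leq_maxr.
by move=> i; apply: lt_le_trans (hN i) _; rewrite ler_nat leq_maxl.
Qed.

(** The coordinates are measurable for the sigma-algebra generated by the open
    boxes, because a half-space is a countable union of boxes. *)
Lemma measurable_sub_boxes (S : set V) : measurable S -> <<s G >> S.
Proof.
move=> mS.
have GS (B : nat -> set V) : (forall n, G (B n)) -> <<s G >> (\bigcup_n B n).
  by move=> GB; apply: sigma_algebra_bigcup => n; exact: sub_gen_smallest.
have m1 : measurable_fun [set: g_sigma_algebraType G] (fun p : g_sigma_algebraType G => (p : V).1).
  apply: (measurability _ (RGenOInfty.measurableE R)) => _ [_ [x ->] <-].
  rewrite setTI (_ : _ @^-1` _ =
    \bigcup_n open_box x n%:R (fun=> - n%:R) (fun=> n%:R)); last first.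
    apply/seteqP; split => [p|p [n _ [/andP[h _] _]]]; last by rewrite /= in_itv/= h.
    rewrite /= in_itv/= andbT => xp; have [N [h1 h2]] := coord_bound2 p.
    exists N => //; split; first by rewrite xp (le_lt_trans (ler_norm _)).
    by move=> i; rewrite -ltr_norml.
  by apply: GS => n; exists x, n%:R, (fun=> - n%:R), (fun=> n%:R).
have m2 i : measurable_fun [set: g_sigma_algebraType G]
    (fun p : g_sigma_algebraType G => (p : V).2 ord0 i).
  apply: (measurability _ (RGenOInfty.measurableE R)) => _ [_ [x ->] <-].
  rewrite setTI (_ : _ @^-1` _ =
    \bigcup_n open_box (- n%:R) n%:R (fun j => if j == i then x else - n%:R) (fun=> n%:R)); last first.
    apply/seteqP; split => [p|p [n _ [_ /(_ i)]]]; last first.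
      by rewrite eqxx => /andP[h _]; rewrite /= in_itv/= h.
    rewrite /= in_itv/= andbT => xp; have [N [h1 h2]] := coord_bound2 p.
    exists N => //; split; first by rewrite -ltr_norml.
    move=> j; case: eqP => [->|_]; last by rewrite -ltr_norml.
    by rewrite xp (le_lt_trans (ler_norm _)).
  by apply: GS => n; exists (- n%:R), n%:R, (fun j => if j == i then x else - n%:R), (fun=> n%:R).
have mid : measurable_fun [set: g_sigma_algebraType G]
    (fun p : g_sigma_algebraType G => ((p : V).1, (p : V).2)).
  by apply: measurable_fun_pair => //; exact: measurable_fun_rV.
have := mid measurableT _ mS; rewrite setTI.
by rewrite (_ : _ @^-1` S = S)//; apply/seteqP; split => -[].
Qed.

Let good_box N : G `<=` good N.
Proof.
move=> _ [a [b [lo [hi ->]]]]; split; first exact: measurable_open_box.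
rewrite /Box open_boxI; apply: approximable_box.
- by rewrite le_max lexx orbT.
- by rewrite ge_min lexx orbT.
Qed.

Let dynkin_good N : dynkin (good N).
Proof.
split.
- split; first exact: measurableT.
  by rewrite setTI; apply: approximable_box.
- move=> S [mS aS]; split; first exact: measurableC.
  rewrite (_ : \1_(~` S `&` Box N) = fun p => \1_(Box N) p - \1_(S `&` Box N) p :> R).
    by apply: approximableB => //; exact: approximable_box.
  apply/funext => p; rewrite !indicE !in_setI in_setC.
  by case: (p \in S); case: (p \in Box N); rewrite /= ?subrr ?subr0.
- move=> F tF gF; split; first by apply: bigcupT_measurable => i; exact: (gF i).1.
  pose U n := \big[setU/set0]_(i < n) F i.
  have mU n : measurable (U n) by apply: bigsetU_measurable => i _; exact: (gF i).1.
  have aU n : approximable (\1_(U n `&` Box N)).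
    elim: n => [|n IH].
      rewrite /U big_ord0 set0I indic0; apply: approximable_test; exact: flat_test0.
    rewrite (_ : \1_(U n.+1 `&` Box N) = fun p => \1_(U n `&` Box N) p + \1_(F n `&` Box N) p :> R).
      by apply: approximableD => //; exact: (gF n).2.
    apply/funext => p; rewrite !indicE !in_setI /U big_ord_recr/= in_setU -/(U n).
    have [pU|pU] := boolP (p \in U n); last by rewrite /= add0r.
    have [pF|pF] := boolP (p \in F n); last by rewrite /= addr0.
    exfalso; move: pU; rewrite inE /U -bigcup_mkord => -[i /= ilt Fi].
    move/trivIsetP : tF => /(_ i n I I); rewrite neq_ltn ilt => /(_ isT) /seteqP[+ _].
    by move=> /(_ p); apply; split => //; move: pF; rewrite inE.
  have mI S : measurable S -> measurable_fun [set: V] (\1_(S `&` Box N) : V -> R).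
    by move=> mS; apply: measurable_indic; exact: measurableI.
  apply: (@approximable_lim (fun n => \1_(U n `&` Box N)) _ (\1_(Box N))) => //.
  + by apply: mI; apply: bigcupT_measurable => i; exact: (gF i).1.
  + exact: sqnorm2_box_lty.
  + move=> p _; have [[i _ Fip]|nF] := pselect ((\bigcup_i F i) p).
      apply: cvg_near_cst; exists i.+1 => // n /= ltin.
      rewrite !indicE !in_setI; congr (_%:R); congr (_ && _).
      by rewrite !mem_set//; [exists i|rewrite /U -bigcup_mkord; exists i].
    rewrite (_ : (fun n => _) = fun=> \1_((\bigcup_i F i) `&` Box N) p); first exact: cvg_cst.
    apply/funext => n; rewrite !indicE !in_setI (memNset nF) (memNset (A := U n))//.
    by rewrite /U -bigcup_mkord => -[i _ Fi]; apply: nF; exists i.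
  + move=> n p; rewrite !indicI /= -mulrBl normrM ler_piMl// !indicE.
    by case: (p \in \bigcup_k F k); case: (p \in U n);
       rewrite ?subrr ?subr0 ?sub0r ?normrN ?normr0 ?normr1.
Qed.

(** Dynkin's theorem: the sets whose trace on Box N has an approximable indicator
    contain the open boxes, which are stable under intersection, and form a
    Dynkin class by dominated convergence. *)
Lemma approximable_indic N (S : set V) : measurable S ->
  approximable (\1_(S `&` Box N)).
Proof.
move=> mS; have := measurable_sub_boxes mS.
rewrite -(setI_closed_g_dynkin_g_sigma_algebra setI_closed_G) => h.
by have [] : good N S by apply: h; split; [exact: dynkin_good|exact: good_box].
Qed.

Let box_exhaust (p : V) : D p -> exists N, forall n, (N <= n)%N -> Box n p.
Proof.
move=> [p1 _]; have [N hN] := coord_bound p.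
exists N => n Nn; split; first by move: p1; rewrite /= in_itv.
move=> i; have := hN i; rewrite ltr_norml => /andP[h1 h2].
have nN : (N%:R : R) <= n%:R by rewrite ler_nat.
by apply/andP; split; lra.
Qed.

(** Simple functions increasing to f, cut down to growing boxes. *)
Lemma approximable_ge0 (f : V -> R) : measurable_fun [set: V] f -> (forall p, 0 <= f p) ->
  (sqnorm2 T f < +oo)%E -> approximable f.
Proof.
move=> mf f0 foo.
have mEf : measurable_fun [set: V] (EFin \o f) by exact: measurable_EFin_on.
pose s := nnsfun_approx measurableT mEf.
have s_cvg (p : V) : s n p @[n --> \oo] --> f p.
  have /fine_cvgP[_ h] := @cvg_nnsfun_approx _ _ _ _ measurableT _ mEf (fun p _ => f0 p) p I.
  exact: h.
have s_le n (p : V) : s n p <= f p.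
  have nds : nondecreasing_seq (fun n => s n p).
    by move=> a b ab; have /lefP := @nd_nnsfun_approx _ _ _ _ measurableT _ mEf a b ab; exact.
  rewrite -(cvg_lim _ (s_cvg p)) //; apply: nondecreasing_cvgn_le => //.
  by apply: cvgP; exact: s_cvg.
have s_ge0 n (p : V) : 0 <= s n p by exact: fun_ge0.
apply: (@approximable_lim (fun n p => s n p * \1_(Box n) p) f f) => //.
- move=> n.
  have fs : finite_set (range (s n)) by exact: fimfunP.
  rewrite (_ : (fun p => _) = fun p : V => \sum_(y <- finmap.enum_fset (fset_set (range (s n))))
      y * \1_((s n @^-1` [set y]) `&` Box n) p).
    apply: approximable_sum => y _; apply: approximableZ; apply: approximable_indic.
    exact: measurable_sfunP.
  apply/funext => p; rewrite {1}fimfunE (fsbig_finite _ _ fs)/= mulr_suml.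
  by apply: eq_bigr => y _; rewrite indicI/= mulrA.
- move=> p Dp; apply: cvg_trans (s_cvg p); apply: near_eq_cvg.
  have [N hN] := box_exhaust Dp.
  exists N => // n /= Nn; rewrite indicE mem_set ?mulr1//; exact: hN.
- move=> n p; rewrite indicE; case: (_ \in _); rewrite ?mulr1 ?mulr0 ?subr0//.
  by rewrite !ger0_norm ?subr_ge0 ?f0// gerBl.
Qed.

(** Test functions are dense in L^2 of spacetime. *)
Theorem approximableP (f : V -> R) : measurable_fun [set: V] f ->
  (sqnorm2 T f < +oo)%E -> approximable f.
Proof.
move=> mf foo.
have mabs : measurable_fun [set: V] (fun p => `|f p|) by exact: measurableT_comp.
have m1 : measurable_fun [set: V] (fun p => Num.max (f p) 0) by exact: measurable_maxr.
have m2 : measurable_fun [set: V] (fun p => Num.max (- f p) 0).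
  by apply: measurable_maxr => //; exact: measurable_funN.
rewrite (_ : f = fun p => Num.max (f p) 0 - Num.max (- f p) 0).
  apply: approximableB; apply: approximable_ge0 => //.
  - by move=> p; rewrite le_max lexx orbT.
  - apply: le_lt_trans foo; apply: le_sqnorm2 => // p.
    by case: (leP (f p) 0) => h; rewrite ?normr0.
  - by move=> p; rewrite le_max lexx orbT.
  - apply: le_lt_trans foo; apply: le_sqnorm2 => // p.
    by case: (leP (- f p) 0) => h; rewrite ?normr0// normrN.
apply/funext => p; case: (leP (f p) 0) => h.
  by case: leP => h'; lra.
by case: leP => h'; lra.
Qed.

End density.

(** * Continuity of the kernel form in L^2 *)

Section kernel_square.
Context {R : realType} (d : nat) (T H : R).
Local Notation lambda := (@lebesgue_measure R).
Local Notation mu := (@lebesgue_rV R d).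
Local Notation V := (R * 'rV[R]_d)%type.
Local Notation A := (`[0%R, T]%classic : set R).

Let k (u v : R) : R := `|u - v| `^ (2 * H - 2).

Let k_ge0 u v : 0 <= k u v. Proof. exact: powR_ge0. Qed.

Let measurable_k : measurable_fun [set: R * R] (fun p : R * R => k p.1 p.2).
Proof.
by apply: measurable_fun_powR; apply: measurableT_comp => //; exact: measurable_funB.
Qed.

Let measurable_kernel_space (phi : V -> R) : measurable_fun [set: V] phi ->
  measurable_fun [set: (R * R) * 'rV[R]_d] (fun q =>
    (`|phi (q.1.1, q.2)| * `|phi (q.1.2, q.2)| * `|q.1.1 - q.1.2| `^ (2 * H - 2))%:E).
Proof.
move=> mphi; apply: measurable_EFin_on; apply: measurable_funM.
  apply: measurable_funM; apply: measurableT_comp => //;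
    apply: (measurableT_comp mphi); apply: measurable_fun_pair => //; exact: measurableT_comp.
apply: measurable_fun_powR; apply: measurableT_comp => //.
by apply: measurable_funB; exact: measurableT_comp.
Qed.

Let measurable_kernel_pair (phi : V -> R) : measurable_fun [set: V] phi ->
  measurable_fun [set: R * R] (fun p : R * R => \int[mu]_x
    (`|phi (p.1, x)| * `|phi (p.2, x)| * `|p.1 - p.2| `^ (2 * H - 2))%:E)%E.
Proof.
move=> mphi; apply: (@measurable_int_rV _ _ _ _ (fun q : (R * R) * 'rV[R]_d =>
    (`|phi (q.1.1, q.2)| * `|phi (q.1.2, q.2)| * `|q.1.1 - q.1.2| `^ (2 * H - 2))%:E)).
exact: measurable_kernel_space.
Qed.

Let measurable_kernel_inner (phi : V -> R) : measurable_fun [set: V] phi ->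
  measurable_fun [set: R] (fun u => \int[lambda]_(v in A) \int[mu]_x
    (`|phi (u, x)| * `|phi (v, x)| * `|u - v| `^ (2 * H - 2))%:E)%E.
Proof.
move=> mphi; apply: (@measurable_int_line _ _ _ A (fun p : R * R => \int[mu]_x
    (`|phi (p.1, x)| * `|phi (p.2, x)| * `|p.1 - p.2| `^ (2 * H - 2))%:E)%E) => //.
exact: measurable_kernel_pair.
Qed.

Let measurable_kernel_inner2 u (phi : V -> R) : measurable_fun [set: V] phi ->
  measurable_fun [set: R] (fun v => \int[mu]_x
    (`|phi (u, x)| * `|phi (v, x)| * `|u - v| `^ (2 * H - 2))%:E)%E.
Proof.
move=> mphi.
exact: (measurableT_comp (measurable_kernel_pair mphi) (pair1_measurable u)).
Qed.

(** Schur's test: |phi(u, x) phi(v, x)| is at most the half-sum of the squares, and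
    the kernel |u - v|^(2H-2) has integral at most C over v in [0, T], for every u. *)
Lemma kernel_form_le_sqnorm2 (phi : V -> R) : 0 < T -> 2^-1 < H < 1 ->
  measurable_fun [set: V] phi ->
  (kernel_form T H phi <= (2 * (T `^ (2 * H - 1) / (2 * H - 1)))%:E * sqnorm2 T phi)%E.
Proof.
move=> T0 /andP[H2 H1] mphi; rewrite sqnorm2E//.
set C := 2 * _.
have kC u : 0 <= u <= T -> (\int[lambda]_(v in A) (k u v)%:E <= C%:E)%E.
  move=> uT; have := @riesz_kernel_le R (2 * H - 2) T u.
  rewrite /C (_ : 2 * H - 2 + 1 = 2 * H - 1); last by ring.
  by apply=> //; lra.
pose N u := (\int[mu]_x (phi (u, x) ^+ 2)%:E)%E.
have mphi2 : measurable_fun [set: V] (fun p => (phi p ^+ 2)%:E) by exact: measurable_sqr.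
have N0 u : (0 <= N u)%E by apply: integral_ge0 => x _; rewrite lee_fin sqr_ge0.
have mN : measurable_fun [set: R] N.
  exact: (@measurable_int_rV _ _ _ _ (fun p : V => (phi p ^+ 2)%:E)).
have mxN u : measurable_fun [set: 'rV[R]_d] (fun x => (phi (u, x) ^+ 2)%:E).
  exact: (measurableT_comp mphi2 (pair1_measurable u)).
have mkE : measurable_fun [set: R * R] (fun p : R * R => (k p.1 p.2 / 2)%:E).
  by apply: measurable_EFin_on; exact: measurable_funM.
have mku u : measurable_fun [set: R] (fun v : R => (k u v / 2)%:E).
  exact: (measurableT_comp mkE (pair1_measurable u)).
have k20 u v : (0 <= (k u v / 2)%:E)%E by rewrite lee_fin divr_ge0.
have step u v : (\int[mu]_x (`|phi (u, x)| * `|phi (v, x)| * `|u - v| `^ (2 * H - 2))%:E <=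
    (k u v / 2)%:E * N u + (k u v / 2)%:E * N v)%E.
  rewrite /N -ge0_integralZl //; last by move=> x _; rewrite lee_fin sqr_ge0.
  rewrite -[X in (_ <= _ + X)%E]ge0_integralZl //; last by move=> x _; rewrite lee_fin sqr_ge0.
  rewrite -ge0_integralD //; first last.
  - exact: emeasurable_funM.
  - by move=> x _; rewrite mule_ge0// lee_fin sqr_ge0.
  - exact: emeasurable_funM.
  - by move=> x _; rewrite mule_ge0// lee_fin sqr_ge0.
  apply: ge0_le_integral => //.
  - have mx w : measurable_fun [set: 'rV[R]_d] (fun x => `|phi (w, x)|).
      by apply: measurableT_comp => //; exact: (measurableT_comp mphi (pair1_measurable w)).
    by apply: measurable_EFin_on; apply: measurable_funM => //; exact: measurable_funM.
  - by apply: emeasurable_funD; exact: emeasurable_funM.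
  - move=> x _; rewrite -!EFinM -EFinD lee_fin -/(k u v).
    rewrite -[phi (u, x) ^+ 2]real_normK ?num_real// -[phi (v, x) ^+ 2]real_normK ?num_real//.
    have := sqr_ge0 (`|phi (u, x)| - `|phi (v, x)|); have := k_ge0 u v.
    move: (k u v) (`|phi (u, x)|) (`|phi (v, x)|) => w a b w0 ab; nra.
have mF1 : measurable_fun [set: R * R] (fun p : R * R => ((k p.1 p.2 / 2)%:E * N p.1)%E).
  by apply: emeasurable_funM => //; exact: (measurableT_comp mN).
have mF2 : measurable_fun [set: R * R] (fun p : R * R => ((k p.1 p.2 / 2)%:E * N p.2)%E).
  by apply: emeasurable_funM => //; exact: (measurableT_comp mN).
have half (u : R) : A u -> (\int[lambda]_(v in A) ((k u v / 2)%:E * N u) <= (C / 2)%:E * N u)%E.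
  have mA : measurable_fun A (fun v : R => (k u v / 2)%:E) by exact: measurable_funTS.
  move=> uA; rewrite ge0_integralZr //.
  apply: lee_wpmul2r => //.
  under eq_integral do rewrite EFinM.
  rewrite ge0_integralZr //.
  - by rewrite EFinM; apply: lee_wpmul2r; [rewrite lee_fin|apply: kC; move: uA; rewrite /= in_itv].
  - apply: measurable_funTS.
    by apply: measurable_EFin_on; exact: (measurableT_comp measurable_k (pair1_measurable u)).
  - by move=> v _; rewrite lee_fin.
have mI1 : measurable_fun A (fun u => \int[lambda]_(v in A) ((k u v / 2)%:E * N u))%E.
  apply: measurable_funTS.
  exact: (@measurable_int_line _ _ _ A (fun p : R * R => ((k p.1 p.2 / 2)%:E * N p.1)%E)).
have mI2 : measurable_fun A (fun u => \int[lambda]_(v in A) ((k u v / 2)%:E * N v))%E.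
  apply: measurable_funTS.
  exact: (@measurable_int_line _ _ _ A (fun p : R * R => ((k p.1 p.2 / 2)%:E * N p.2)%E)).
have mNA : measurable_fun A N by exact: measurable_funTS.
have C0 : 0 <= C.
  by rewrite mulr_ge0// divr_ge0 ?powR_ge0//; lra.
have IN0 : (0 <= \int[lambda]_(u in A) N u)%E by exact: integral_ge0.
have b1 : (\int[lambda]_(u in A) \int[lambda]_(v in A) ((k u v / 2)%:E * N u) <=
    (C / 2)%:E * \int[lambda]_(u in A) N u)%E.
  rewrite -ge0_integralZl //; last by rewrite lee_fin divr_ge0.
  apply: ge0_le_integral; [exact: measurable_itv| |exact: mI1| |exact: half].
  - by move=> u _; apply: integral_ge0 => v _; exact: mule_ge0.
  - by apply: emeasurable_funM.
have b2 : (\int[lambda]_(u in A) \int[lambda]_(v in A) ((k u v / 2)%:E * N v) <=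
    (C / 2)%:E * \int[lambda]_(u in A) N u)%E.
  apply: le_trans b1; rewrite le_eqVlt; apply/orP; left; apply/eqP.
  transitivity (\int[lambda]_(v in A) \int[lambda]_(u in A) ((k u v / 2)%:E * N v))%E.
    apply: (@tonelli_plane _ A A (fun p : R * R => ((k p.1 p.2 / 2)%:E * N p.2)%E)) => //.
    by move=> p; exact: mule_ge0.
  by apply: eq_integral => v _; apply: eq_integral => u _; rewrite /k distrC.
apply: (@le_trans _ _ (\int[lambda]_(u in A) (\int[lambda]_(v in A) ((k u v / 2)%:E * N u) +
   \int[lambda]_(v in A) ((k u v / 2)%:E * N v)))%E).
  apply: ge0_le_integral; first exact: measurable_itv.
  - move=> u _; apply: integral_ge0 => v _; apply: integral_ge0 => x _.
    by rewrite lee_fin mulr_ge0 ?powR_ge0// mulr_ge0.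
  - exact: measurable_funTS (measurable_kernel_inner mphi).
  - exact: (emeasurable_funD mI1 mI2).
  move=> u uA; have m1 : measurable_fun A (fun v => (k u v / 2)%:E * N u)%E.
    by apply: measurable_funTS; exact: emeasurable_funM.
  have m2 : measurable_fun A (fun v => (k u v / 2)%:E * N v)%E.
    by apply: measurable_funTS; exact: emeasurable_funM.
  rewrite -ge0_integralD; [|by []|by move=> v _; exact: mule_ge0|exact: m1|by move=> v _; exact: mule_ge0|exact: m2].
  apply: ge0_le_integral; first exact: measurable_itv.
  - move=> v _; apply: integral_ge0 => x _.
    by rewrite lee_fin mulr_ge0 ?powR_ge0// mulr_ge0.
  - exact: measurable_funTS (measurable_kernel_inner2 u mphi).
  - exact: (emeasurable_funD m1 m2).
  - by move=> v _; exact: step.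
rewrite ge0_integralD; [|by []| |exact: mI1| |exact: mI2].
- apply: (le_trans (leeD b1 b2)).
  by rewrite -ge0_muleDl ?lee_fin ?divr_ge0// -EFinD -splitr.
- by move=> u _; apply: integral_ge0 => v _; exact: mule_ge0.
- by move=> u _; apply: integral_ge0 => v _; exact: mule_ge0.
Qed.

End kernel_square.

(** * The backward heat convolution of a test function *)

Section test_function_bounds.
Context {R : realType} (d : nat).
Local Notation V := (R * 'rV[R]_d)%type.

Lemma test_function_continuous (U : set V) (f : V -> R) :
  test_function U f -> continuous f.
Proof. by move=> [sf _ _] p; apply: differentiable_continuous; exact: (sf [::] p). Qed.

Lemma test_function_support (U : set V) (f : V -> R) p :
  test_function U f -> f p != 0 -> U p.
Proof. by move=> [_ _ fU] fp; apply: fU; apply: subset_closure. Qed.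

Lemma coord_le_norm (v : 'rV[R]_d) i : `|v ord0 i| <= `|v|.
Proof.
rewrite {2}/Num.Def.normr/= mx_normrE.
exact: (le_bigmax _ (fun ij : 'I_1 * 'I_d => `|v ij.1 ij.2|) (ord0, i)).
Qed.

Lemma test_function_bounded (U : set V) (f : V -> R) : test_function U f ->
  exists2 M : R, 0 <= M & forall p, `|f p| <= M.
Proof.
move=> tf; have cf := test_function_continuous tf.
have [_ cK _] := tf; set K := closure _ in cK.
have : compact (f @` K).
  by apply: continuous_compact => //; exact: continuous_subspaceT.
move=> /compact_bounded [M0 [_ hM]].
exists (Num.max 0 (M0 + 1)); first by rewrite le_max lexx.
move=> p; have [->|fp] := eqVneq (f p) 0; first by rewrite normr0 le_max lexx.
rewrite le_max; apply/orP; right; apply: (hM (M0 + 1)); first by rewrite ltrDl.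
by exists p => //; exact: subset_closure.
Qed.

Lemma test_function_space_bounded (U : set V) (f : V -> R) : test_function U f ->
  exists2 L : R, 0 <= L & forall p, f p != 0 -> forall i, `|p.2 ord0 i| <= L.
Proof.
move=> [_ cK _]; set K := closure _ in cK.
have [M0 [_ hM]] := compact_bounded cK.
exists (Num.max 0 (M0 + 1)); first by rewrite le_max lexx.
move=> p fp i; rewrite le_max; apply/orP; right.
have Kp : K p by exact: subset_closure.
have M1 : M0 < M0 + 1 by rewrite ltrDl.
apply: le_trans (hM _ M1 _ Kp); apply: (le_trans (coord_le_norm _ _)).
by rewrite prod_normE le_max lexx orbT.
Qed.

End test_function_bounds.

Section backward_convolution.
Context {R : realType} (d : nat) (T : R) (eta : R * 'rV[R]_d -> R).
Local Notation lambda := (@lebesgue_measure R).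
Local Notation mu := (@lebesgue_rV R d).
Local Notation V := (R * 'rV[R]_d)%type.
Local Notation P := (`[0%R, +oo[%classic : set R).
Hypothesis T0 : 0 < T.
Hypothesis teta : test_function (spacetime T) eta.

Let F (p : V) (s : R) (y : 'rV[R]_d) : R := eta (p.1 + s, p.2 + y) * heat s y.

Let measurable_eta : measurable_fun [set: V] eta.
Proof. exact: continuous_measurable_fun_rV (test_function_continuous teta). Qed.

Local Notation W := ((V * R) * 'rV[R]_d)%type.

Let m111 : measurable_fun [set: W] (fun q : W => q.1.1.1).
Proof. by apply: measurableT_comp => //; exact: measurableT_comp. Qed.

Let m112 : measurable_fun [set: W] (fun q : W => q.1.1.2).
Proof. by apply: measurableT_comp => //; exact: measurableT_comp. Qed.

Let m12 : measurable_fun [set: W] (fun q : W => q.1.2).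
Proof. exact: measurableT_comp. Qed.

Let measurable_F : measurable_fun [set: W]
  (fun q => F q.1.1 q.1.2 q.2).
Proof.
apply: measurable_funM; last by apply: measurable_fun_heat => //; exact: measurable_snd.
have hh : measurable_fun [set: W]
   (fun q : W => (q.1.1.1 + q.1.2, q.1.1.2 + q.2)).
  apply: measurable_fun_pair; first exact: measurable_funD.
  apply: measurable_fun_rV => i.
  rewrite (_ : (fun q => _) = fun q : W => q.1.1.2 ord0 i + q.2 ord0 i); last first.
    by apply/funext => q; rewrite mxE.
  apply: measurable_funD; first exact: (measurableT_comp (measurable_coord i) m112).
  exact: (measurableT_comp (measurable_coord i) measurable_snd).
exact: (measurableT_comp measurable_eta hh).
Qed.

Let measurable_inner : measurable_fun [set: V * R] (fun q => \int[mu]_y F q.1 q.2 y).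
Proof.
exact: (@measurable_Rint_param _ _ _ _ R mu setT (fun q : W => F q.1.1 q.1.2 q.2)).
Qed.

Lemma measurable_conv : measurable_fun [set: V] (conv_heat_rev eta).
Proof.
exact: (@measurable_Rint_line _ _ _ P (fun q : V * R => \int[mu]_y F q.1 q.2 y)).
Qed.

Let measurable_inner_at p : measurable_fun [set: R] (fun s => \int[mu]_y F p s y).
Proof.
exact: (measurableT_comp measurable_inner (pair1_measurable p)).
Qed.

Let measurable_F_at p s : measurable_fun [set: 'rV[R]_d] (F p s).
Proof.
exact: (measurableT_comp measurable_F (pair1_measurable (p, s))).
Qed.

Lemma integral_heat_le1 (s : R) : (\int[mu]_y (heat s y)%:E <= 1)%E.
Proof.
have [s0|s0] := ltP 0 s; last first.
  by rewrite integral0_eq ?lee_fin// => y _; rewrite heat_le0.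
rewrite -(integral_heat (0 : 'rV[R]_d) s0) le_eqVlt; apply/orP; left; apply/eqP.
apply: eq_integral => y _.
have sq : sqnorm (0 - y) = sqnorm y.
  by apply: eq_bigr => i _; rewrite !mxE sub0r sqrrN.
by rewrite /heat sq.
Qed.

(* Majorant of F: eta is bounded and vanishes outside ]0, T[ x [-L, L]^d.  Its
   integral over y is at most M 1_]0, T[(t + s), which gives boundedness; its
   integral over y and x is a constant times the same indicator, which gives
   integrability over [0, T] x R^d. *)
Let window (M L : R) (p : V) (s : R) (y : 'rV[R]_d) : R :=
  M * \1_(`]0, T[%classic) (p.1 + s) *
  ((\prod_(i < d) \1_(`[- L, L]%classic) (p.2 ord0 i + y ord0 i)) * heat s y).

Let indic_ge0 (S : set R) (x : R) : 0 <= \1_S x :> R.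
Proof. by rewrite indicE. Qed.

Let window_ge0 M L p s y : 0 <= M -> 0 <= window M L p s y.
Proof.
move=> M0; apply: mulr_ge0; first exact: mulr_ge0.
by apply: mulr_ge0; [exact: prodr_ge0|exact: heat_ge0].
Qed.

Let F_le_window : exists M L, [/\ 0 <= M, 0 <= L &
  forall p s y, `|F p s y| <= window M L p s y].
Proof.
have [M M0 hM] := test_function_bounded teta.
have [L L0 hL] := test_function_space_bounded teta.
exists M, L; split => // p s y; rewrite /F /window normrM (ger0_norm (heat_ge0 _ _)).
rewrite mulrA ler_wpM2r ?heat_ge0//.
have [->|e0] := eqVneq (eta (p.1 + s, p.2 + y)) 0.
  by rewrite normr0 mulr_ge0 ?prodr_ge0// mulr_ge0.
have [h1 _] := test_function_support teta e0.
rewrite indicE mem_set// mulr1 big1 ?mulr1// => i _.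
rewrite indicE mem_set// /= in_itv/= -ler_norml.
by have := hL _ e0 i; rewrite /= mxE.
Qed.

Let measurable_window M L : measurable_fun [set: W]
  (fun q => (window M L q.1.1 q.1.2 q.2)%:E).
Proof.
have mI (a b : R) : measurable_fun [set: R] (\1_(`[a, b]%classic) : R -> R) by exact: measurable_indic.
have mI' (a b : R) : measurable_fun [set: R] (\1_(`]a, b[%classic) : R -> R) by exact: measurable_indic.
apply: measurable_EFin_on; apply: measurable_funM.
  apply: measurable_funM => //.
  by apply: (measurableT_comp (mI' _ _)); exact: measurable_funD.
apply: measurable_funM; last by apply: measurable_fun_heat => //; exact: measurable_snd.
apply: measurable_prod => i _; apply: (measurableT_comp (mI _ _)).
apply: measurable_funD; first exact: (measurableT_comp (measurable_coord i) m112).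
exact: (measurableT_comp (measurable_coord i) measurable_snd).
Qed.

Let conv_le_window M L p : 0 <= M -> (forall p s y, `|F p s y| <= window M L p s y) ->
  (`|conv_heat_rev eta p|%:E <= \int[lambda]_(s in P) \int[mu]_y (window M L p s y)%:E)%E.
Proof.
move=> M0 FW.
have mw : measurable_fun [set: R * 'rV[R]_d] (fun q => (window M L p q.1 q.2)%:E).
  have hh : measurable_fun [set: R * 'rV[R]_d] (fun q : R * 'rV[R]_d => ((p, q.1), q.2)).
    by apply: measurable_fun_pair => //; exact: measurable_fun_pair.
  exact: (measurableT_comp (measurable_window M L) hh).
apply: (le_trans (@le_abs_Rintegral _ _ R lambda P _ _ _)) => //.
  exact: measurable_funTS (measurable_inner_at p).
apply: ge0_le_integral => //.
- have h : measurable_fun [set: R] (fun s => `|\int[mu]_y F p s y|) by exact: measurableT_comp.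
  exact: (measurable_EFin_on (D := P) h).
- by apply: measurable_funTS; exact: (@measurable_int_rV _ _ _ _ (fun q : R * 'rV[R]_d => (window M L p q.1 q.2)%:E)).
move=> s _; apply: (le_trans (le_abs_Rintegral _ _ _)) => //.
  exact: (measurable_F_at p s).
apply: ge0_le_integral => //.
- have h : measurable_fun [set: 'rV[R]_d] (fun y => `|F p s y|).
    by apply: measurableT_comp => //; exact: measurable_F_at.
  exact: measurable_EFin_on.
- exact: (measurableT_comp mw (pair1_measurable s)).
- by move=> y _; rewrite lee_fin; exact: FW.
Qed.

Let integral_time_window (t : R) :
  (\int[lambda]_(s in P) (\1_(`]0, T[%classic) (t + s))%:E <= T%:E)%E.
Proof.
have mI : measurable_fun [set: R] (\1_(`]0, T[%classic) : R -> R) by exact: measurable_indic.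
have mI2 : measurable_fun [set: R] (fun s : R => (\1_(`]0, T[%classic) (1 * s + t) : R)%:E).
  apply: measurable_EFin_on; apply: (measurableT_comp mI).
  by apply: measurable_funD => //; exact: measurable_funM.
apply: (@le_trans _ _ (\int[lambda]_s (\1_(`]0, T[%classic) (1 * s + t))%:E)%E).
  under eq_integral do rewrite addrC -[X in X + t]mul1r.
  by apply: ge0_subset_integral => //; move=> s _; rewrite lee_fin.
have := @ge0_integral_affine R 1 t (fun x => (\1_(`]0, T[%classic) x)%:E) (oner_neq0 _).
rewrite normr1 mul1e => <-.
- by rewrite integral_indic//= setIT lebesgue_measure_itv/= lte_fin T0 sube0.
- exact: measurable_EFin_on.
- by move=> x; rewrite lee_fin.
Qed.

Let spread (L : R) (x y : 'rV[R]_d) : R :=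
  \prod_(i < d) \1_(`[- L, L]%classic) (x ord0 i + y ord0 i).

Let spread_ge0 L x y : 0 <= spread L x y.
Proof. exact: prodr_ge0. Qed.

Let spread_le1 L x y : spread L x y <= 1.
Proof.
by apply: prodr_ile1 => i; rewrite indic_ge0/= indicE; case: (_ \in _).
Qed.

Let integral_spread (L : R) y : 0 <= L ->
  (\int[mu]_x (spread L x y)%:E = ((2 * L) ^+ d)%:E)%E.
Proof.
move=> L0; rewrite /spread.
rewrite (@integral_rV_prod _ _ (fun i x => \1_(`[- L, L]%classic) (x + y ord0 i)) (fun=> 2 * L)) //.
- by rewrite prodr_const card_ord.
- move=> i; apply: (@measurableT_comp _ _ _ _ _ _ (\1_(`[- L, L]%classic) : R -> R)).
    exact: measurable_indic.
  exact: measurable_funD.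
- move=> i; have mI : measurable_fun [set: R] (fun x : R => (\1_(`[- L, L]%classic) x : R)%:E).
    by apply: measurable_EFin_on; exact: measurable_indic.
  have := @ge0_integral_affine R 1 (y ord0 i) _ (oner_neq0 _) mI (fun x => indic_ge0 _ _).
  rewrite normr1 mul1e; under [in RHS]eq_integral do rewrite mul1r.
  move=> <-; rewrite integral_indic//= setIT lebesgue_measure_itv/= lte_fin.
  case: ifPn => [_|]; first by rewrite -EFinB; congr EFin; ring.
  by rewrite -leNgt => h; congr EFin; lra.
Qed.

Let measurable_heat_at s : measurable_fun [set: 'rV[R]_d] (fun y : 'rV[R]_d => (heat s y)%:E).
Proof. by apply: measurable_EFin_on; exact: measurable_fun_heat. Qed.

Let measurable_time t : measurable_fun P (fun s : R => (\1_(`]0, T[%classic) (t + s) : R)%:E).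
Proof.
have mI : measurable_fun [set: R] (\1_(`]0, T[%classic) : R -> R) by exact: measurable_indic.
by apply: measurable_EFin_on; apply: (measurableT_comp mI); exact: measurable_funD.
Qed.

Let measurable_spread L : measurable_fun [set: 'rV[R]_d * 'rV[R]_d]
  (fun q => (spread L q.1 q.2)%:E).
Proof.
have mI (a b : R) : measurable_fun [set: R] (\1_(`[a, b]%classic) : R -> R) by exact: measurable_indic.
apply: measurable_EFin_on; apply: measurable_prod => i _; apply: (measurableT_comp (mI _ _)).
by apply: measurable_funD; apply: (measurableT_comp (measurable_coord i)).
Qed.

Let integral_window_y (M L : R) p s : 0 <= M ->
  (\int[mu]_y (window M L p s y)%:E <= M%:E * (\1_(`]0, T[%classic) (p.1 + s))%:E)%E.
Proof.
move=> M0; have m0 : 0 <= M * \1_(`]0, T[%classic) (p.1 + s) by exact: mulr_ge0.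
apply: (@le_trans _ _ ((M * \1_(`]0, T[%classic) (p.1 + s))%:E * \int[mu]_y (heat s y)%:E)%E).
  rewrite -ge0_integralZl //; last by move=> y _; rewrite lee_fin heat_ge0.
  apply: ge0_le_integral => //.
  - by move=> y _; rewrite lee_fin window_ge0.
  - exact: (measurableT_comp (measurable_window M L) (pair1_measurable (p, s))).
  - exact: emeasurable_funM.
  - move=> y _; rewrite -EFinM lee_fin; apply: ler_wpM2l => //.
    by apply: ler_piMl; [exact: heat_ge0|exact: spread_le1].
rewrite -EFinM -[leRHS]mule1; apply: lee_wpmul2l; first by rewrite lee_fin.
exact: integral_heat_le1.
Qed.

Let measurable_window_y M L p : measurable_fun P (fun s : R => \int[mu]_y (window M L p s y)%:E)%E.
Proof.
apply: measurable_funTS.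
have hh : measurable_fun [set: R * 'rV[R]_d] (fun q : R * 'rV[R]_d => ((p, q.1), q.2)).
  by apply: measurable_fun_pair => //; exact: measurable_fun_pair.
exact: (@measurable_int_rV _ _ _ _ (fun q : R * 'rV[R]_d => (window M L p q.1 q.2)%:E)
  (measurableT_comp (measurable_window M L) hh)).
Qed.

Let time_bound (M t : R) : 0 <= M ->
  (\int[lambda]_(s in P) (M%:E * (\1_(`]0, T[%classic) (t + s))%:E) <= (M * T)%:E)%E.
Proof.
move=> M0; rewrite ge0_integralZl //; last exact: measurable_time.
by rewrite EFinM; apply: lee_wpmul2l => //; exact: integral_time_window.
Qed.

Lemma conv_bounded : exists2 B : R, 0 <= B & forall p, `|conv_heat_rev eta p| <= B.
Proof.
have [M [L [M0 L0 FW]]] := F_le_window.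
exists (M * T); first by rewrite mulr_ge0// ltW.
move=> p; rewrite -lee_fin; apply: (le_trans (conv_le_window p M0 FW)).
apply: le_trans (time_bound p.1 M0); apply: ge0_le_integral => //.
- by move=> s _; apply: integral_ge0 => y _; rewrite lee_fin window_ge0.
- exact: measurable_window_y.
- by apply: emeasurable_funM => //; exact: measurable_time.
- by move=> s _; exact: integral_window_y.
Qed.

Let integral_window_xy (M L t s : R) : 0 <= M -> 0 <= L ->
  (\int[mu]_x \int[mu]_y (window M L (t, x) s y)%:E <=
   (M * (2 * L) ^+ d)%:E * (\1_(`]0, T[%classic) (t + s))%:E)%E.
Proof.
move=> M0 L0; set c := M * \1_(`]0, T[%classic) (t + s).
have c0 : 0 <= c by exact: mulr_ge0.
have mw : measurable_fun [set: 'rV[R]_d * 'rV[R]_d] (fun q => (window M L (t, q.1) s q.2)%:E).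
  have hh : measurable_fun [set: 'rV[R]_d * 'rV[R]_d]
      (fun q : 'rV[R]_d * 'rV[R]_d => (((t, q.1), s), q.2)).
    by apply: measurable_fun_pair => //; apply: measurable_fun_pair => //; exact: measurable_fun_pair.
  exact: (measurableT_comp (measurable_window M L) hh).
have -> : (\int[mu]_x \int[mu]_y (window M L (t, x) s y)%:E =
    \int[mu]_y \int[mu]_x (window M L (t, x) s y)%:E)%E.
  apply: (@tonelli_in _ _ _ _ R mu mu setT setT (fun q => (window M L (t, q.1) s q.2)%:E)) => //.
  by move=> q; rewrite lee_fin window_ge0.
have ms y : measurable_fun [set: 'rV[R]_d] (fun x => (spread L x y)%:E).
  exact: (measurableT_comp (measurable_spread L) (pair2_measurable y)).
under eq_integral => y _.
  under eq_integral => x _.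
    rewrite (_ : (window M L (t, x) s y)%:E = (c * heat s y)%:E * (spread L x y)%:E)%E; last first.
      by rewrite -EFinM; congr EFin; rewrite /window -/c -/(spread L x y); ring.
    over.
  rewrite ge0_integralZl //; last first.
  - by rewrite lee_fin mulr_ge0 ?heat_ge0.
  - by move=> x _; rewrite lee_fin spread_ge0.
  rewrite (integral_spread _ L0) -EFinM mulrAC.
  over.
rewrite /=.
under eq_integral do rewrite EFinM.
rewrite ge0_integralZl //; last first.
- by rewrite lee_fin mulr_ge0// exprn_ge0// mulr_ge0.
- by move=> y _; rewrite lee_fin heat_ge0.
rewrite (_ : M * (2 * L) ^+ d = (2 * L) ^+ d * M) 1?mulrC// -EFinM.
rewrite (_ : (2 * L) ^+ d * M * \1_(`]0, T[%classic) (t + s) = (2 * L) ^+ d * c); last by rewrite /c; ring.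
rewrite -[leRHS]mule1; apply: lee_wpmul2l; last exact: integral_heat_le1.
by rewrite lee_fin mulr_ge0// exprn_ge0// mulr_ge0.
Qed.

Let measurable_abs_conv : measurable_fun [set: V] (fun p => `|conv_heat_rev eta p|%:E).
Proof.
apply: measurable_EFin_on; apply: measurableT_comp => //; exact: measurable_conv.
Qed.

Lemma conv_integrable :
  (\int[lambda]_(t in `[0%R, T]) \int[mu]_x `|conv_heat_rev eta (t, x)|%:E < +oo)%E.
Proof.
have [M [L [M0 L0 FW]]] := F_le_window.
pose N := M * (2 * L) ^+ d; have N0 : 0 <= N by rewrite mulr_ge0// exprn_ge0// mulr_ge0.
apply: (@le_lt_trans _ _ (\int[lambda]_(t in `[0%R, T]) (N * T)%:E)%E); last first.
  by rewrite integral_cst//= lebesgue_measure_itv/=; case: ifP => _; rewrite ?mule0 ltry.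
apply: ge0_le_integral => //.
- by move=> t _; apply: integral_ge0 => x _; rewrite lee_fin.
- apply: measurable_funTS.
  exact: (@measurable_int_rV _ _ _ _ (fun p : V => `|conv_heat_rev eta p|%:E)).
move=> t _; apply: le_trans (time_bound t N0).
have mw : measurable_fun [set: 'rV[R]_d * R]
    (fun q => \int[mu]_y (window M L (t, q.1) q.2 y)%:E)%E.
  have hh : measurable_fun [set: ('rV[R]_d * R) * 'rV[R]_d]
      (fun q : ('rV[R]_d * R) * 'rV[R]_d => (((t, q.1.1), q.1.2), q.2)).
    apply: measurable_fun_pair => //; apply: measurable_fun_pair; last exact: measurableT_comp.
    by apply: measurable_fun_pair => //; exact: measurableT_comp.
  exact: (@measurable_int_rV _ _ _ _
    (fun q : ('rV[R]_d * R) * 'rV[R]_d => (window M L (t, q.1.1) q.1.2 q.2)%:E)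
    (measurableT_comp (measurable_window M L) hh)).
have w0 x s : (0 <= \int[mu]_y (window M L (t, x) s y)%:E)%E.
  by apply: integral_ge0 => y _; rewrite lee_fin window_ge0.
apply: (@le_trans _ _ (\int[mu]_x \int[lambda]_(s in P) \int[mu]_y (window M L (t, x) s y)%:E)%E).
  apply: ge0_le_integral => //.
  - exact: (measurableT_comp measurable_abs_conv (pair1_measurable t)).
  - exact: (@measurable_int_line _ _ _ P (fun q : 'rV[R]_d * R => \int[mu]_y (window M L (t, q.1) q.2 y)%:E)%E).
  - by move=> x _; exact: conv_le_window.
have -> : (\int[mu]_x \int[lambda]_(s in P) \int[mu]_y (window M L (t, x) s y)%:E =
    \int[lambda]_(s in P) \int[mu]_x \int[mu]_y (window M L (t, x) s y)%:E)%E.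
  apply: (@tonelli_line _ _ _ mu setT P
    (fun q : 'rV[R]_d * R => \int[mu]_y (window M L (t, q.1) q.2 y)%:E)%E) => //.
apply: ge0_le_integral => //.
- by move=> s _; exact: integral_ge0.
- apply: measurable_funTS.
  exact: (@measurable_int_rV _ _ _ _
    (fun q : R * 'rV[R]_d => \int[mu]_y (window M L (t, q.2) q.1 y)%:E)%E (measurableT_comp mw (@measurable_swap _ _ _ _))).
- by apply: emeasurable_funM => //; exact: measurable_time.
- by move=> s _; exact: integral_window_xy.
Qed.

(** A bounded integrable function is square-integrable. *)
Lemma conv_sqnorm2_lty : (sqnorm2 T (conv_heat_rev eta) < +oo)%E.
Proof.
have [B B0 hB] := conv_bounded.
have mc := measurable_conv.
have mS : measurable_fun [set: R] (fun t : R => \int[mu]_x `|conv_heat_rev eta (t, x)|%:E)%E.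
  exact: (@measurable_int_rV _ _ _ _ (fun p : V => `|conv_heat_rev eta p|%:E)).
have S0 (t : R) : (0 <= \int[mu]_x `|conv_heat_rev eta (t, x)|%:E)%E.
  by apply: integral_ge0 => x _; rewrite lee_fin.
rewrite sqnorm2E//.
apply: (@le_lt_trans _ _ (\int[lambda]_(t in `[0%R, T])
    (B%:E * \int[mu]_x `|conv_heat_rev eta (t, x)|%:E))%E); last first.
  rewrite ge0_integralZl//; last exact: measurable_funTS.
  by rewrite lte_mul_pinfty ?conv_integrable// lee_fin.
apply: ge0_le_integral => //.
- by move=> t _; apply: integral_ge0 => x _; rewrite lee_fin sqr_ge0.
- apply: measurable_funTS.
  by apply: (@measurable_int_rV _ _ _ _ (fun p : V => (conv_heat_rev eta p ^+ 2)%:E)); exact: measurable_sqr.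
- by apply: measurable_funTS; exact: emeasurable_funM.
move=> t _.
have ma := measurableT_comp measurable_abs_conv (pair1_measurable t).
rewrite -ge0_integralZl//.
apply: ge0_le_integral => //.
- by move=> x _; rewrite lee_fin sqr_ge0.
- exact: (measurableT_comp (measurable_sqr mc) (pair1_measurable t)).
- exact: emeasurable_funM.
- move=> x _; rewrite -EFinM lee_fin -real_normK ?num_real// expr2.
  by apply: ler_wpM2r.
Qed.

End backward_convolution.

(** * Square-integrable elements of H and the theorem *)

Section hilbert_norm.
Context {R : realType} (d : nat) (T H : R).
Local Notation lambda := (@lebesgue_measure R).
Local Notation mu := (@lebesgue_rV R d).
Local Notation V := (R * 'rV[R]_d)%type.
Hypotheses (T0 : 0 < T) (HH : 2^-1 < H < 1).

Let bounded_integrable (f : R -> R) (B : R) : measurable_fun [set: R] f ->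
  (forall u, `|f u| <= B) ->
  lambda.-integrable (`[0, T] : set R) (fun u => (f u)%:E).
Proof.
move=> mf fB; apply: (@le_integrable _ _ _ lambda _ _ _ (fun=> B%:E)) => //.
- exact: measurable_EFin_on.
- by move=> u _; rewrite /= lee_fin (le_trans (fB u))// ler_norm.
- apply/integrableP; split; first exact: measurable_cst.
  by rewrite integral_cst//= lebesgue_measure_itv/=; case: ifP => _; rewrite ?mule0 ltry.
Qed.

Lemma calH_norm_ge0 (phi : V -> R) : (0 <= calH_norm T H phi)%E.
Proof. exact: sqrte_ge0. Qed.

(** The spectral form is at most K times the kernel form, which is at most a
    multiple of the L^2 norm. *)
Lemma calH_norm2_le_sqnorm2 : exists2 C : R, 0 < C &
  forall (phi : V -> R) (B : R), measurable_fun [set: V] phi ->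
    (forall p, `|phi p| <= B) ->
    (calH_norm2 T H phi <= C%:E * sqnorm2 T phi)%E.
Proof.
have [K K0 HK] := spectral_kernel HH; have c0 := calH_const_gt0 HH.
move: (HH) => /andP[H2 H1].
pose k := 2 * (T `^ (2 * H - 1) / (2 * H - 1)).
have k0 : 0 < k by rewrite /k mulr_gt0// divr_gt0 ?powR_gt0// subr_gt0; lra.
exists (alphaH H * cH H * (K * k)); first by apply: mulr_gt0 => //; exact: mulr_gt0.
move=> phi B mphi phiB; have ix : {ae mu, forall x, lambda.-integrable (`[0, T] : set R)
    (fun u => (phi (u, x))%:E)}.
  by apply: aeW => x; apply: (@bounded_integrable _ B) => //; exact: measurable_slice.
have [hs _] := HK d T phi mphi ix.
rewrite EFinM -muleA; apply: lee_wpmul2l; first by rewrite lee_fin ltW.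
apply: (le_trans hs); rewrite EFinM -muleA.
apply: lee_wpmul2l; first by rewrite lee_fin ltW.
exact: kernel_form_le_sqnorm2.
Qed.

(** Measurability on spacetime makes the truncated Fourier transform jointly
    measurable, as a parametrized integral. *)
Lemma calH_admissible_bounded (phi : V -> R) (B : R) : measurable_fun [set: V] phi ->
  (forall p, `|phi p| <= B) -> calH_admissible T phi.
Proof.
move=> mphi phiB; split.
- move=> x; have mx := measurable_slice x mphi; split; first exact: measurable_funTS.
  have /integrableP[_] : lambda.-integrable (`[0, T] : set R) (fun u => (`|phi (u, x)| ^+ 2)%:E).
    apply: (@bounded_integrable _ (B ^+ 2)).
      by apply: measurable_funX; exact: measurableT_comp.
    by move=> u; rewrite ger0_norm ?sqr_ge0// ler_sqr ?nnegrE// (le_trans _ (phiB (u, x))).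
  by under eq_integral do rewrite gee0_abs ?lee_fin ?sqr_ge0//.
- by apply: measurable_trig_transform => //; apply: continuous_measurable_fun; exact: continuous_cos.
- apply: measurableT_comp => //.
  by apply: measurable_trig_transform => //; apply: continuous_measurable_fun; exact: continuous_sin.
Qed.

(** Test functions approximating phi in L^2 also approximate it in the norm of H,
    which is at most a multiple of the L^2 norm.  The bound on phi gives
    admissibility and the integrability in time that the comparison asks for. *)
Lemma in_calH_bounded_L2 (phi : V -> R) (B : R) : measurable_fun [set: V] phi ->
  (forall p, `|phi p| <= B) -> (sqnorm2 T phi < +oo)%E -> in_calH T H phi.
Proof.
move=> mphi phiB phioo; split; first exact: calH_admissible_bounded phiB.
have [C C0 HC] := calH_norm2_le_sqnorm2.
have [_ approx] := approximableP mphi phioo.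
(* Squared L^2 distance 1 / (C (n + 1)^2), so that the H distance is at most
   1 / (n + 1). *)
have e0 n : 0 < C^-1 * (n.+1%:R^-1) ^+ 2 by rewrite mulr_gt0 ?invr_gt0// exprn_gt0// invr_gt0.
pose phi_ n := sval (cid2 (approx _ (e0 n))).
have flat_phi n : flat_test T (phi_ n) by rewrite /phi_; case: cid2.
have near_phi n : (sqnorm2 T (fun p => phi p - phi_ n p)%R <=
    (C^-1 * (n.+1%:R^-1) ^+ 2)%:E)%E by rewrite /phi_; case: cid2.
exists phi_; split=> [n|]; first exact: flat_test_test_function.
apply: (@squeeze_cvge _ _ _ _ (fun=> 0%E) _ (fun n => (n.+1%:R^-1)%:E)).
- near=> n; rewrite calH_norm_ge0/=.
  have [M M0 phiM] := test_function_bounded (flat_test_test_function (flat_phi n)).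
  have h : (calH_norm2 T H (fun p => phi p - phi_ n p)%R <= ((n.+1%:R^-1) ^+ 2)%:E)%E.
    apply: (@le_trans _ _ (C%:E * sqnorm2 T (fun p => phi p - phi_ n p)%R)%E).
      apply: (HC _ (B + M)).
        by apply: measurable_funB => //; exact: measurable_flat_test.
      by move=> p; rewrite (le_trans (ler_normB _ _))// lerD.
    apply: (@le_trans _ _ (C%:E * (C^-1 * (n.+1%:R^-1) ^+ 2)%:E)%E).
      by apply: lee_wpmul2l => //; rewrite lee_fin ltW.
    by rewrite -EFinM mulrA mulfV ?gt_eqF// mul1r.
  have -> : (n.+1%:R^-1)%:E = sqrte ((n.+1%:R^-1) ^+ 2)%:E :> \bar R.
    by rewrite /= sqrtr_sqr ger0_norm// invr_ge0.
  by rewrite lee_sqrt// lee_fin exprn_ge0// invr_ge0.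
- exact: cvg_cst.
- apply: cvg_EFin; first by near=> n.
  exact: cvg_harmonic.
Unshelve. all: by end_near. Qed.

End hilbert_norm.

Theorem theorem2p7 (R : realType) (d : nat) (T H : R)
    (hd : (1 <= d)%N) (hT : 0 < T) (hH : 2^-1 < H < 1) :
  (d%:R / 4 < H ->
     (forall (t : R) (x : 'rV[R]_d), 0 <= t <= T ->
        in_abs_calH T H (heat_tx t x)) /\
     (forall eta : R * 'rV[R]_d -> R, test_function (spacetime T) eta ->
        in_calH T H (conv_heat_rev eta))) /\
  ((forall (t : R) (x : 'rV[R]_d), 0 <= t <= T ->
      (calH_norm T H (heat_tx t x) < +oo)%E) <-> d%:R / 4 < H).
Proof.
split; last exact: calH_norm_heat.
move=> dH; split=> [t x tT|eta teta]; first exact: in_abs_calH_heat.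
have [B _ convB] := conv_bounded hT teta.
by apply: (in_calH_bounded_L2 hT hH (measurable_conv teta) convB); exact: conv_sqnorm2_lty.
Qed.
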